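(* Let $\lambda\in P^+$ and let $\mathbb{P}_\lambda$ be the set of Generalized Lakshmibai-Seshadri paths of shape $\lambda$, with operators $e_i,f_i$ ($i\in I$) on $\mathbb{P}_\lambda$ as in the context. Let $\pi\in\mathbb{P}_\lambda$. Then $e_i\pi=0$ for all $i\in I$ if and only if $\pi=\pi_\lambda$, that is, $$\{\pi\in\mathbb{P}_\lambda\mid e_i\pi=0\ \text{for all } i\in I\}=\{\pi_\lambda\}.$$ Moreover $\mathbb{P}_\lambda=\mathcal{F}\pi_\lambda$.
   Context: **Root data.** $\mathbb N=\{0,1,2,\dots\}$, $\mathbb N^+=\mathbb N\setminus\{0\}$; all vector spaces are over $\mathbb Q$ and intervals consist of rational numbers. $I$ is a countable set and $A=(a_{ij})_{i,j\in I}$ is a Borcherds-Cartan matrix (not assumed symmetrizable): $a_{ii}=2$ or $a_{ii}\in-\mathbb N$ for all $i$; $a_{ij}\in-\mathbb N$ for $i\ne j$; $a_{ij}=0$ iff $a_{ji}=0$. $I^{re}=\{i: a_{ii}=2\}$, $I^{im}=I\setminus I^{re}$. $\mathfrak h$ is a Cartan subalgebra of the associated generalized Kac-Moody algebra: a vector space with linearly independent simple coroots $\alpha_i^\vee\in\mathfrak h$ and linearly independent simple roots $\alpha_i\in\mathfrak h^*$ with $\alpha_i^\vee(\alpha_j)=a_{ij}$. $\Pi=\{\alpha_i\}_{i\in I}$, $P=\{\lambda\in\mathfrak h^*: \alpha_i^\vee(\lambda)\in\mathbb Z\ \forall i\in I\}$, $P^+=\{\lambda\in P:\alpha_i^\vee(\lambda)\ge0\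 \forall i\in I\}$, $Q^+=\bigoplus_{i}\mathbb N\alpha_i$. $r_i:\mathfrak h^*\to\mathfrak h^*$, $r_i(x)=x-\alpha_i^\vee(x)\alpha_i$. $T$ is the monoid generated by all $r_i$, $i\in I$; $W$ is the group generated by $r_i$, $i\in I^{re}$; $W$ acts on $\mathfrak h$ by $r_i(h)=h-h(\alpha_i)\alpha_i^\vee$. For $\beta=w\alpha_i\in W\Pi$ put $\beta^\vee=w\alpha_i^\vee$ (well defined) and $r_\beta(x)=x-\beta^\vee(x)\beta$. $\Delta^+_{re}=\{w\alpha_i: w\in W,i\in I^{re}\}\cap Q^+$, $\Delta_{im}=\{w\alpha_i:w\in W,i\in I^{im}\}$ (contained in $Q^+$), and $W\Pi\cap\Delta^+=\Delta^+_{re}\sqcup\Delta_{im}$. **Order and chains.** Let $\lambda\in P^+$. For $\mu,\nu\in T\lambda$ write $\mu>\nu$ if there are $\mu=\lambda_0,\lambda_1,\dots,\lambda_s=\nu$ ($s\geq 1$) and $\beta_1,\dots,\beta_s\in W\Pi\cap\Delta^+$ with $\lambda_{i-1}=r_{\beta_i}\lambda_i$ and $\beta_i^\vee(\lambda_i)>0$ for $1\le i\le s$; $\operatorname{dist}(\mu,\nu)$ is the maximal length $s$ of such a sequence. If $\mu=r_\beta\nu>\nu$ and $\operatorname{dist}(\mu,\nu)=1$ write $\nu\stackrel{\beta}{\leftarrow}\mu$. For rational $0<a\le1$ and $\mu>\nu$, an $a$-chain for $(\mu,\nu)$ is a sequence $\nu=\nu_s\stackrel{\beta_s}{\leftarrow}\nu_{s-1}\leftarrow\cdots\stackrel{\beta_1}{\leftarrow}\nu_0=\mu$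 in $T\lambda$ such that for $1\le i\le s$: $a\beta_i^\vee(\nu_i)\in\mathbb N^+$ if $\beta_i\in\Delta^+_{re}$, and $a\beta_i^\vee(\nu_i)=1$ if $\beta_i\in\Delta_{im}$. **GLS paths.** A Generalized Lakshmibai-Seshadri (GLS) path of shape $\lambda$, $\pi=(\lambda_1,\dots,\lambda_s;a_0=0,a_1,\dots,a_s=1)$, is given by $\lambda_1>\dots>\lambda_s$ in $T\lambda$ and rationals $0=a_0<a_1<\dots<a_s=1$ such that there is an $a_i$-chain for $(\lambda_i,\lambda_{i+1})$ for $1\le i\le s-1$ and, if $\lambda_s\ne\lambda$, a $1$-chain for $(\lambda_s,\lambda)$; it is the piecewise linear path $\pi(t)=\sum_{i=1}^{j-1}(a_i-a_{i-1})\lambda_i+(t-a_{j-1})\lambda_j$ for $a_{j-1}\le t\le a_j$. $\mathbb P_\lambda$ is the set of GLS paths of shape $\lambda$; $\pi_\lambda(t)=t\lambda$. Paths are considered up to reparametrization by a continuous non-decreasing map of $[0,1]$ fixing the endpoints. **Root operators** on piecewise linear paths $\pi:[0,1]\to\mathbb QP$ with $\pi(0)=0$, $\pi(1)\in P$. Put $h_i^\pi(t)=\alpha_i^\vee(\pi(t))$ and let $m_i^\pi$ be the minimal integer among the values of $h_i^\pi$. *$f_i$, $i\in I$:* let $f_+^i(\pi)$ be the maximal $t$ with $h_i^\pi(t)=m_i^\pi$. If $f_+^i(\pi)=1$, $f_i\pi=0$. Otherwise let $f_-^i(\pi)\in[f_+^i(\pi),1]$ be minimal with $h_i^\pi(f_-^i(\pi))=m_i^\pi+1$,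 and $(f_i\pi)(t)=\pi(t)$ on $[0,f_+^i]$, $\pi(f_+^i)+r_i(\pi(t)-\pi(f_+^i))$ on $[f_+^i,f_-^i]$, $\pi(t)-\alpha_i$ on $[f_-^i,1]$. *$e_i$, $i\in I^{re}$:* let $e_+^i$ be the minimal $t$ with $h_i^\pi(t)=m_i^\pi$. If $e_+^i=0$, $e_i\pi=0$. Otherwise let $e_-^i\in[0,e_+^i]$ be maximal with $h_i^\pi(e_-^i)=m_i^\pi+1$, and $(e_i\pi)(t)=\pi(t)$ on $[0,e_-^i]$, $\pi(e_-^i)+r_i(\pi(t)-\pi(e_-^i))$ on $[e_-^i,e_+^i]$, $\pi(t)+\alpha_i$ on $[e_+^i,1]$. *$e_i$, $i\in I^{im}$:* let $r_i^{-1}(x)=x+\frac1{1-a_{ii}}\alpha_i^\vee(x)\alpha_i$ and $e_-^i=f_+^i(\pi)$. If $e_-^i=1$ or $h_i^\pi(t)<m_i^\pi+1-a_{ii}$ for all $t\in[e_-^i,1]$, $e_i\pi=0$. Otherwise let $e_+^i\in[e_-^i,1]$ be minimal with $h_i^\pi(e_+^i)=m_i^\pi+1-a_{ii}$. If $h_i^\pi(t)\le m_i^\pi-a_{ii}$ for some $t\in[e_+^i,1]$, $e_i\pi=0$. Otherwise $(e_i\pi)(t)=\pi(t)$ on $[0,e_-^i]$, $\pi(e_-^i)+r_i^{-1}(\pi(t)-\pi(e_-^i))$ on $[e_-^i,e_+^i]$, $\pi(t)+\alpha_i$ on $[e_+^i,1]$. **Operators on $\mathbb P_\lambda$.** On $\mathbb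 P_\lambda$ the $f_i$ are the operators above (they map $\mathbb P_\lambda$ to $\mathbb P_\lambda\cup\{0\}$), while $e_i\pi$ is the path above if it lies in $\mathbb P_\lambda$ and is set to be $0$ otherwise. $\mathcal F$ is the monoid generated by the $f_i$, $i\in I$, and $\mathcal F\pi_\lambda$ is the set of nonzero elements obtained from $\pi_\lambda$ by applying elements of $\mathcal F$. *)

(* Defs.v *)
From HB Require Import structures.
From mathcomp Require Import all_boot all_order all_algebra.
From mathcomp Require Import boolp classical_sets functions.

Set Implicit Arguments.
Unset Strict Implicit.
Unset Printing Implicit Defensive.

Import Order.TTheory GRing.Theory Num.Theory.
Local Open Scope classical_set_scope.
Local Open Scope ring_scope.

(* The full algebraic dual of a rational vector space, which may be
   infinite dimensional since the index set may be infinite. *)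
Section Dual.
Variable U : lmodType rat.

Definition linear_functional : {pred U -> rat^o} := [pred f | `[< linear f >]].

Lemma linear_functional_submod : submod_closed linear_functional.
Proof.
split=> [|a f g /asboolP lf /asboolP lg]; apply/asboolP => b x y.
  by rewrite scaler0 addr0.
have E u : (a *: f + g) u = a *: f u + g u by [].
rewrite !E lf lg !scalerDr !scalerA (mulrC a b) -!addrA; congr (_ + _).
by rewrite !addrA; congr (_ + _); rewrite addrC.
Qed.

HB.instance Definition _ := GRing.isSubmodClosed.Build rat (U -> rat^o)
  linear_functional linear_functional_submod.

Record dual := Dual {
  dual_fun :> U -> rat^o;
  dual_funP : linear_functional dual_fun }.

HB.instance Definition _ := [isSub for dual_fun].
HB.instance Definition _ := [Choice of dual by <:].
HB.instance Definition _ := [SubChoice_isSubLmodule of dual by <:].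

Definition pairing (h : U) (mu : dual) : rat := mu h.

End Dual.

Definition linearly_independent (V : lmodType rat) (I : eqType) (v : I -> V) :=
  forall (s : seq I) (c : I -> rat), uniq s ->
    \sum_(i <- s) c i *: v i = 0 -> forall i, i \in s -> c i = 0.

Definition borcherds_cartan (I : Type) (A : I -> I -> int) :=
  [/\ forall i, A i i = 2 \/ A i i <= 0,
      forall i j, i <> j -> A i j <= 0 &
      forall i j, A i j = 0 <-> A j i = 0].

Record realization (I : countType) (A : I -> I -> int) := Realization {
  cartan : lmodType rat;
  coroot : I -> cartan;
  root : I -> dual cartan;
  coroot_indep : linearly_independent coroot;
  root_indep : linearly_independent root;
  pairingE : forall i j, pairing (coroot i) (root j) = (A i j)%:~R }.

Section RootData.
Variables (I : countType) (A : I -> I -> int) (D : realization A).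

Local Notation h := (cartan D).
Local Notation hd := (dual (cartan D)).

Definition is_real (i : I) : bool := A i i == 2.

Definition dominant (lam : hd) : Prop :=
  forall i, pairing (coroot D i) lam \is a Num.int /\
            0 <= pairing (coroot D i) lam.

(* The sequence s is a multiset of simple roots. *)
Definition Qplus : set hd := [set mu | exists s : seq I, mu = \sum_(i <- s) root D i].

Definition refl (beta : hd) (betav : h) (x : hd) : hd :=
  x - pairing betav x *: beta.

Definition srefl (i : I) : hd -> hd := refl (root D i) (coroot D i).

Definition srefl_co (i : I) (x : h) : h :=
  x - pairing x (root D i) *: coroot D i.

(* The word [:: i1; ..; ik] stands for r_i1 ... r_ik.  Arbitrary words give the
   monoid T; since r_i is an involution for real i, words in real indices give
   the group W. *)
Definition act (w : seq I) (x : hd) : hd := foldr srefl x w.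
Definition act_co (w : seq I) (x : h) : h := foldr srefl_co x w.

Definition Torbit (lam : hd) : set hd := [set mu | exists w, mu = act w lam].

(* The graph of beta |-> beta^vee on W Pi: that the coroot depends only on beta
   is not built in. *)
Definition coroot_of (beta : hd) (betav : h) : Prop :=
  exists (w : seq I) (i : I),
    [/\ all is_real w, beta = act w (root D i) & betav = act_co w (coroot D i)].

Definition real_pos_root : set hd :=
  [set beta | (exists (w : seq I) (i : I),
                 [/\ all is_real w, is_real i & beta = act w (root D i)])
              /\ Qplus beta].

Definition imag_root : set hd :=
  [set beta | exists (w : seq I) (i : I),
     [/\ all is_real w, ~~ is_real i & beta = act w (root D i)]].

(* The imaginary roots are all in Q+, hence no condition on that part. *)
Definition pos_root : set hd := real_pos_root `|` imag_root.

Definition order_chain (mu nu : hd) (s : nat) : Prop :=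
  exists (l : nat -> hd) (beta : nat -> hd) (betav : nat -> h),
    [/\ l 0%N = mu, l s = nu &
     forall i, (0 < i <= s)%N ->
       [/\ pos_root (beta i), coroot_of (beta i) (betav i),
           l i.-1 = refl (beta i) (betav i) (l i) &
           0 < pairing (betav i) (l i)]].

Section Shape.
Variable lam : hd.

Definition tgt (mu nu : hd) : Prop :=
  [/\ Torbit lam mu, Torbit lam nu &
      exists2 s, (0 < s)%N & order_chain mu nu s].

Definition is_dist (mu nu : hd) (d : nat) : Prop :=
  order_chain mu nu d /\ forall s, order_chain mu nu s -> (s <= d)%N.

Definition arrow (beta : hd) (betav : h) (mu nu : hd) : Prop :=
  [/\ pos_root beta, coroot_of beta betav,
      mu = refl beta betav nu, tgt mu nu & is_dist mu nu 1%N].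

Definition has_chain (a : rat) (mu nu : hd) : Prop :=
  tgt mu nu /\
  exists (s : nat) (n : nat -> hd) (beta : nat -> hd) (betav : nat -> h),
    [/\ n 0%N = mu, n s = nu &
     forall i, (0 < i <= s)%N ->
       [/\ arrow (beta i) (betav i) (n i.-1) (n i),
           real_pos_root (beta i) ->
             a * pairing (betav i) (n i) \is a Num.nat /\
             0 < a * pairing (betav i) (n i) &
           imag_root (beta i) -> a * pairing (betav i) (n i) = 1]].

(* A path is a map on the rational points of [0, 1]; its values elsewhere are
   never used. *)
Definition gpath := rat -> hd.

(* Only l 1, .., l s and a 0, .., a s are used. *)
Definition GLS_data (s : nat) (l : nat -> hd) (a : nat -> rat) : Prop :=
  [/\ a 0%N = 0 /\ a s = 1,
      forall i, (i < s)%N -> a i < a i.+1,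
      forall i, (0 < i <= s)%N -> Torbit lam (l i),
      forall i, (0 < i < s)%N ->
        tgt (l i) (l i.+1) /\ has_chain (a i) (l i) (l i.+1) &
      l s <> lam -> has_chain 1 (l s) lam].

Definition GLS : set gpath := [set pi | exists s l a,
  GLS_data s l a /\
  forall j t, (0 < j <= s)%N -> a j.-1 <= t <= a j ->
    pi t = \sum_(1 <= i < j) (a i - a i.-1) *: l i + (t - a j.-1) *: l j].

Definition straight : gpath := fun t => t *: lam.

End Shape.

(* Surjectivity is automatic for continuous maps of the real interval [0, 1]
   fixing the endpoints.  Over rational points it has to be required: otherwise
   phi could jump at an irrational number and skip part of a path. *)
Definition reparam (phi : rat -> rat) : Prop :=
  [/\ phi 0 = 0 /\ phi 1 = 1,
      forall s t, 0 <= s -> s <= t -> t <= 1 -> phi s <= phi t,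
      forall t, 0 <= t <= 1 -> forall e, 0 < e ->
        exists2 d, 0 < d & forall u, 0 <= u <= 1 ->
          `|u - t| < d -> `|phi u - phi t| < e &
      forall y, 0 <= y <= 1 -> exists2 t, 0 <= t <= 1 & phi t = y].

Definition same_path (p q : gpath) : Prop :=
  exists phi psi, [/\ reparam phi, reparam psi &
    forall t, 0 <= t <= 1 -> p (phi t) = q (psi t)].

Definition up_to_reparam (X : set gpath) : set gpath :=
  [set p | exists2 q, X q & same_path p q].

(* Greatest and least elements of a set of rationals; 0 if there is none. *)
Definition greatest (S : set rat) : rat :=
  xget 0 [set t | S t /\ forall u, S u -> u <= t].
Definition least (S : set rat) : rat :=
  xget 0 [set t | S t /\ forall u, S u -> t <= u].

Section RootOperators.
Variables (i : I) (pi : gpath).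

Definition height (t : rat) : rat := pairing (coroot D i) (pi t).

Definition min_height : int :=
  xget 0 [set m : int |
    (exists2 t, 0 <= t <= 1 & height t = m%:~R) /\
    forall (n : int) t, 0 <= t <= 1 -> height t = n%:~R -> m <= n].

Let m : rat := min_height%:~R.
Let aii : rat := (A i i)%:~R.

Definition f_plus : rat := greatest [set t | 0 <= t <= 1 /\ height t = m].

(* The value None is the element 0. *)
Definition f_op : option gpath :=
  let fp := f_plus in
  let fm := least [set t | fp <= t <= 1 /\ height t = m + 1] in
  if fp == 1 then None else
  Some (fun t => if t <= fp then pi t
                 else if t <= fm then pi fp + srefl i (pi t - pi fp)
                 else pi t - root D i).

Definition e_real : option gpath :=
  let ep := least [set t | 0 <= t <= 1 /\ height t = m] in
  let em := greatest [set t | 0 <= t <= ep /\ height t = m + 1] in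
  if ep == 0 then None else
  Some (fun t => if t <= em then pi t
                 else if t <= ep then pi em + srefl i (pi t - pi em)
                 else pi t + root D i).

Definition srefl_inv (x : hd) : hd :=
  x + ((1 - aii)^-1 * pairing (coroot D i) x) *: root D i.

Definition e_imag : option gpath :=
  let em := f_plus in
  let ep := least [set t | em <= t <= 1 /\ height t = m + 1 - aii] in
  if `[< em = 1 \/ forall t, em <= t <= 1 -> height t < m + 1 - aii >] then None
  else if `[< exists2 t, ep <= t <= 1 & height t <= m - aii >] then None
  else
  Some (fun t => if t <= em then pi t
                 else if t <= ep then pi em + srefl_inv (pi t - pi em)
                 else pi t + root D i).

Definition e_path : option gpath := if is_real i then e_real else e_imag.

End RootOperators.

Definition e_op (lam : hd) (i : I) (pi : gpath) : option gpath :=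
  obind (fun p => if `[< up_to_reparam (GLS lam) p >] then Some p else None)
        (e_path i pi).

Definition f_word (w : seq I) (pi : gpath) : option gpath :=
  foldr (fun i => obind (f_op i)) (Some pi) w.

Definition F_orbit (pi : gpath) : set gpath :=
  [set p | exists w, f_word w pi = Some p].

End RootData.

(* Main.v *)
Require Import Defs.
From HB Require Import structures.
From mathcomp Require Import all_boot all_order all_algebra.
From mathcomp Require Import boolp classical_sets functions.
From mathcomp Require Import zify lra.

(** Every path p of shape lam other than the straight one can be raised
    ([raise_exists]): for some i the operator e_i takes it to a path p' of shape lam
    with p'(1) = p(1) + alpha_i, and f_i takes p' back to p.  The theorem follows.
    The directions of a path lie in lam - Q^+, so the height of p(1) is at most that
    of lam ([ht_end]) and raising can be repeated only finitely often; it stops at the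
    straight path, and reading the steps backwards writes p as f_{i_1} ... f_{i_k}
    applied to the straight path ([GLS_orbit]).  Conversely the f_i take paths of
    shape lam to such paths ([f_op_GLS]).  A path killed by all e_i is not raised,
    hence straight, and all e_i kill the straight path because the result would end
    at lam + alpha_i ([straight_e_op]).

    Which e_i raises p is read off its first direction mu.  If alpha_i^vee is negative
    on mu for a real i, then e_i raises p, exactly as for LS paths.  Otherwise mu is
    dominant for the real simple roots.  If p is not straight, then at the end of its
    first straight piece there is a nonempty chain starting at mu, and the first
    arrow mu = r_beta nu of this chain can only come from an imaginary simple root
    beta = alpha_i ([arrowA_dominant]); then e_i replaces mu by nu on that piece.

    All root operators bend a path between two of its breakpoints ([bend]).  The bent
    path has shape lam if the chains at the breakpoints in between survive the
    reflection r_i.  For real i an arrow is carried to an arrow, under a sign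
    condition on the pairings with alpha_i^vee, unless it is given by alpha_i itself
    ([arrowA_real]).  Along a whole chain this leaves one exception, in which a
    multiple of a pairing is an integer ([chainA_end_pos], [chainA_start_neg]); at a
    breakpoint that integrality says that the height function of the path is an
    integer there ([height_int_left], [height_int_right]), and inside a bent piece it
    is not.  For imaginary i the pairings with alpha_i^vee can only decrease from one
    direction to the next, so on the piece bent by f_i they are constant, and there
    r_i is a translation, which preserves chains ([chainA_imag]).

    The facts about roots come from [reach_act]: a weight in the T-orbit of a dominant integral weight
    x is reached from x by simple reflections each of which subtracts a positive
    multiple of its simple root.  Hence x - w x lies in Q^+ ([act_le]).  For dominant x
    in h^* this yields the signs of the real roots ([real_root_sign]) and the fact that
    beta^vee depends only on beta, as far as integral weights see it
    ([coroot_of_uniq]).  For imaginary i the weight - alpha_i is dominant too, and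
    taking it for x shows that the imaginary roots are positive ([imag_root_ge]) and
    that their pairings with the coroots have the expected sign
    ([coroot_imag_sign]). *)

Set Implicit Arguments.
Unset Strict Implicit.
Unset Printing Implicit Defensive.

Import Order.TTheory GRing.Theory Num.Theory.
Local Open Scope classical_set_scope.
Local Open Scope ring_scope.

(** * Functionals with prescribed values *)

Section PairingTheory.
Variable U : lmodType rat.
Implicit Types (h g : U) (x y : dual U).

Lemma pairingDr h x y : pairing h (x + y) = pairing h x + pairing h y.
Proof. by []. Qed.
Lemma pairingNr h x : pairing h (- x) = - pairing h x.
Proof. by []. Qed.
Lemma pairingBr h x y : pairing h (x - y) = pairing h x - pairing h y.
Proof. by []. Qed.
Lemma pairingZr h a x : pairing h (a *: x) = a * pairing h x.
Proof. by []. Qed.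
Lemma pairing0r h : pairing h 0 = 0.
Proof. by []. Qed.

Lemma dual_linear x : linear (x : U -> rat^o).
Proof. by case: x => f /= /asboolP. Qed.

Lemma pairingPl a h g x : pairing (a *: h + g) x = a * pairing h x + pairing g x.
Proof. exact: dual_linear. Qed.
Lemma pairingDl h g x : pairing (h + g) x = pairing h x + pairing g x.
Proof. by have := pairingPl 1 h g x; rewrite scale1r mul1r. Qed.
Lemma pairing0l x : pairing 0 x = 0.
Proof. by have := pairingDl 0 0 x; rewrite addr0; lra. Qed.
Lemma pairingZl a h x : pairing (a *: h) x = a * pairing h x.
Proof. by have := pairingPl a h 0 x; rewrite !addr0 pairing0l addr0. Qed.
Lemma pairingNl h x : pairing (- h) x = - pairing h x.
Proof. by rewrite -scaleN1r pairingZl mulN1r. Qed.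
Lemma pairingBl h g x : pairing (h - g) x = pairing h x - pairing g x.
Proof. by rewrite pairingDl pairingNl. Qed.

(** The form of linearity in the definition of the dual is over the regular module of
    the rationals; here it is spelled out with products. *)
Lemma dual_of_linear (f : U -> rat) :
    (forall a u v, f (a *: u + v) = a * f u + f v) ->
  exists x : dual U, forall u, pairing u x = f u.
Proof.
move=> lf; have L : linear_functional (f : U -> rat^o) by apply/asboolP.
by exists (Dual L).
Qed.

End PairingTheory.

Section Extension.
Variables (V : lmodType rat) (I : eqType) (v : I -> V) (c : I -> rat).
Hypothesis indep : linearly_independent v.

(** The graph of a linear form on a subspace containing every v i, with the values
    c i; the last clause makes it single-valued. *)
Definition partial_functional (G : set (V * rat)) : Prop :=
  [/\ forall i, G (v i, c i),
      forall a p q, G p -> G q -> G (a *: p.1 + q.1, a * p.2 + q.2) &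
      forall y, G (0, y) -> y = 0].

(** The graph of the form on the span of the v i. *)
Definition span_graph : set (V * rat) := [set p | exists (s : seq I) (d : I -> rat),
  [/\ uniq s, p.1 = \sum_(i <- s) d i *: v i & p.2 = \sum_(i <- s) d i * c i]].

Lemma sum_widen (M : zmodType) (s t : seq I) (F : I -> M) :
    uniq s -> uniq t -> {subset s <= t} ->
  \sum_(i <- t) (if i \in s then F i else 0) = \sum_(i <- s) F i.
Proof.
move=> us ut st; rewrite -big_mkcond -big_filter; apply: perm_big.
apply: uniq_perm => //; first exact: filter_uniq.
by move=> i; rewrite mem_filter; case E: (i \in s) => //=; rewrite st.
Qed.

Lemma span_graph_functional : partial_functional span_graph.
Proof.
split.
- move=> i; exists [:: i], (fun=> 1); split=> //=.
    by rewrite big_seq1 scale1r.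
  by rewrite big_seq1 mul1r.
- move=> a p q [s [d [us -> ->]]] [t [e [ut -> ->]]].
  exists (undup (s ++ t)),
    (fun i => a * (if i \in s then d i else 0) + (if i \in t then e i else 0)).
  have ss : {subset s <= undup (s ++ t)}.
    by move=> i si; rewrite mem_undup mem_cat si.
  have ts : {subset t <= undup (s ++ t)}.
    by move=> i si; rewrite mem_undup mem_cat si orbT.
  split; first exact: undup_uniq.
  + rewrite -(sum_widen _ us (undup_uniq _) ss) -(sum_widen _ ut (undup_uniq _) ts).
    rewrite /= scaler_sumr -big_split; apply: eq_bigr => i _ /=.
    by rewrite scalerDl -scalerA; congr (_ *: _ + _); case: ifP; rewrite ?scale0r.
  + rewrite -(@sum_widen rat _ _ _ us (undup_uniq _) ss) -(@sum_widen rat _ _ _ ut (undup_uniq _) ts).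
    rewrite /= mulr_sumr -big_split; apply: eq_bigr => i _ /=.
    by rewrite mulrDl -mulrA; congr (_ * _ + _); case: ifP; rewrite ?mul0r.
- move=> y [s [d [us /= /esym s0 ->]]].
  by rewrite big_seq big1 // => i si; rewrite (indep us s0) ?mul0r.
Qed.

(** Zorn's lemma; the empty graph is admitted in its use only to have a bound for the
    empty chain. *)
Lemma maximal_functional : exists G, partial_functional G /\
  forall G', G `<=` G' -> partial_functional G' -> G' `<=` G.
Proof.
have [|A [PA maxA]] := @Zorn_bigcup (V * rat)%type
    (fun G => G = set0 \/ partial_functional G).
  move=> F FP Ftot.
  have [[G [FG Gp]]|noG] := pselect (exists G, F G /\ partial_functional G); last first.
    left; rewrite predeqE => p; split=> // -[X FX Xp].
    by case: (FP _ FX) => [X0|Xg]; [rewrite X0 in Xp | case: noG; exists X].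
  have Fpf X p : F X -> X p -> partial_functional X.
    by move=> FX Xp; case: (FP _ FX) => // X0; rewrite X0 in Xp.
  right; split.
  - by move=> i; exists G => //; case: Gp.
  - move=> a p q [X FX Xp] [Y FY Yq].
    case: (Ftot _ _ FX FY) => [XY|YX].
      by exists Y => //; case: (Fpf _ _ FY Yq) => _ h _; apply: h => //; exact: XY.
    by exists X => //; case: (Fpf _ _ FX Xp) => _ h _; apply: h => //; exact: YX.
  - by move=> y [X FX Xy]; case: (Fpf _ _ FX Xy) => _ _; exact.
case: PA => [A0|Ag]; last first.
  exists A; split=> // G' AG' G'g; apply: contrapT => nG'.
  by apply: (maxA G'); [split | right].
exists span_graph; split; first exact: span_graph_functional.
move=> G' _ G'g p G'p; exfalso.
apply: (maxA G'); last by right.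
split; first by move=> x; rewrite A0.
by move=> /(_ _ G'p); rewrite A0.
Qed.

Lemma partial_functional_uniq G x y z :
  partial_functional G -> G (x, y) -> G (x, z) -> y = z.
Proof.
case=> _ Gl G0 Gy Gz; apply/eqP; rewrite -subr_eq0; apply/eqP; apply: G0.
have := Gl (-1) _ _ Gz Gy => /=.
by rewrite scaleN1r mulN1r addNr addrC.
Qed.

(** A maximal partial functional is defined everywhere: if u is outside its domain,
    it extends by the value 0 on u. *)
Lemma extend_functional : exists x : dual V, forall i, pairing (v i) x = c i.
Proof.
have [G [Gp Gmax]] := maximal_functional.
have [Gv Gl G0] := Gp.
have GZ a x y : G (x, y) -> G (a *: x, a * y).
  move=> Gxy; have Gz : G (0, 0).
    have := Gl (-1) _ _ Gxy Gxy => /=.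
    by rewrite scaleN1r mulN1r !addNr.
  by have := Gl a _ _ Gxy Gz => /=; rewrite !addr0.
have [[p0 Gp0]|/forallNP Gno] := pselect (exists p, G p); last first.
  have [f fE] := @dual_of_linear V (fun=> 0) (fun a u w => esym (etrans (addr0 _) (mulr0 a))).
  exists f => i; by case: (Gno _ (Gv i)).
have G00 : G (0, 0) by have := @GZ 0 p0.1 p0.2; rewrite scale0r mul0r -surjective_pairing; exact.
have tot u : exists y, G (u, y).
  apply: contrapT => /forallNP nu.
  pose G' : set (V * rat) := [set p | exists b q, G q /\ p = (q.1 + b *: u, q.2)].
  have GG' : G `<=` G'.
    by move=> p Gpp; exists 0, p; rewrite scale0r addr0 -surjective_pairing.
  suff G'p : partial_functional G'.
    apply: (nu 0); apply: (Gmax _ GG' G'p).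
    by exists 1, (0, 0); rewrite /= add0r scale1r.
  split.
  - by move=> i; apply: GG'; exact: Gv.
  - move=> a p q [b [p' [Gp' ->]]] [d [q' [Gq' ->]]] /=.
    exists (a * b + d), (a *: p'.1 + q'.1, a * p'.2 + q'.2); split; first exact: Gl.
    by congr (_, _) => /=; rewrite scalerDl scalerDr scalerA -!addrA; congr (_ + _);
      rewrite addrCA.
  - move=> y [b [q [Gq [q0 ->]]]].
    have [b0|b0] := eqVneq b 0.
      move: q0; rewrite b0 scale0r addr0 => q0.
      by apply: G0; rewrite q0 -surjective_pairing.
    case: (nu (- b^-1 * q.2)).
    have -> : u = (- b^-1) *: q.1.
      have -> : q.1 = - (b *: u) by apply/eqP; rewrite -addr_eq0 -q0.
      by rewrite scalerN scaleNr opprK scalerA mulVf ?scale1r.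
    by apply: GZ; rewrite -surjective_pairing.
pose f u := sval (cid (tot u)).
have fG u : G (u, f u) by rewrite /f; case: cid.
have [|x xE] := @dual_of_linear V f.
  move=> a u w; apply: (partial_functional_uniq Gp (fG _)).
  by have := Gl a _ _ (fG u) (fG w).
exists x => i; rewrite xE; exact: (partial_functional_uniq Gp (fG _) (Gv i)).
Qed.

End Extension.

(** * Simple roots and simple reflections *)

Lemma nat_gt0_ge1 (x : rat) : x \is a Num.int -> 0 < x -> 1 <= x.
Proof. by move=> /intrP[n ->]; rewrite ltr0z ler1z. Qed.

Arguments pairing : simpl never.
Arguments srefl : simpl never.
Arguments refl : simpl never.
Arguments act : simpl never.

(** The axioms on the matrix are passed to the lemmas by class inference. *)
Existing Class borcherds_cartan.

Lemma intD (x y : rat) : x \is a Num.int -> y \is a Num.int -> x + y \is a Num.int.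
Proof. exact: rpredD. Qed.
Lemma intB (x y : rat) : x \is a Num.int -> y \is a Num.int -> x - y \is a Num.int.
Proof. exact: rpredB. Qed.
Lemma intM (x y : rat) : x \is a Num.int -> y \is a Num.int -> x * y \is a Num.int.
Proof. exact: rpredM. Qed.
Lemma intN (x : rat) : x \is a Num.int -> - x \is a Num.int.
Proof. by rewrite rpredN. Qed.

Lemma sub_scale_A (V : lmodType rat) (z u : V) (b c e : rat) :
  b + c = e -> z - b *: u - c *: u = z - e *: u.
Proof. by move=> <-; rewrite scalerDl opprD addrA. Qed.
Lemma sub_scale_AC (V : lmodType rat) (z u v : V) (b c d e : rat) :
  b + d = e -> z - b *: u - c *: v - d *: u = z - e *: u - c *: v.
Proof. by move=> <-; rewrite addrAC (sub_scale_A _ _ (erefl _)). Qed.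

Section SimpleReflections.
Variables (I : countType) (A : I -> I -> int).
Context {hA : borcherds_cartan A}.
Variable D : realization A.

Local Notation hd := (dual (cartan D)).
Local Notation al := (@Defs.root I A D).
Local Notation cr i x := (pairing (coroot D i) x).
Local Notation a i j := ((A i j)%:~R : rat).
Local Notation r := (@srefl I A D).
Local Notation real := (is_real A).
Implicit Types (x y z mu nu beta : hd) (i j k l : I) (w u : seq I) (K : pred I).

Lemma cr_root i j : cr i (al j) = a i j.
Proof. exact: pairingE. Qed.

Lemma cartan_real i : real i -> a i i = 2.
Proof. by rewrite /is_real => /eqP ->. Qed.

Lemma cartan_imag i : ~~ real i -> a i i <= 0.
Proof. by rewrite /is_real lerz0; case: hA => /(_ i) [-> //|]. Qed.

Lemma cartan_off i j : i != j -> a i j <= 0.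
Proof. by rewrite lerz0 => /eqP; case: hA => _ h _; apply: h. Qed.

Lemma cartan_imag_le0 i j : ~~ real i -> a i j <= 0.
Proof. by move=> hi; have [<-|/cartan_off //] := eqVneq i j; exact: cartan_imag. Qed.

Lemma cartan_sym0 i j : a i j = 0 -> a j i = 0.
Proof. by move=> /eqP; rewrite intr_eq0 => /eqP; case: hA => _ _ h /h ->. Qed.

Lemma real_neq i j : real i -> ~~ real j -> i != j.
Proof. by move=> ri; apply: contraNneq => <-. Qed.

(** The simple roots need not span h^*: coordinates and height are chosen as linear
    forms on h^* with the right values at the simple roots. *)
Lemma rcoord_exists i : exists f : dual hd, forall j, pairing (al j) f = (i == j)%:R.
Proof. exact: (extend_functional (fun j => (i == j)%:R) (@root_indep _ _ D)). Qed.

Lemma height_exists : exists f : dual hd, forall j, pairing (al j) f = 1.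
Proof. exact: (extend_functional (fun j => 1) (@root_indep _ _ D)). Qed.

Definition rcoord i x := pairing x (sval (cid (rcoord_exists i))).
Definition ht x := pairing x (sval (cid height_exists)).

Lemma rcoord_root i j : rcoord i (al j) = (i == j)%:R.
Proof. by rewrite /rcoord; case: cid. Qed.
Lemma ht_root j : ht (al j) = 1.
Proof. by rewrite /ht; case: cid. Qed.

Lemma rcoordD i x y : rcoord i (x + y) = rcoord i x + rcoord i y.
Proof. exact: pairingDl. Qed.
Lemma rcoordB i x y : rcoord i (x - y) = rcoord i x - rcoord i y.
Proof. exact: pairingBl. Qed.
Lemma rcoordN i x : rcoord i (- x) = - rcoord i x.
Proof. exact: pairingNl. Qed.
Lemma rcoordZ i b x : rcoord i (b *: x) = b * rcoord i x.
Proof. exact: pairingZl. Qed.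
Lemma rcoord0 i : rcoord i 0 = 0.
Proof. exact: pairing0l. Qed.
Lemma htD x y : ht (x + y) = ht x + ht y.
Proof. exact: pairingDl. Qed.
Lemma htB x y : ht (x - y) = ht x - ht y.
Proof. exact: pairingBl. Qed.
Lemma htN x : ht (- x) = - ht x.
Proof. exact: pairingNl. Qed.
Lemma htZ b x : ht (b *: x) = b * ht x.
Proof. exact: pairingZl. Qed.
Lemma ht0 : ht 0 = 0.
Proof. exact: pairing0l. Qed.

Local Notation Qp := (@Qplus I A D).

Lemma Qplus0 : Qp 0.
Proof. by exists [::]; rewrite big_nil. Qed.
Lemma Qplus_root i : Qp (al i).
Proof. by exists [:: i]; rewrite big_seq1. Qed.
Lemma QplusD x y : Qp x -> Qp y -> Qp (x + y).
Proof. by move=> [s ->] [t ->]; exists (s ++ t); rewrite big_cat. Qed.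
Lemma QplusMn n x : Qp x -> Qp (x *+ n).
Proof. by move=> Qx; elim: n => [|n IH]; rewrite ?mulr0n ?mulrS //; [exact: Qplus0 | exact: QplusD]. Qed.
Lemma QplusZ (b : rat) x : b \is a Num.int -> 0 <= b -> Qp x -> Qp (b *: x).
Proof.
move=> bi b0 Qx; have : b \is a Num.nat by rewrite natrEint bi.
by move=> /natrP[n ->]; rewrite scaler_nat; exact: QplusMn.
Qed.

Lemma Qplus_ind (P : hd -> Prop) :
  P 0 -> (forall i x, Qp x -> P x -> P (al i + x)) -> forall x, Qp x -> P x.
Proof.
move=> P0 PS x [s ->]; elim: s => [|i s IH]; first by rewrite big_nil.
by rewrite big_cons; apply: PS => //; exists s.
Qed.

Lemma Qplus_coord x i : Qp x -> 0 <= rcoord i x.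
Proof.
move: x; apply: Qplus_ind => [|j x _ IH]; first by rewrite rcoord0.
by rewrite rcoordD rcoord_root addr_ge0 // ler0n.
Qed.

Lemma Qplus_ht_nat x : Qp x -> ht x \is a Num.nat.
Proof.
move: x; apply: Qplus_ind => [|j x _ IH]; first by rewrite ht0.
by rewrite htD ht_root rpredD.
Qed.

Lemma Qplus_ht x : Qp x -> 0 <= ht x.
Proof. by move=> /Qplus_ht_nat; rewrite natrEint => /andP[]. Qed.

Lemma Qplus_root_ht i x : Qp x -> 1 <= ht (al i + x).
Proof. by move=> /Qplus_ht; rewrite htD ht_root; lra. Qed.

Lemma Qplus_ht_le0 x : Qp x -> ht x <= 0 -> x = 0.
Proof.
move=> [[|i s] ->]; first by rewrite big_nil.
have Qs : Qp (\sum_(j <- s) al j) by exists s.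
by rewrite big_cons => h; exfalso; have := Qplus_root_ht i Qs; lra.
Qed.

(** The height is positive on the nonzero elements of Q^+. *)
Lemma Qplus_anti x : Qp x -> Qp (- x) -> x = 0.
Proof.
by move=> Qx /Qplus_ht; rewrite htN => h; apply: Qplus_ht_le0 => //; lra.
Qed.

Lemma root_neq0 i : al i <> 0.
Proof. by move=> /(congr1 ht); rewrite ht_root ht0; lra. Qed.

Lemma root_inj i j : al i = al j -> i = j.
Proof.
move=> /(congr1 (rcoord i)); rewrite !rcoord_root eqxx.
by case: eqP => // _ /eqP; rewrite oner_eq0.
Qed.

Lemma Qplus_root_sub i j : Qp (al i - al j) -> i = j.
Proof.
move=> Q; have : al i - al j = 0.
  by apply: Qplus_ht_le0 => //; rewrite htB !ht_root; lra.
by move=> /eqP; rewrite subr_eq0 => /eqP/root_inj.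
Qed.

Lemma Qplus_coord_zero x i : Qp x -> (forall j, j != i -> rcoord j x = 0) ->
  exists n : nat, x = n%:R *: al i.
Proof.
move: x; apply: Qplus_ind => [_|j x Qx IH h]; first by exists 0%N; rewrite scale0r.
have ji : j = i.
  apply/eqP; apply: contraT => ji; have := h j ji.
  by have := Qplus_coord j Qx; rewrite rcoordD rcoord_root eqxx /=; lra.
case: IH => [k ki|n ->].
  by have := h k ki; rewrite rcoordD rcoord_root ji (negbTE ki) add0r.
by exists n.+1; rewrite ji -natr1 scalerDl scale1r addrC.
Qed.

Definition integral x := forall i, cr i x \is a Num.int.

Lemma root_integral j : integral (al j).
Proof. by move=> i; rewrite cr_root. Qed.
Lemma integral0 : integral 0.
Proof. by move=> i; rewrite pairing0r. Qed.
Lemma integralD x y : integral x -> integral y -> integral (x + y).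
Proof. by move=> ix iy i; rewrite pairingDr intD. Qed.
Lemma integralN x : integral x -> integral (- x).
Proof. by move=> ix i; rewrite pairingNr intN. Qed.
Lemma integralB x y : integral x -> integral y -> integral (x - y).
Proof. by move=> ix iy i; rewrite pairingBr intB. Qed.
Lemma integralZ (b : rat) x : b \is a Num.int -> integral x -> integral (b *: x).
Proof. by move=> ib ix i; rewrite pairingZr intM. Qed.
Lemma Qplus_integral x : Qp x -> integral x.
Proof.
move: x; apply: Qplus_ind => [|j x _ IH]; first exact: integral0.
by apply: integralD => //; exact: root_integral.
Qed.

(** The diagonal entry of the matrix at an imaginary index is not positive either. *)
Lemma Qplus_cr_imag i x : ~~ real i -> Qp x -> cr i x <= 0.
Proof.
move=> ii; move: x; apply: Qplus_ind => [|j x _ IH]; first by rewrite pairing0r.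
by rewrite pairingDr cr_root; have := cartan_imag_le0 j ii; lra.
Qed.

Lemma sreflE i x : r i x = x - cr i x *: al i.
Proof. by []. Qed.
Lemma cr_srefl i j x : cr j (r i x) = cr j x - cr i x * a j i.
Proof. by rewrite sreflE pairingBr pairingZr cr_root. Qed.
Lemma cr_srefl_real i x : real i -> cr i (r i x) = - cr i x.
Proof. by move=> ri; rewrite cr_srefl cartan_real //; lra. Qed.
Lemma sreflK i x : real i -> r i (r i x) = x.
Proof.
move=> ri; rewrite [LHS]sreflE cr_srefl_real // sreflE scaleNr opprK.
by rewrite subrK.
Qed.
Lemma sreflD i x y : r i (x + y) = r i x + r i y.
Proof. by rewrite !sreflE pairingDr scalerDl opprD addrACA. Qed.
Lemma sreflZ i b x : r i (b *: x) = b *: r i x.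
Proof. by rewrite !sreflE pairingZr -scalerA scalerBr. Qed.
Lemma sreflN i x : r i (- x) = - r i x.
Proof. by rewrite -scaleN1r sreflZ scaleN1r. Qed.
Lemma sreflB i x y : r i (x - y) = r i x - r i y.
Proof. by rewrite sreflD sreflN. Qed.
Lemma srefl_fix i x : cr i x = 0 -> r i x = x.
Proof. by rewrite sreflE => ->; rewrite scale0r subr0. Qed.
Lemma srefl_integral i x : integral x -> integral (r i x).
Proof. by move=> ix; apply: integralB => //; apply: integralZ => //; exact: root_integral. Qed.
Lemma srefl_root_real i : real i -> r i (al i) = - al i.
Proof.
by move=> ri; rewrite sreflE cr_root cartan_real // scaler_nat mulr2n opprD addNKr.
Qed.
Lemma rcoord_srefl i j x : i != j -> rcoord j (r i x) = rcoord j x.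
Proof.
by move=> ij; rewrite sreflE rcoordB rcoordZ rcoord_root eq_sym (negbTE ij) mulr0 subr0.
Qed.

Lemma srefl_comm i j x : i != j -> a i j = 0 -> r i (r j x) = r j (r i x).
Proof.
move=> ij aij; have aji := cartan_sym0 aij.
rewrite [LHS]sreflE [RHS]sreflE !cr_srefl aij aji !mulr0 !subr0 !sreflE.
by rewrite addrAC.
Qed.

Local Notation act := (@act I A D).
Lemma act_nil x : act [::] x = x.
Proof. by []. Qed.
Lemma act_cons i w x : act (i :: w) x = r i (act w x).
Proof. by []. Qed.
Lemma act_cat u w x : act (u ++ w) x = act u (act w x).
Proof. exact: foldr_cat. Qed.
Lemma actD w x y : act w (x + y) = act w x + act w y.
Proof. by elim: w => // i w IH; rewrite !act_cons IH sreflD. Qed.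
Lemma actZ w b x : act w (b *: x) = b *: act w x.
Proof. by elim: w => // i w IH; rewrite !act_cons IH sreflZ. Qed.
Lemma actN w x : act w (- x) = - act w x.
Proof. by rewrite -scaleN1r actZ scaleN1r. Qed.
Lemma actB w x y : act w (x - y) = act w x - act w y.
Proof. by rewrite actD actN. Qed.
Lemma act_integral w x : integral x -> integral (act w x).
Proof. by move=> ix; elim: w => // i w; exact: srefl_integral. Qed.
Lemma act_rev w x : all real w -> act w (act (rev w) x) = x.
Proof.
elim: w x => // i w IH x /= /andP[ri rw].
by rewrite rev_cons -cats1 act_cat act_cons IH // act_cons act_nil sreflK.
Qed.
Lemma act_revK w x : all real w -> act (rev w) (act w x) = x.
Proof. by move=> rw; rewrite -{2}(revK w) act_rev // all_rev. Qed.
(** Membership in the orbit of x with a witness that descends: each letter subtracts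
    a positive multiple of its simple root.  The set K of admissible letters is all
    of I for the monoid T and the real indices for the group W. *)
Inductive reach (K : pred I) x : hd -> Prop :=
| reach_refl : reach K x x
| reach_step j y : K j -> reach K x y -> 0 < cr j y -> reach K x (r j y).

Lemma reach_weak K x j y : K j -> reach K x y -> 0 <= cr j y -> reach K x (r j y).
Proof.
move=> Kj xy; rewrite le_eqVlt => /orP[/eqP/esym/srefl_fix -> //|]; exact: reach_step.
Qed.

Definition integral_on (K : pred I) x := forall j, K j -> cr j x \is a Num.int.

Lemma reach_Qplus K x y : integral_on K x -> reach K x y ->
  Qp (x - y) /\ integral_on K y.
Proof.
move=> ix; elim=> [|j {}y Kj _ [IH iy] cy].
  by split=> //; rewrite subrr; exact: Qplus0.
split; last first.
  by move=> k Kk; rewrite cr_srefl; apply: intB; [|apply: intM]; rewrite ?iy.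
rewrite sreflE opprB addrCA addrC; apply: QplusD => //.
by apply: QplusZ; [exact: iy | exact: ltW | exact: Qplus_root].
Qed.

(** ** Dihedral orbits

    For two real letters i and j, a weight dominant for both has all of its orbit
    under r_i and r_j reachable by descents.  If a_ij a_ji >= 4 the group is infinite
    and the pairings stay nonnegative along alternating words by an invariant
    inequality; otherwise it is one of four finite dihedral groups and the pairings
    are computed. *)
Section Rank2.
Variables (K : pred I) (x : hd).

Fixpoint alternate i j n z := if n is n'.+1 then r i (alternate j i n' z) else z.

Section Pair.
Variables (i j : I) (z : hd).
Hypotheses (ri : real i) (rj : real j).

(** If the two alternating words of length m agree, longer alternating words fold
    back. *)
Lemma alternate_closed m :
    alternate i j m z = alternate j i m z -> (0 < m)%N ->
  forall u, all [predU pred1 i & pred1 j] u -> exists2 n, (n <= m)%N &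
    act u z = alternate i j n z \/ act u z = alternate j i n z.
Proof.
case: m => // m hm _; elim=> [|k u IH] /=; first by move=> _; exists 0%N => //; left.
move=> /andP[/orP[] /eqP -> /IH {IH} [n nm [uz|uz]]]; rewrite act_cons uz {uz}.
- case: n nm => [|n] nm; first by exists 1%N => //; left.
  by exists n; [exact: ltnW | right; rewrite /= sreflK].
- move: nm; rewrite leq_eqVlt => /orP[/eqP ->|nm]; last by exists n.+1 => //; left.
  by exists m => //; right; rewrite -hm /= sreflK.
- move: nm; rewrite leq_eqVlt => /orP[/eqP ->|nm]; last by exists n.+1 => //; right.
  by exists m => //; left; rewrite hm /= sreflK.
- case: n nm => [|n] nm; first by exists 1%N => //; right.
  by exists n; [exact: ltnW | left; rewrite /= sreflK].
Qed.

Lemma alternate_all u : all [predU pred1 i & pred1 j] u ->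
  exists n, act u z = alternate i j n z \/ act u z = alternate j i n z.
Proof.
elim: u => [|k u IH]; first by exists 0%N; left.
move=> /= /andP[/orP[] /eqP -> /IH {IH} [[|n] [uz|uz]]]; rewrite act_cons uz {uz}.
- by exists 1%N; left.
- by exists 1%N; left.
- by exists n; right; rewrite /= sreflK.
- by exists n.+2; left.
- by exists 1%N; right.
- by exists 1%N; right.
- by exists n.+2; right.
- by exists n; left; rewrite /= sreflK.
Qed.

End Pair.

(** The inequality 2 q_i >= a_ij q_j between the two pairings at each stage is the
    invariant that carries the positivity of the next pairing: under r_j it turns
    into the same inequality with i and j exchanged, because a_ij a_ji >= 4. *)
Lemma alternate_reach_inf n z i j : real i -> real j -> K i -> K j ->
    reach K x z -> 0 <= cr i z -> 0 <= cr j z -> i != j -> 4 <= a i j * a j i ->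
  reach K x (alternate i j n z) /\ ((0 < n)%N ->
     0 <= cr j (alternate i j n z) /\
     0 <= 2 * cr i (alternate i j n z) - a i j * cr j (alternate i j n z)).
Proof.
elim: n i j => [//|n IH] i j ri rj Ki Kj xz zi zj ij a4.
have [xy yP] := IH j i rj ri Kj Ki xz zj zi ltac:(by rewrite eq_sym)
  ltac:(by rewrite mulrC).
have c0 : a i j <= 0 by exact: cartan_off.
have d0 : a j i <= 0 by rewrite cartan_off // eq_sym.
rewrite /=; set y := alternate j i n z in xy yP *.
have yi : 0 <= cr i y by move: yP; rewrite /y; case: (n) => [_ //|n' /(_ isT)[]].
split=> [|_]; first exact: reach_weak.
rewrite cr_srefl_real // cr_srefl.
have h : 0 <= 2 * cr j y - a j i * cr i y.
  move: yP; rewrite /y; case: (n) => [_|n' /(_ isT)[_]]; last by lra.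
  rewrite /=.
  by rewrite subr_ge0 (@le_trans _ _ 0) // ?mulr_ge0 // mulr_le0_ge0.
move: c0 d0 a4 h yi; clear; move: (cr i y) (cr j y) (a i j) (a j i) => u v c d.
move=> c0 d0 a4 h u0.
have du : 0 <= - d * u by rewrite mulr_ge0 // oppr_ge0.
split; first by lra.
have h1 : 0 <= - c * (2 * v - d * u) by rewrite mulr_ge0 // oppr_ge0.
have h2 : 0 <= (c * d - 4) * u by rewrite mulr_ge0 // subr_ge0.
by nra.
Qed.

Lemma alternate_reach_fin m z i j : K i -> K j -> reach K x z ->
    (forall n, (n < m)%N ->
       0 <= cr i (alternate j i n z) /\ 0 <= cr j (alternate i j n z)) ->
  forall n, (n <= m)%N ->
    reach K x (alternate i j n z) /\ reach K x (alternate j i n z).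
Proof.
move=> Ki Kj xz h; elim=> [//|n IH] nm.
have [r1 r2] := IH (ltnW nm); have [h1 h2] := h _ nm.
by split; apply: reach_weak.
Qed.

Lemma rank2_reach i j z u : real i -> real j -> K i -> K j -> i != j ->
    reach K x z -> 0 <= cr i z -> 0 <= cr j z ->
    all [predU pred1 i & pred1 j] u ->
  reach K x (act u z).
Proof.
move=> ri rj Ki Kj ij xz zi zj hu.
have [c4|c4] := leP 4 (a i j * a j i).
  have [n [->|->]] := alternate_all z ri rj hu.
    by case: (alternate_reach_inf n ri rj Ki Kj xz zi zj ij c4).
  by case: (@alternate_reach_inf n z j i) => //; rewrite 1?eq_sym 1?mulrC.
have fin m : (0 < m)%N -> alternate i j m z = alternate j i m z ->
    (forall n, (n < m)%N ->
       0 <= cr i (alternate j i n z) /\ 0 <= cr j (alternate i j n z)) ->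
    reach K x (act u z).
  move=> m0 hm hn; have [n nm] := alternate_closed ri rj hm m0 hu.
  by have [r1 r2] := alternate_reach_fin Ki Kj xz hn nm; case=> ->.
(* The coordinates of r_i r_j ... z relative to z are computed by the two affine
   rules pti and ptj, so that each finite case is a numerical check. *)
pose pt (b c : rat) : hd := z - b *: al i - c *: al j.
have pti b c : r i (pt b c) = pt (cr i z - b - a i j * c) c.
  rewrite /pt sreflE !pairingBr !pairingZr !cr_root cartan_real //.
  by apply: sub_scale_AC; lra.
have ptj b c : r j (pt b c) = pt b (cr j z - c - a j i * b).
  rewrite /pt sreflE !pairingBr !pairingZr !cr_root cartan_real //.
  by apply: sub_scale_A; lra.
have z0 : z = pt 0 0 by rewrite /pt !scale0r !subr0.
(* Types A1 x A1, A2, B2 and G2; the last two in both orientations. *)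
have cases : A i j = 0 /\ A j i = 0 \/ A i j = -1 /\ A j i = -1 \/
    A i j = -1 /\ A j i = -2 \/ A i j = -2 /\ A j i = -1 \/
    A i j = -1 /\ A j i = -3 \/ A i j = -3 /\ A j i = -1.
  move: c4 (cartan_off ij) (@cartan_off j i ltac:(by rewrite eq_sym)).
  rewrite -rmorphM /= !lerz0 (ltr_int _ _ 4) => c4 c0 d0.
  have := @cartan_sym0 i j; have := @cartan_sym0 j i.
  have E b : (b%:~R = 0 :> rat) <-> b = 0.
    by split=> [/eqP|->]; rewrite ?intr_eq0 // => /eqP.
  rewrite !E; move: (A i j) (A j i) c4 c0 d0 => c d c4 c0 d0 dc cd.
  have [c0'|c1] := eqVneq c 0; first by left; split=> //; exact: cd.
  have d1 : d <> 0 by move=> /dc; apply/eqP.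
  have c3 : c = -1 \/ c = -2 \/ c = -3 by clear -c4 c0 d0 c1 d1; nia.
  have d3 : d = -1 \/ d = -2 \/ d = -3 by clear -c4 c0 d0 c1 d1; nia.
  by clear -c4 c3 d3; case: c3 => [|[|]] ?; case: d3 => [|[|]] ?; subst; lia.
have incr m : (forall n, (n < m)%N ->
    0 <= cr i (alternate j i n (pt 0 0)) /\ 0 <= cr j (alternate i j n (pt 0 0))) ->
  forall n, (n < m)%N ->
       0 <= cr i (alternate j i n z) /\ 0 <= cr j (alternate i j n z).
  by rewrite -z0.
have crip b c : cr i (pt b c) = cr i z - 2 * b - a i j * c.
  by rewrite /pt !pairingBr !pairingZr !cr_root cartan_real //; lra.
have crjp b c : cr j (pt b c) = cr j z - 2 * c - a j i * b.
  by rewrite /pt !pairingBr !pairingZr !cr_root cartan_real //; lra.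
have ptE b c b' c' : b = b' -> c = c' -> pt b c = pt b' c' by move=> -> ->.
clearbody pt.
have altS b c n (t : hd) : alternate b c n.+1 t = r b (alternate c b n t) by [].
have alt0 b c (t : hd) : alternate b c 0 t = t by [].
case: cases => [|[|[|[|[|]]]]] [cE dE]; rewrite cE dE in pti ptj crip crjp;
  [apply: (fin 2%N isT) | apply: (fin 3%N isT) | apply: (fin 4%N isT)
  | apply: (fin 4%N isT) | apply: (fin 6%N isT) | apply: (fin 6%N isT)].

all: match goal with |- @eq _ _ _ =>
  by rewrite {1 2}z0 ?altS ?alt0 ?(pti, ptj); apply: ptE; lra | _ => idtac end.
all: apply: incr => -[|[|[|[|[|[|//]]]]]] // _.
all: by rewrite ?altS ?alt0 ?(pti, ptj) ?crip ?crjp; split; lra.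
Qed.

End Rank2.
End SimpleReflections.

(** * Orbits by descending words *)

Section DescendingWords.
Variables (I : countType) (A : I -> I -> int).
Context {hA : borcherds_cartan A}.
Variable D : realization A.

Local Notation hd := (dual (cartan D)).
Local Notation al := (@Defs.root I A D).
Local Notation cr i x := (pairing (coroot D i) x).
Local Notation a i j := ((A i j)%:~R : rat).
Local Notation r := (@srefl I A D).
Local Notation real := (is_real A).
Implicit Types (x y z mu nu beta : hd) (i j k l : I) (w u : seq I) (K : pred I).

Local Notation Qp := (@Qplus I A D).
Local Notation act := (@act I A D).

Section Descent.
Variables (K : pred I) (x : hd).
Hypothesis xint : integral_on K x.
Hypothesis xdom : forall i, K i -> 0 <= cr i x.

(** Descents subtract elements of Q^+, on which the coroot of an imaginary i is not
    positive. *)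
Lemma reach_imag_ge0 i y : K i -> ~~ real i -> reach K x y -> cr i x <= cr i y.
Proof.
move=> Ki ii /(reach_Qplus xint) [/(Qplus_cr_imag ii)].
by rewrite pairingBr subr_le0.
Qed.

Lemma reach_int_ge1 i y : K i -> reach K x y -> 0 < cr i y -> 1 <= cr i y.
Proof. by move=> Ki /(reach_Qplus xint) [_ /(_ i Ki)]; exact: nat_gt0_ge1. Qed.

Lemma ht_srefl y i : ht (x - r i y) = ht (x - y) + cr i y.
Proof. by rewrite sreflE !htB htZ ht_root; lra. Qed.

(** The claim proved by induction on the height of x - y: the reachable weights are
    closed under the real reflections that go up.  Closure under those that go down
    holds by construction. *)
Definition ascends n := forall y i, reach K x y -> ht (x - y) < n%:R ->
  K i -> real i -> cr i y < 0 -> reach K x (r i y).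

(** Climbing from y with r_i and r_j, as long as one of the two goes up, ends at a
    weight dominant for both. *)
Lemma reach_climb n i j m y : ascends n -> K i -> K j -> real i -> real j ->
    (m <= n)%N -> reach K x y -> ht (x - y) < m%:R ->
  exists z u, [/\ all [predU pred1 i & pred1 j] u, y = act u z, reach K x z,
    0 <= cr i z & 0 <= cr j z].
Proof.
move=> An Ki Kj ri rj; elim: m y => [|m IH] y mn xy hy.
  by have [/Qplus_ht] := reach_Qplus xint xy; lra.
have hn : ht (x - y) < n%:R by apply: (lt_le_trans hy); rewrite ler_nat.
have step k : K k -> real k -> [predU pred1 i & pred1 j] k -> cr k y < 0 ->
  exists z u, [/\ all [predU pred1 i & pred1 j] u, y = act u z, reach K x z,
    0 <= cr i z & 0 <= cr j z].
  move=> Kk rk kij ky; have xky := An y k xy hn Kk rk ky.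
  have k1 : 1 <= cr k (r k y).
    by apply: reach_int_ge1 => //; rewrite cr_srefl_real //; lra.
  have [|z [u [hu uz xz zi zj]]] := IH (r k y) (ltnW mn) xky.
    move: k1 hy; rewrite cr_srefl_real // ht_srefl -natr1; lra.
  exists z, (k :: u); split=> //; first by apply/andP.
  by rewrite act_cons -uz sreflK.
have hi : [predU pred1 i & pred1 j] i by apply/orP; left; exact: eqxx.
have hj : [predU pred1 i & pred1 j] j by apply/orP; right; exact: eqxx.
have [iy|iy] := ltP (cr i y) 0; first exact: (step i Ki ri hi iy).
have [jy|jy] := ltP (cr j y) 0; first exact: (step j Kj rj hj jy).
by exists y, [::].
Qed.

(** Let y = r_j y0 be the last descent.  If j is real, y lies in the dihedral orbit of
    a reachable weight dominant for i and j, and so does r_i y.  If j is imaginary,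
    the pairings of y0 and of r_i y0 with the two coroots have signs that force
    a_ij = 0, and then r_i and r_j commute. *)
Lemma reach_ascends n : ascends n.
Proof.
elim: n => [|n IH] y i xy hy Ki ri iy.
  by have [/Qplus_ht] := reach_Qplus xint xy; lra.
case: xy hy iy => [|j y0 Kj xy0 jy0] hy iy; first by have := xdom Ki; lra.
have j1 := reach_int_ge1 Kj xy0 jy0.
have hy0 : ht (x - y0) < n%:R by move: hy; rewrite ht_srefl -natr1; lra.
have [ji|ij] := eqVneq i j; first by rewrite -ji sreflK.
have [rj|ij'] := boolP (real j).
  have [z [u [hu -> xz zi zj]]] := reach_climb IH Ki Kj ri rj (leqnn n) xy0 hy0.
  apply: (@rank2_reach _ _ _ _ _ _ i j z [:: i, j & u]) => //.
  by apply/and3P; split=> //; apply/orP; [left | right]; exact: eqxx.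
have c0 : a i j <= 0 by exact: cartan_off.
have d0 : a j i <= 0 by rewrite cartan_off // eq_sym.
move: iy; rewrite cr_srefl => iy.
have iy0 : cr i y0 < 0.
  have : cr j y0 * a i j <= 0 by rewrite mulr_ge0_le0 // ltW.
  by lra.
have xy' := IH y0 i xy0 hy0 Ki ri iy0.
have := le_trans (xdom Kj) (reach_imag_ge0 Kj ij' xy').
rewrite cr_srefl => jy'.
have aij : a i j = 0.
  apply/eqP; apply: contraT => n0.
  have c1 : a i j <= -1.
    have : 1 <= - a i j; last by lra.
    by apply: nat_gt0_ge1; rewrite ?intN // oppr_gt0 lt_neqAle n0.
  have d1 : a j i <= -1.
    have : 1 <= - a j i; last by lra.
    apply: nat_gt0_ge1; rewrite ?intN // oppr_gt0 lt_neqAle d0 andbT.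
    by apply: contra n0 => /eqP/cartan_sym0 ->.
  exfalso; move: c1 d1 iy jy' iy0; clear.
  move: (a i j) (a j i) (cr i y0) (cr j y0) => c d p q c1 d1 h1 h2 p0.
  have : 0 <= (- p) * (d * c - 1) by apply: mulr_ge0; nra.
  have : 0 <= (q - p * d) * (- c) by apply: mulr_ge0; lra.
  by lra.
rewrite srefl_comm //; apply: reach_weak => //.
by rewrite cr_srefl.
Qed.

(** The orbit of a dominant weight is reached by descents.  A letter that would go up
    is real, since imaginary pairings stay nonnegative, and [reach_ascends] applies. *)
Theorem reach_act w : all K w -> reach K x (act w x).
Proof.
elim: w => [_|i w IH]; first exact: reach_refl.
rewrite act_cons => /= /andP[Ki /IH xy]; set y := act w x in xy *.
have [iy|iy] := leP 0 (cr i y); first exact: reach_weak.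
have [ri|ii] := boolP (real i); last first.
  by have := reach_imag_ge0 Ki ii xy; have := xdom Ki; lra.
have [/Qplus_ht_nat/natrP[n hn] _] := reach_Qplus xint xy.
by apply: (@reach_ascends n.+1) => //; rewrite hn ltr_nat.
Qed.

Lemma act_le w : all K w -> Qp (x - act w x).
Proof. by move=> /reach_act/(reach_Qplus xint) []. Qed.

(* The first descending step from a dominant weight. *)
(** The first letter of a nonempty descent has positive pairing with x itself. *)
Lemma act_first w : all K w -> act w x <> x ->
  exists j, [/\ K j, 0 < cr j x & Qp (x - act w x - al j)].
Proof.
move=> /reach_act; move: (act w x) => y; elim=> [//|j {}y Kj xy IH jy _].
have Q1 : Qp (cr j y *: al j - al j).
  rewrite -[X in _ - X]scale1r -scalerBl; apply: QplusZ; last exact: Qplus_root.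
    by apply: intB => //; have [_] := reach_Qplus xint xy; exact.
  by rewrite subr_ge0 reach_int_ge1.
have [yx|/eqP yx] := eqVneq y x.
  exists j; split=> //; first by rewrite -yx.
  by rewrite sreflE yx subKr -yx.
have [k [Kk kx Q]] := IH yx; exists k; split=> //.
have -> : x - r j y - al k = (x - y - al k) + cr j y *: al j.
  by rewrite sreflE opprB [_ *: _ - _]addrC addrA [LHS]addrAC.
apply: QplusD => //; apply: QplusZ; [|exact: ltW|exact: Qplus_root].
by have [_] := reach_Qplus xint xy; exact.
Qed.

End Descent.
End DescendingWords.

(** * Coroots and integral weights *)

Section Roots.
Variables (I : countType) (A : I -> I -> int).
Context {hA : borcherds_cartan A}.
Variable D : realization A.

Local Notation hd := (dual (cartan D)).
Local Notation al := (@Defs.root I A D).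
Local Notation cr i x := (pairing (coroot D i) x).
Local Notation a i j := ((A i j)%:~R : rat).
Local Notation r := (@srefl I A D).
Local Notation real := (is_real A).
Implicit Types (x y z mu nu beta : hd) (i j k l : I) (w u : seq I) (K : pred I).

Local Notation Qp := (@Qplus I A D).
Local Notation act := (@act I A D).

Local Notation act_co := (@act_co I A D).

Lemma pairing_srefl_co i (h : cartan D) x : pairing (srefl_co i h) x = pairing h (r i x).
Proof.
by rewrite /srefl_co pairingBl pairingZl sreflE pairingBr pairingZr mulrC.
Qed.

Lemma pairing_act_co w (h : cartan D) x : pairing (act_co w h) x = pairing h (act (rev w) x).
Proof.
elim: w x => // i w IH x.
by rewrite [LHS]pairing_srefl_co IH rev_cons -cats1 act_cat.
Qed.

(** For real w the reflection in the root w alpha_l is the word w r_l w^-1, for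
    imaginary l as well. *)
Lemma act_refl w l x : all real w ->
  act (w ++ l :: rev w) x = x - cr l (act (rev w) x) *: act w (al l).
Proof.
by move=> rw; rewrite act_cat act_cons sreflE actB actZ act_rev.
Qed.

Lemma refl_act w l x : all real w ->
  refl (act w (al l)) (act_co w (coroot D l)) x = act (w ++ l :: rev w) x.
Proof. by move=> rw; rewrite act_refl // /refl pairing_act_co. Qed.

(** There are enough weights: the simple coroots are linearly independent. *)
Lemma weight_exists (c : I -> rat) : exists x, forall i, cr i x = c i.
Proof. exact: (extend_functional c (@coroot_indep _ _ D)). Qed.

Lemma cr_act_ext w x y : (forall i, cr i x = cr i y) ->
  forall l, cr l (act w x) = cr l (act w y).
Proof.
move=> xy; elim: w => [|i w IH] l; first exact: xy.
by rewrite !act_cons !cr_srefl !IH.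
Qed.

(** As far as the simple coroots see, an integral weight is a difference of two
    dominant integral weights.  This reduces identities between coroots on integral
    weights to dominant ones. *)
Lemma integral_split x : integral x -> exists y z,
  [/\ integral y, integral z, forall i, 0 <= cr i y, forall i, 0 <= cr i z &
      forall i, cr i x = cr i (y - z)].
Proof.
move=> ix.
have [y yE] := weight_exists (fun i => Num.max (cr i x) 0).
have [z zE] := weight_exists (fun i => Num.max (- cr i x) 0).
exists y, z; split.
- by move=> i; rewrite yE /Order.max; case: ifP.
- by move=> i; rewrite zE /Order.max; case: ifP => // _; exact: intN.
- by move=> i; rewrite yE le_max lexx orbT.
- by move=> i; rewrite zE le_max lexx orbT.
- move=> i; rewrite pairingBr yE zE /Order.max; case: ltP => ?; case: ltP => ?; lra.
Qed.

(** * Positivity of roots *)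

Definition Qlattice x := exists y z, [/\ Qp y, Qp z & x = y - z].

Lemma Qplus_lattice x : Qp x -> Qlattice x.
Proof. by move=> Qx; exists x, 0; split; rewrite ?subr0 //; exact: Qplus0. Qed.

Lemma QlatticeN x : Qlattice x -> Qlattice (- x).
Proof. by move=> [y [z [Qy Qz ->]]]; exists z, y; split; rewrite ?opprB. Qed.

Lemma QlatticeD x y : Qlattice x -> Qlattice y -> Qlattice (x + y).
Proof.
move=> [x1 [x2 [Q1 Q2 ->]]] [y1 [y2 [Q3 Q4 ->]]].
by exists (x1 + y1), (x2 + y2); split; rewrite ?opprD 1?addrACA //; exact: QplusD.
Qed.

Lemma Qlattice_srefl i x : Qlattice x -> Qlattice (r i x).
Proof.
move=> Qx; rewrite sreflE; apply: QlatticeD => //.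
have ix : cr i x \is a Num.int.
  case: Qx => y [z [Qy Qz ->]].
  by apply: integralB; exact: Qplus_integral.
rewrite -scaleNr; have := intN ix; move: (- _) => b.
rewrite intrE => /orP[] /natrP[n bn].
  apply: Qplus_lattice; apply: QplusZ; rewrite ?bn ?ler0n //; exact: Qplus_root.
rewrite -[b]opprK scaleNr; apply/QlatticeN/Qplus_lattice.
by apply: QplusZ; rewrite ?bn ?ler0n //; exact: Qplus_root.
Qed.

Lemma Qlattice_act w i : Qlattice (act w (al i)).
Proof.
elim: w => [|j w IH]; first exact/Qplus_lattice/Qplus_root.
exact: Qlattice_srefl.
Qed.

Lemma Qplus_coord_int i x : Qp x -> rcoord i x \is a Num.int.
Proof.
move: x; apply: Qplus_ind => [|j x _ IH]; first by rewrite rcoord0.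
by rewrite rcoordD rcoord_root; apply: intD.
Qed.

Lemma Qlattice_coord_int i x : Qlattice x -> rcoord i x \is a Num.int.
Proof.
by move=> [y [z [Qy Qz ->]]]; rewrite rcoordB; apply: intB; exact: Qplus_coord_int.
Qed.

Lemma Qplus_coord_gt0 i x : Qp x -> 0 < rcoord i x -> Qp (x - al i).
Proof.
move: x; apply: Qplus_ind => [|j x Qx IH]; first by rewrite rcoord0 ltxx.
have [<- _|ij] := eqVneq j i; first by rewrite addrC addKr.
rewrite rcoordD rcoord_root eq_sym (negbTE ij) add0r => /IH Q.
by rewrite -addrA; apply: QplusD => //; exact: Qplus_root.
Qed.

Lemma Qlattice_ge0 x : Qlattice x -> (forall i, 0 <= rcoord i x) -> Qp x.
Proof.
move=> [y [z [Qy [t ->] ->]]]; elim: t y Qy => [|j t IH] y Qy.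
  by rewrite big_nil subr0.
rewrite big_cons opprD addrA => h; apply: IH.
  apply: Qplus_coord_gt0 => //; have := h j.
  have Qt : Qp (\sum_(k <- t) al k) by exists t.
  by have := Qplus_coord j Qt; rewrite !rcoordB rcoord_root eqxx /=; lra.
exact: h.
Qed.

(** The coordinates of x are integers, and b does not change their signs. *)
Lemma Qlattice_scale (b : rat) x : Qlattice x -> 0 < b -> Qp (b *: x) -> Qp x.
Proof.
move=> Qx b0 Qb; apply: Qlattice_ge0 => // i.
by have := Qplus_coord i Qb; rewrite rcoordZ pmulr_rge0.
Qed.

(** The reflection in b = w alpha_l subtracts a multiple of b from a dominant weight,
    and the difference lies in Q^+, so the sign of b is that of its coroot at any
    dominant weight where the coroot does not vanish.  There is one because the
    coroot takes the value 2 at b. *)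
Lemma real_root_sign w l : all real w -> real l ->
  Qp (act w (al l)) \/ Qp (- act w (al l)).
Proof.
move=> rw rl; set b := act w (al l).
have Qb : Qlattice b by exact: Qlattice_act.
have ib : integral b by exact: (act_integral w (root_integral D l)).
have [y [z [iy iz y0 z0 yz]]] := integral_split ib.
have val x : integral x -> (forall i, 0 <= cr i x) -> cr l (act (rev w) x) != 0 ->
    Qp b \/ Qp (- b).
  move=> ix x0; have := @act_le _ _ hA _ real x (fun i _ => ix i) (fun i _ => x0 i)
    (w ++ l :: rev w).
  rewrite all_cat /= all_rev rw rl act_refl // subKr => /(_ isT).
  set c := cr l _; rewrite neq_lt => Qc /orP[] c0.
    right; apply: (@Qlattice_scale (- c)); rewrite ?oppr_gt0 ?scalerN ?scaleNr ?opprK //.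
    exact: QlatticeN.
  by left; exact: (@Qlattice_scale c).
have [vy|] := eqVneq (cr l (act (rev w) y)) 0; last exact: val.
have [vz|] := eqVneq (cr l (act (rev w) z)) 0; last exact: val.
have := cr_act_ext (rev w) yz l.
by rewrite act_revK // actB pairingBr vy vz cr_root cartan_real // subr0.
Qed.

(** The weight - alpha_i is dominant for the real simple roots. *)
Lemma imag_root_ge w i : all real w -> ~~ real i -> Qp (act w (al i) - al i).
Proof.
move=> rw ii; have := @act_le _ _ hA _ real (- al i) _ _ w rw.
rewrite actN opprK addrC; apply.
- by move=> j _; apply: integralN; exact: root_integral.
- by move=> j rj; rewrite pairingNr cr_root oppr_ge0 cartan_off // (real_neq rj).
Qed.

Lemma imag_neq_real w i j : all real w -> ~~ real i -> real j -> act w (al i) <> al j.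
Proof.
move=> rw ii rj E; have := imag_root_ge rw ii; rewrite E => /Qplus_root_sub ji.
by rewrite ji (negbTE ii) in rj.
Qed.

Lemma imag_root_Qplus beta : imag_root beta -> Qp beta.
Proof.
move=> [w [i [rw ii ->]]]; rewrite -[act _ _](subrK (al i)).
by apply: QplusD; [exact: imag_root_ge | exact: Qplus_root].
Qed.

Lemma pos_root_Qplus beta : pos_root beta -> Qp beta.
Proof. by case=> [[_ //]|]; exact: imag_root_Qplus. Qed.

Lemma real_imag_disjoint beta : real_pos_root beta -> imag_root beta -> False.
Proof.
move=> [[w [l [rw rl ->]]] _] [u [i [ru ii E]]].
apply: (@imag_neq_real (rev w ++ u) i l) => //; first by rewrite all_cat all_rev rw.
by rewrite act_cat -E act_revK.
Qed.

(** Both b and 1/b are integers, as coordinates of elements of the root lattice. *)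
Lemma root_multiple w l i (b : rat) : all real w -> 0 < b ->
  act w (al l) = b *: al i -> act w (al l) = al i.
Proof.
move=> rw b0 E.
have b1 : 1 <= b.
  apply: nat_gt0_ge1 => //.
  by have := Qlattice_coord_int i (Qlattice_act w l); rewrite E rcoordZ rcoord_root eqxx mulr1.
have c1 : 1 <= b^-1.
  apply: nat_gt0_ge1; rewrite ?invr_gt0 //.
  have := Qlattice_coord_int l (Qlattice_act (rev w) i).
  have -> : al i = b^-1 *: act w (al l) by rewrite E scalerA mulVf ?scale1r ?gt_eqF.
  by rewrite actZ act_revK // rcoordZ rcoord_root eqxx mulr1.
have -> : al i = b *: al i; last by [].
suff -> : b = 1 by rewrite scale1r.
apply/le_anti; rewrite b1 andbT.
by move: c1; rewrite -[X in X <= _]invr1 lef_pV2 // posrE.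
Qed.

Lemma pos_root_simple i beta : pos_root beta ->
  (forall j, j != i -> rcoord j beta = 0) -> beta = al i.
Proof.
move=> pb cb; have Qb := pos_root_Qplus pb.
have [n bn] := Qplus_coord_zero Qb cb.
have [w [l [rw E]]] : exists w l, all real w /\ beta = act w (al l).
  by case: pb => [[[w [l [rw _ E]]] _]|[w [l [rw _ E]]]]; exists w, l.
have n0 : 0 < n%:R :> rat.
  rewrite ltr0n lt0n; apply/eqP => n0; move: bn; rewrite n0 scale0r E.
  move=> /(congr1 (act (rev w))); rewrite act_revK //.
  by rewrite -(scale0r (0 : hd)) actZ scale0r => /root_neq0.
by rewrite E; apply: (root_multiple rw n0); rewrite -E.
Qed.

Lemma pos_root_neq0 beta : pos_root beta -> 0 < ht beta.
Proof.
move=> pb; rewrite lt_def Qplus_ht ?andbT; last exact: pos_root_Qplus.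
apply/eqP => /eqP; rewrite eq_le => /andP[h _].
have b0 := Qplus_ht_le0 (pos_root_Qplus pb) h.
have [w [l [rw E]]] : exists w l, all real w /\ beta = act w (al l).
  by case: pb => [[[w [l [rw _ E]]] _]|[w [l [rw _ E]]]]; exists w, l.
move: b0; rewrite E => /(congr1 (act (rev w))); rewrite act_revK //.
by rewrite -(scale0r (0 : hd)) actZ scale0r => /root_neq0.
Qed.

(** A real reflection changes only one coordinate.  So if beta is sent to a negative
    root, its other coordinates vanish. *)
Lemma pos_root_srefl i beta : real i -> pos_root beta -> beta <> al i ->
  pos_root (r i beta).
Proof.
move=> ri pb bi; case: (pb) => [[[w [l [rw rl E]]] Qb]|[w [l [rw il E]]]]; last first.
  by right; exists (i :: w), l; split; rewrite /= ?ri ?rw // E.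
left; split; first by exists (i :: w), l; split; rewrite /= ?ri ?rw // E.
have [||//|Qn] := @real_root_sign (i :: w) l; rewrite /= ?ri ?rw //.
  by rewrite act_cons -E.
case: bi; apply: pos_root_simple => // j ji; apply/le_anti.
rewrite Qplus_coord // andbT.
by have := Qplus_coord j Qn; rewrite act_cons -E rcoordN rcoord_srefl 1?eq_sym // oppr_ge0.
Qed.

Lemma coroot_of_srefl i beta b : real i -> coroot_of beta b ->
  coroot_of (r i beta) (srefl_co i b).
Proof.
by move=> ri [w [l [rw -> ->]]]; exists (i :: w), l; split; rewrite /= ?ri.
Qed.

(** * Uniqueness of coroots *)

(** For dominant x, let c be the value at x of the coroot of w alpha_l = alpha_i.
    Applying r_i after the reflection in w alpha_l, or before it, changes x by a
    multiple of alpha_i, namely by cr i x - c and by c - cr i x.  Both are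
    nonnegative as x - u x lies in Q^+ for every u in W. *)
Lemma coroot_simple_real w l i x : all real w -> real l -> act w (al l) = al i ->
  integral x -> (forall j, 0 <= cr j x) -> cr l (act (rev w) x) = cr i x.
Proof.
move=> rw rl E ix x0.
have ri : real i.
  apply: contraT => ii; case: (@imag_neq_real (rev w) i l); rewrite ?all_rev //.
  by rewrite -E act_revK.
set w' := w ++ l :: rev w.
have rw' : all real w' by rewrite all_cat /= all_rev rw rl.
have le u : all real u -> 0 <= ht (x - act u x).
  by move=> ru; apply/Qplus_ht/(@act_le _ _ hA _ real) => //.
set c := cr l _; have act1 : act w' x = x - c *: al i by rewrite act_refl // E.
have h1 : 0 <= cr i x - c.
  have := le (i :: w'); rewrite /= ri rw' => /(_ isT).
  rewrite act_cons act1 sreflB sreflZ srefl_root_real // sreflE.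
  by rewrite !htB htZ htN htZ ht_root; lra.
have h2 : 0 <= c - cr i x.
  have := le (w' ++ [:: i]); rewrite all_cat /= ri rw' => /(_ isT).
  have act2 : act w' (al i) = - al i.
    have wi : act (rev w) (al i) = al l by rewrite -E act_revK.
    by rewrite act_refl // wi cr_root cartan_real // E scaler_nat mulr2n opprD addNKr.
  rewrite act_cat act_cons act_nil sreflE actB actZ act1 act2.
  by rewrite !(htB, htZ, htN) ht_root; lra.
by lra.
Qed.

(** For imaginary i, the element w fixes alpha_i, so it moves x and x - N alpha_i by
    the same amount.  For N larger than the height of that amount, a descending word
    from x - N alpha_i cannot use a reflection moving alpha_i, since its first use
    would subtract at least N; reflections fixing alpha_i do not change the pairing
    with its coroot. *)
Lemma coroot_simple_imag w i x : all real w -> ~~ real i -> act w (al i) = al i ->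
  integral x -> (forall j, 0 <= cr j x) -> cr i (act w x) = cr i x.
Proof.
move=> rw ii E ix x0.
have [/Qplus_ht_nat/natrP[n hn] _] : Qp (x - act w x) /\ True.
  by split=> //; apply: (@act_le _ _ hA _ real) => //.
pose N : rat := n.+1%:R; pose y := x - N *: al i.
have iy : integral_on real y.
  move=> j _; apply: integralB => //.
  by apply: integralZ; [exact: natr_int | exact: root_integral].
have cry j : cr j y = cr j x - N * a j i by rewrite pairingBr pairingZr cr_root.
have y0 j : real j -> 0 <= cr j y.
  move=> rj; rewrite cry addr_ge0 // oppr_ge0 mulr_ge0_le0 ?ler0n //.
  by rewrite cartan_off // (real_neq rj).
have key z : reach real y z -> ht (y - z) < N ->
    cr i (y - z) = 0 /\ forall k, a k i != 0 -> cr k (y - z) <= 0.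
  elim=> [|k {}z rk yz IH kz]; first by rewrite subrr pairing0r; split=> // k; rewrite pairing0r.
  rewrite ht_srefl => hz; have [Qz _] := reach_Qplus iy yz.
  have [|i0 k0] := IH; first by lra.
  have zE j : cr j (y - r k z) = cr j (y - z) + cr k z * a j k.
    by rewrite sreflE opprB [_ *: _ - _]addrC addrA [LHS]pairingDr pairingZr cr_root.
  have aki : a k i = 0.
    apply/eqP; apply: contraT => nk; have := k0 k nk.
    have := Qplus_ht Qz; have := x0 k.
    rewrite pairingBr cry.
    have : 1 <= - a k i.
      apply: nat_gt0_ge1; rewrite ?intN // oppr_gt0 lt_neqAle nk.
      by rewrite cartan_off // (real_neq rk).
    have : 0 <= N by rewrite ler0n.
    by move: hz; clear; move: (a k i) => c; nra.
  have aik := cartan_sym0 aki.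
  split; first by rewrite zE i0 aik mulr0 addr0.
  move=> k' nk'; rewrite zE; have := k0 _ nk'.
  have : cr k z * a k' k <= 0.
    rewrite mulr_ge0_le0 ?(ltW kz) // cartan_off //.
    by apply: contraNneq nk' => ->; rewrite aki.
  by lra.
have yw : y - act w y = x - act w x.
  by rewrite /y actB actZ E opprB addrA subrK.
have [||+ _] := key (act w y).
- exact: reach_act.
- by rewrite yw hn ltr_nat.
- by rewrite yw pairingBr => /eqP; rewrite subr_eq0 => /eqP ->.
Qed.

Lemma coroot_simple w l i x : all real w -> act w (al l) = al i -> integral x ->
  cr l (act (rev w) x) = cr i x.
Proof.
move=> rw E ix; have [y [z [iy iz y0 z0 yz]]] := integral_split ix.
rewrite (cr_act_ext (rev w) yz) yz actB !pairingBr.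
have main t : integral t -> (forall i, 0 <= cr i t) -> cr l (act (rev w) t) = cr i t.
  move=> it t0; have [rl|il] := boolP (real l); first exact: coroot_simple_real.
  have := imag_root_ge rw il; rewrite E => /Qplus_root_sub il'.
  move: E; rewrite il' => E; apply: coroot_simple_imag; rewrite ?all_rev //.
  by rewrite -{1}E act_revK.
by rewrite !main.
Qed.

(** The coroot of a root is well defined on integral weights.  After applying an
    element of W one of the two presentations of the root is a simple root. *)
Lemma coroot_of_uniq beta b c x : coroot_of beta b -> coroot_of beta c ->
  integral x -> pairing b x = pairing c x.
Proof.
move=> [w [l [rw -> ->]]] [u [k [ru E ->]]] ix; rewrite !pairing_act_co.
have := @coroot_simple (rev u ++ w) l k (act (rev u) x).
rewrite all_cat all_rev ru rw rev_cat revK act_cat E act_revK // => /(_ isT erefl) <-.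
  by rewrite act_cat act_rev.
exact: act_integral.
Qed.

Lemma coroot_of_root i : coroot_of (al i) (coroot D i).
Proof. by exists [::], i. Qed.

Lemma coroot_of_simple i b x : coroot_of (al i) b -> integral x ->
  pairing b x = cr i x.
Proof. by move=> cb; exact: coroot_of_uniq cb (coroot_of_root i). Qed.

Lemma coroot_of_int beta b x : coroot_of beta b -> integral x ->
  pairing b x \is a Num.int.
Proof.
by move=> [w [l [_ _ ->]]] ix; rewrite pairing_act_co; exact: act_integral.
Qed.

Lemma coroot_of_integral beta b : coroot_of beta b -> integral beta.
Proof. by move=> [w [l [_ -> _]]]; apply: act_integral; exact: root_integral. Qed.

(** * Signs of pairings with imaginary roots *)

(** For imaginary i the weight x = - alpha_i is dominant for all simple roots, so the
    reflection in beta lowers it.  If it moves x, the first descent is by a letter k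
    with a_ki < 0, and k occurs in beta; then a_ik < 0 makes the pairing of beta with
    the coroot of alpha_i negative. *)
Lemma coroot_imag_sign i beta b : ~~ real i -> pos_root beta -> coroot_of beta b ->
  pairing b (al i) <= 0 /\ (pairing b (al i) != 0 -> cr i beta < 0).
Proof.
move=> ii pb [w [l [rw E cE]]]; pose x := - al i; set u := w ++ l :: rev w.
have Qb := pos_root_Qplus pb.
have ix : integral_on predT x.
  by move=> j _; apply: integralN; exact: root_integral.
have x0 j : predT j -> 0 <= cr j x.
  move=> _; rewrite pairingNr cr_root oppr_ge0.
  by have [->|/cartan_off //] := eqVneq j i; exact: cartan_imag.
have ux : act u x = x - pairing b x *: beta by rewrite act_refl // cE pairing_act_co E.
have Qu := @act_le _ _ hA _ predT x ix x0 u (all_predT _).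
have bx : pairing b x = - pairing b (al i) by [].
rewrite ux subKr bx in Qu.
have bneg : pairing b (al i) <= 0.
  have := Qplus_ht Qu; rewrite htZ; have := pos_root_neq0 pb.
  by move=> h; rewrite pmulr_lge0 // oppr_ge0.
split=> // bn.
have [|k [_ kx]] := @act_first _ _ hA _ predT x ix x0 u (all_predT _).
  rewrite ux bx => /(congr1 (@ht _ _ D)); rewrite htB htZ.
  have := pos_root_neq0 pb => h /eqP; rewrite -subr_eq0 addrAC subrr add0r.
  by rewrite oppr_eq0 mulf_eq0 oppr_eq0 (negbTE bn) gt_eqF.
rewrite ux subKr bx => /(Qplus_coord k); rewrite rcoordB rcoordZ rcoord_root eqxx /= => h.
have ck : 0 < rcoord k beta.
  rewrite lt_def Qplus_coord // andbT; apply: contraTneq h => ->.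
  by rewrite mulr0 -ltNge; lra.
have : cr i (beta - al k) <= 0 by exact: Qplus_cr_imag ii (Qplus_coord_gt0 Qb ck).
rewrite pairingBr cr_root.
suff : a i k < 0 by lra.
move: kx; rewrite pairingNr cr_root oppr_gt0 => aki.
rewrite lt_neqAle cartan_imag_le0 // andbT.
by apply: contraTneq aki => /cartan_sym0 ->; rewrite ltxx.
Qed.

(** Up to sign w^-1 alpha_j is a positive root, to which [coroot_imag_sign] applies. *)
Lemma imag_real_sign w i j : all real w -> ~~ real i -> real j ->
  0 < cr j (act w (al i)) -> 0 < cr i (act (rev w) (al j)).
Proof.
move=> rw ii rj n0; have rv : all real (rev w) by rewrite all_rev.
set g := act (rev w) (al j).
have [Qg|Qg] := real_root_sign rv rj.
  have pg : pos_root g by left; split=> //; exists (rev w), j.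
  have [|+ _] := @coroot_imag_sign i g (act_co (rev w) (coroot D j)) ii pg.
    by exists (rev w), j.
  by rewrite pairing_act_co revK; lra.
have gE : - g = act (rev w ++ [:: j]) (al j).
  by rewrite act_cat act_cons act_nil srefl_root_real // actN.
have rv' : all real (rev w ++ [:: j]) by rewrite all_cat rv /= rj.
have pg : pos_root (- g) by left; split=> //; exists (rev w ++ [:: j]), j.
have [|_] := @coroot_imag_sign i (- g) (act_co (rev w ++ [:: j]) (coroot D j)) ii pg.
  by exists (rev w ++ [:: j]), j.
rewrite pairing_act_co rev_cat revK act_cat /= act_cons act_nil cr_srefl_real //.
by rewrite oppr_eq0 gt_eqF // pairingNr oppr_lt0; apply.
Qed.

(** An antidominant weight is the lowest in its W-orbit, and so is alpha_i
    ([imag_root_ge]). *)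
Lemma imag_antidominant w i : all real w -> ~~ real i ->
  (forall j, real j -> cr j (act w (al i)) <= 0) -> act w (al i) = al i.
Proof.
move=> rw ii h; apply/eqP; rewrite -subr_eq0; apply/eqP.
apply: Qplus_anti; first exact: imag_root_ge.
have := @act_le _ _ hA _ real (- act w (al i)) _ _ (rev w).
rewrite all_rev actN act_revK // opprK opprB [al i - _]addrC; apply => //.
- by move=> j _; apply: integralN; apply: act_integral; exact: root_integral.
- by move=> j rj; rewrite pairingNr oppr_ge0 h.
Qed.

(** * The orbit of a dominant weight *)

Variable lam : hd.
Hypothesis hlam : dominant lam.

Local Notation Tl := (Torbit lam).

Lemma Torbit_integral mu : Tl mu -> integral mu.
Proof. by move=> [w ->]; apply: act_integral => i; case: (hlam i). Qed.

Lemma Torbit_le mu : Tl mu -> Qp (lam - mu).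
Proof.
by move=> [w ->]; apply: (@act_le _ _ hA _ predT); rewrite ?all_predT // => i _;
  case: (hlam i).
Qed.

Lemma Torbit_srefl i mu : Tl mu -> Tl (r i mu).
Proof. by move=> [w ->]; exists (i :: w). Qed.

Lemma Torbit_act w mu : Tl mu -> Tl (act w mu).
Proof. by move=> [u ->]; exists (w ++ u); rewrite act_cat. Qed.

Lemma Torbit_lam : Tl lam.
Proof. by exists [::]. Qed.

Lemma Torbit_refl beta b mu : coroot_of beta b -> Tl mu -> Tl (refl beta b mu).
Proof. by move=> [w [l [rw -> ->]]] Tm; rewrite refl_act //; exact: Torbit_act. Qed.

Lemma Torbit_imag i mu : ~~ real i -> Tl mu -> 0 <= cr i mu.
Proof.
move=> ii /Torbit_le/(Qplus_cr_imag ii); rewrite pairingBr.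
by case: (hlam i) => _; lra.
Qed.

Lemma Torbit_imag_root w i mu : ~~ real i -> Tl mu -> 0 <= pairing (act_co w (coroot D i)) mu.
Proof.
by move=> ii Tm; rewrite pairing_act_co; apply: Torbit_imag => //; exact: Torbit_act.
Qed.

End Roots.

Section OrderAndChains.
Variables (I : countType) (A : I -> I -> int).
Context {hA : borcherds_cartan A}.
Variable D : realization A.

Local Notation hd := (dual (cartan D)).
Local Notation al := (@Defs.root I A D).
Local Notation cr i x := (pairing (coroot D i) x).
Local Notation a i j := ((A i j)%:~R : rat).
Local Notation r := (@srefl I A D).
Local Notation real := (is_real A).
Implicit Types (x y z mu nu beta : hd) (i j k l : I) (w u : seq I) (K : pred I).

Local Notation Qp := (@Qplus I A D).
Local Notation act := (@act I A D).

Local Notation act_co := (@act_co I A D).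
Implicit Types (a : rat) (b c : cartan D) (m n : nat).

(** * The order on weights *)

(** One step of the order, upwards from nu to mu in the order and down in weight.
    Integrality of nu stands for membership in the orbit of lam: it is what the
    uniqueness of coroots asks for, and it is stable under all reflections. *)
Definition step mu nu := integral nu /\ exists beta b,
  [/\ pos_root beta, coroot_of beta b, mu = refl beta b nu & 0 < pairing b nu].

Fixpoint steps n mu nu :=
  if n is n'.+1 then exists2 kap, step mu kap & steps n' kap nu else mu = nu.

Lemma refl_integral beta b x : coroot_of beta b -> integral x -> integral (refl beta b x).
Proof.
move=> cb ix; apply: integralB => //; apply: integralZ.
  exact: coroot_of_int cb ix.
exact: coroot_of_integral cb.
Qed.

Lemma step_integral mu nu : step mu nu -> integral mu.
Proof. by move=> [inu [beta [b [_ cb -> _]]]]; exact: refl_integral. Qed.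

Lemma steps_integral n mu nu : integral nu -> steps n mu nu -> integral mu.
Proof. by case: n => [|n] inu; [move=> /= -> | move=> [kap /step_integral]]. Qed.

Lemma steps1 mu nu : step mu nu -> steps 1 mu nu.
Proof. by move=> s; exists nu. Qed.

Lemma steps_cat m n x y z : steps m x y -> steps n y z -> steps (m + n) x z.
Proof.
elim: m x => [|m IH] x /=; first by move=> ->.
by move=> [k xk ky] yz; exists k => //; exact: IH ky yz.
Qed.

Lemma steps_snoc n x z : steps n.+1 x z -> exists2 y, steps n x y & step y z.
Proof.
elim: n x => [|n IH] x; first by move=> [k xk <-]; exists x.
by move=> [k xk /IH [y ky yz]]; exists y => //; exists k.
Qed.

Lemma order_chain_steps s mu nu : integral nu -> order_chain mu nu s -> steps s mu nu.
Proof.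
move=> inu; elim: s mu => [|s IH] mu [l [beta [b [l0 ls h]]]]; first by rewrite -l0 -ls.
have st : steps s (l 1%N) nu.
  apply: IH; exists (fun i : nat => l i.+1), (fun i : nat => beta i.+1), (fun i : nat => b i.+1).
  split=> // i /andP[i0 is1]; have := h i.+1.
  by rewrite /= ltnS is1 => /(_ isT); case: (i) i0.
exists (l 1%N) => //; split; first exact: steps_integral st.
by exists (beta 1%N), (b 1%N); have := h 1%N isT; rewrite /= l0.
Qed.

Lemma steps_order_chain s mu nu : steps s mu nu -> order_chain mu nu s.
Proof.
elim: s mu => [|s IH] mu.
  by move=> /= ->; exists (fun=> nu), (fun=> 0), (fun=> 0); split=> // -[|i].
move=> [kap [ik [beta [b [pb cb mE bk]]]] /IH [l [be [bb [l0 ls h]]]]].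
exists (fun i : nat => if i is i'.+1 then l i' else mu),
  (fun i : nat => if i is i'.+2 then be i'.+1 else beta),
  (fun i : nat => if i is i'.+2 then bb i'.+1 else b).
split=> // -[|[|i]] // hi; first by rewrite /= l0.
by have := h i.+1 hi.
Qed.

Lemma step_diff mu nu : step mu nu ->
  exists beta (k : rat), [/\ pos_root beta, 1 <= k, k \is a Num.int & nu - mu = k *: beta].
Proof.
move=> [inu [beta [b [pb cb -> bn]]]]; exists beta, (pairing b nu).
have ib := coroot_of_int cb inu; split=> //; first exact: nat_gt0_ge1.
by rewrite /refl subKr.
Qed.

Lemma step_Qplus mu nu : step mu nu -> Qp (nu - mu) /\ ht mu < ht nu.
Proof.
move=> /step_diff [beta [k [pb k1 ik E]]]; have k0 : 0 <= k by lra.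
split; first by rewrite E; apply: QplusZ => //; exact: pos_root_Qplus.
have h : 0 < ht beta by exact: pos_root_neq0.
have := congr1 (@ht _ _ D) E; rewrite htB htZ => e.
by rewrite -subr_gt0 e mulr_gt0 //; lra.
Qed.

Lemma steps_Qplus n mu nu : steps n mu nu -> Qp (nu - mu).
Proof.
elim: n mu => [|n IH] mu; first by move=> /= ->; rewrite subrr; exact: Qplus0.
move=> [kap /step_Qplus[Q _] /IH Q'].
by have := QplusD Q' Q; rewrite addrA subrK.
Qed.

Lemma steps_ht n mu nu : steps n mu nu -> (0 < n)%N -> ht mu < ht nu.
Proof.
case: n => // n [kap /step_Qplus[_ h] /steps_Qplus/Qplus_ht].
by rewrite htB => h' _; lra.
Qed.

Lemma pos_root_root i : pos_root (al i).
Proof.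
have [ri|ii] := boolP (real i); last by right; exists [::], i.
by left; split; [exists [::], i | exact: Qplus_root].
Qed.

Lemma step_simple i x : integral x -> 0 < cr i x -> step (r i x) x.
Proof.
move=> ix x0; split=> //; exists (al i), (coroot D i); split=> //.
  exact: pos_root_root.
exact: coroot_of_root.
Qed.

Lemma step_up i x : real i -> integral x -> cr i x < 0 -> step x (r i x).
Proof.
move=> ri ix x0; rewrite -{1}(sreflK x ri); apply: step_simple.
  exact: srefl_integral.
by rewrite cr_srefl_real //; lra.
Qed.

Lemma refl_srefl i beta b x : real i ->
  refl (r i beta) (srefl_co i b) (r i x) = r i (refl beta b x).
Proof.
by move=> ri; rewrite /refl pairing_srefl_co sreflK // sreflB sreflZ.
Qed.

(** A real r_i permutes the positive roots other than alpha_i. *)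
Lemma step_srefl i x y : real i -> step x y ->
  (x = r i y /\ 0 < cr i y) \/ step (r i x) (r i y).
Proof.
move=> ri [iy [beta [b [pb cb -> by0]]]].
have [bi|bi] := eqVneq beta (al i).
  left; rewrite bi in cb *; have E : pairing b y = cr i y by exact: coroot_of_simple cb iy.
  by split; [rewrite /refl E | rewrite -E].
right; split; first exact: srefl_integral.
exists (r i beta), (srefl_co i b); split.
- by apply: pos_root_srefl => //; exact/eqP.
- exact: coroot_of_srefl.
- by rewrite refl_srefl.
- by rewrite pairing_srefl_co sreflK.
Qed.

Lemma steps_srefl_end i n x y : real i -> steps n x y ->
  steps n (r i x) (r i y) \/ (0 < n)%N /\ steps n.-1 x (r i y).
Proof.
move=> ri; elim: n x => [|n IH] x; first by move=> /= ->; left.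
move=> [k xk /IH [h|[n0 h]]]; last first.
  by right; split=> //; case: n n0 h {IH} => // n _ h; exists k.
have [[-> _]|s] := step_srefl ri xk; first by right.
by left; exists (r i k).
Qed.

Lemma steps_srefl_start i n x y : real i -> steps n x y ->
  steps n (r i x) (r i y) \/ (0 < n)%N /\ steps n.-1 (r i x) y.
Proof.
move=> ri; elim: n x => [|n IH] x; first by move=> /= ->; left.
move=> [k xk ky].
have [[-> _]|s] := step_srefl ri xk; first by right; rewrite sreflK.
have [h|[n0 h]] := IH k ky; first by left; exists (r i k).
by right; split=> //; case: n n0 h {IH ky} => // n _ h; exists (r i k).
Qed.

(** Reflecting a sequence of steps loses at most the one step by alpha_i; the step
    from r_i x to x makes up for it. *)
Lemma steps_srefl_pos i n x y : real i -> integral x -> 0 < cr i x -> steps n x y ->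
  steps n (r i x) (r i y).
Proof.
move=> ri ix x0 xy; have [//|[n0 h]] := steps_srefl_end ri xy.
rewrite -(prednK n0); apply: (steps_cat (m := 1) _ h).
by apply: steps1; exact: step_simple.
Qed.

Lemma steps_srefl_neg i n x y : real i -> integral y -> cr i y < 0 -> steps n x y ->
  steps n (r i x) (r i y).
Proof.
move=> ri iy y0 xy; have [//|[n0 h]] := steps_srefl_start ri xy.
rewrite -(prednK n0) -addn1; apply: (steps_cat h).
by apply: steps1; exact: step_up.
Qed.

Lemma step_cr_imag i x y : ~~ real i -> step x y -> cr i y <= cr i x.
Proof.
move=> ii /step_Qplus[Q _]; have : cr i (y - x) <= 0 by exact: Qplus_cr_imag.
by rewrite pairingBr subr_le0.
Qed.

Lemma steps_cr_imag i n x y : ~~ real i -> steps n x y -> cr i y <= cr i x.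
Proof.
move=> ii /steps_Qplus Q; have : cr i (y - x) <= 0 by exact: Qplus_cr_imag.
by rewrite pairingBr subr_le0.
Qed.

(** If the coroot of an imaginary alpha_i vanishes on beta, then beta^vee vanishes on
    alpha_i, and the reflection in beta commutes with translation along alpha_i. *)
Lemma imag_shift i beta b x (t : rat) : ~~ real i -> pos_root beta -> coroot_of beta b ->
    0 < pairing b x -> cr i (refl beta b x) = cr i x ->
  pairing b (al i) = 0 /\ refl beta b (x + t *: al i) = refl beta b x + t *: al i.
Proof.
move=> ii pb cb bx; rewrite pairingBr pairingZr => e.
have cb0 : cr i beta = 0.
  have /eqP : pairing b x * cr i beta = 0 by lra.
  by rewrite mulf_eq0 gt_eqF //= => /eqP.
have b0 : pairing b (al i) = 0.
  have [_ h] := @coroot_imag_sign _ _ hA _ _ _ _ ii pb cb.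
  by apply/eqP; apply: contraT => /h; rewrite cb0 ltxx.
split=> //; rewrite /refl pairingDr pairingZr b0 mulr0 addr0.
by rewrite addrAC.
Qed.

(** The pairing with the coroot of an imaginary i is monotone along steps; if its
    values at the ends agree it is constant, and [imag_shift] applies to each step. *)
Lemma steps_shift i n x y (t : rat) : ~~ real i -> t \is a Num.int -> steps n x y ->
  cr i x = cr i y -> steps n (x + t *: al i) (y + t *: al i).
Proof.
move=> ii it; elim: n x => [|n IH] x; first by move=> /= ->.
move=> [k xk ky] xy.
have h1 := step_cr_imag ii xk; have h2 := steps_cr_imag ii ky.
have ky' : cr i k = cr i y by apply/le_anti/andP; split=> //; rewrite -xy.
exists (k + t *: al i); last exact: IH.
case: xk => ik [beta [b [pb cb xE bk]]]; split.
  by apply: integralD => //; apply: integralZ => //; exact: root_integral.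
have [|b0 E] := imag_shift t ii pb cb bk; first by rewrite -xE ky'.
exists beta, b; split=> //; first by rewrite E xE.
by rewrite pairingDr pairingZr b0 mulr0 addr0.
Qed.

(** The distance from mu to nu is at most 1. *)
Definition covers mu nu := forall n, steps n mu nu -> (n <= 1)%N.

(** A weight between r_i x and x differs from x by a multiple of alpha_i, so the root
    of the last step is alpha_i. *)
Lemma covers_simple i x : 0 < cr i x -> covers (r i x) x.
Proof.
move=> x0 [|[|n]] // /steps_snoc [y ry yx]; exfalso.
have [iy [beta [b [pb cb yE bx]]]] := yx.
have bi : beta = al i.
  apply: pos_root_simple => // j ji.
  have h1 := Qplus_coord j (steps_Qplus ry).
  have [Q _] := step_Qplus yx; have h2 := Qplus_coord j Q.
  move: h1 h2; rewrite rcoordB rcoord_srefl 1?eq_sym // rcoordB => h1 h2.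
  have : rcoord j y = rcoord j x by lra.
  rewrite yE rcoordB rcoordZ => e.
  have /eqP : pairing b x * rcoord j beta = 0 by lra.
  by rewrite mulf_eq0 gt_eqF //= => /eqP.
have yr : y = r i x.
  by rewrite bi in cb yE; rewrite yE /refl (@coroot_of_simple _ _ hA _ _ _ _ cb iy).
by have := steps_ht ry isT; rewrite yr ltxx.
Qed.

(** * a-chains *)

Variable lam : hd.
Hypothesis hlam : dominant lam.
Local Notation Tl := (Torbit lam).

(** An arrow of an a-chain, for a > 0, together with its integrality condition and
    with the root hidden.  For a real root the positivity of beta^vee (nu) makes the
    integer a beta^vee (nu) positive. *)
Definition arrowA a mu nu := [/\ Tl nu, covers mu nu &
  exists beta b, [/\ pos_root beta, coroot_of beta b, mu = refl beta b nu & 0 < pairing b nu] /\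
    a * pairing b nu \is a Num.int /\ (imag_root beta -> a * pairing b nu = 1)].

(** Empty chains are included, so that a path may have equal successive directions. *)
Inductive chainA a : hd -> hd -> Prop :=
| chainA_refl mu : chainA a mu mu
| chainA_step mu kap nu : arrowA a mu kap -> chainA a kap nu -> chainA a mu nu.

Lemma chainA_trans a x y z : chainA a x y -> chainA a y z -> chainA a x z.
Proof.
by elim=> // {}x k {}y xk _ IH /IH; exact: chainA_step.
Qed.

Lemma chainA1 a x y : arrowA a x y -> chainA a x y.
Proof. by move=> h; apply: chainA_step h (chainA_refl _ _). Qed.

Lemma arrowA_step a mu nu : arrowA a mu nu -> step mu nu.
Proof.
move=> [Tn _ [beta [b [h _]]]]; split; first exact: Torbit_integral Tn.
by exists beta, b.
Qed.

Lemma arrowA_Torbit a mu nu : arrowA a mu nu -> Tl mu.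
Proof. by move=> [Tn _ [beta [b [[_ cb -> _] _]]]]; exact: Torbit_refl. Qed.

Lemma chainA_Torbit a mu nu : chainA a mu nu -> Tl nu -> Tl mu.
Proof. by case=> // {}mu k {}nu /arrowA_Torbit. Qed.

Lemma chainA_steps a mu nu : chainA a mu nu -> exists n, steps n mu nu.
Proof.
elim=> [{}mu|{}mu k {}nu /arrowA_step mk _ [n kn]]; first by exists 0%N.
by exists n.+1, k.
Qed.

(** An arrow subtracts from a nu an integral multiple of a root, and the simple coroots
    are integral on roots. *)
Lemma chainA_int a i mu nu : chainA a mu nu -> a * (cr i mu - cr i nu) \is a Num.int.
Proof.
elim=> [{}mu|{}mu k {}nu [Tk _ [beta [b [[_ cb -> _] [ab _]]]]] _ IH].
  by rewrite subrr mulr0.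
have -> : a * (cr i (refl beta b k) - cr i nu) =
    a * (cr i k - cr i nu) - a * pairing b k * cr i beta.
  by rewrite pairingBr pairingZr; lra.
apply: intB => //; apply: intM => //.
exact: coroot_of_integral cb i.
Qed.

Lemma chainA_cr_imag a i mu nu : ~~ real i -> chainA a mu nu -> cr i nu <= cr i mu.
Proof. by move=> ii /chainA_steps [n]; exact: steps_cr_imag. Qed.

Lemma arrow_arrowA a beta b mu nu : 0 < a -> arrow lam beta b mu nu ->
    (real_pos_root beta -> a * pairing b nu \is a Num.nat /\ 0 < a * pairing b nu) ->
    (imag_root beta -> a * pairing b nu = 1) ->
  arrowA a mu nu.
Proof.
move=> a0 [pb cb mE [Tm Tn _] [oc dist]] hr hi.
have inu : integral nu := Torbit_integral hlam Tn.
split=> //; first by move=> n /steps_order_chain; exact: dist.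
have ab : a * pairing b nu \is a Num.int /\ 0 < a * pairing b nu.
  case: (pb) => [/hr [h1 h2]|/hi ->]; last by [].
  by split=> //; move: h1; rewrite natrEint => /andP[].
exists beta, b; split; last by case: ab.
by split=> //; case: ab => _; rewrite pmulr_rgt0.
Qed.

Lemma arrowA_arrow a mu nu : 0 < a -> arrowA a mu nu -> exists beta b,
  [/\ arrow lam beta b mu nu,
   real_pos_root beta -> a * pairing b nu \is a Num.nat /\ 0 < a * pairing b nu &
   imag_root beta -> a * pairing b nu = 1].
Proof.
move=> a0 h; have Tm := arrowA_Torbit h; have st := steps1 (arrowA_step h).
case: h => Tn cov [beta [b [[pb cb mE bn] [ab imb]]]]; exists beta, b.
have inu : integral nu := Torbit_integral hlam Tn.
have oc := steps_order_chain st.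
split=> //; first split=> //.
- by split=> //; exists 1%N.
- by split=> // n /(order_chain_steps inu); exact: cov.
- by move=> _; rewrite natrEint ab mulr_gt0 // ltW // mulr_gt0.
Qed.

Lemma has_chain_chainA a mu nu : 0 < a -> has_chain lam a mu nu -> chainA a mu nu.
Proof.
move=> a0 [_ [s [n [beta [b]]]]]; elim: s mu n beta b => [|s IH] mu n beta b [n0 ns h].
  by rewrite -n0 -ns; exact: chainA_refl.
apply: (@chainA_step _ _ (n 1%N)).
  by have [h1 h2 h3] := h 1%N isT; rewrite -n0; exact: arrow_arrowA h1 h2 h3.
apply: (IH _ (fun i : nat => n i.+1) (fun i : nat => beta i.+1) (fun i : nat => b i.+1)); split=> // i.
move=> /andP[i0 is1]; have := h i.+1.
by rewrite /= ltnS is1 => /(_ isT); case: (i) i0.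
Qed.

Lemma chainA_has_chain a mu nu : 0 < a -> chainA a mu nu -> Tl nu -> mu <> nu ->
  has_chain lam a mu nu.
Proof.
move=> a0 ch Tn mn; split.
  split=> //; first exact: chainA_Torbit ch Tn.
  have [[|n] st] := chainA_steps ch; first by case: mn.
  by exists n.+1 => //; exact: steps_order_chain.
elim: ch {Tn mn} => [{}mu|{}mu k {}nu /(arrowA_arrow a0) [be [bb hk]] _ [s [n [beta [b [n0 ns h]]]]]].
  by exists 0%N, (fun=> mu), (fun=> 0), (fun=> 0); split=> // -[|i].
exists s.+1, (fun i : nat => if i is i'.+1 then n i' else mu),
  (fun i : nat => if i is i'.+2 then beta i'.+1 else be),
  (fun i : nat => if i is i'.+2 then b i'.+1 else bb).
split=> // -[|[|i]] // hi; first by rewrite /= n0.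
by have := h i.+1 hi.
Qed.

(** If the arrow is not given by alpha_i, the reflected pair is again one step apart.  A longer sequence between the reflected weights could be
    reflected back under the sign condition of the last clause, contradicting the
    distance 1.  Likewise, if r_i moved the two ends of the arrow in opposite
    directions, the detour over the reflected pair would be longer than the arrow. *)
Lemma arrowA_real a i mu nu : real i -> arrowA a mu nu ->
  [/\ mu = r i nu, 0 < cr i nu & a * cr i nu \is a Num.int] \/
  [/\ cr i mu < 0 -> cr i nu < 0, 0 < cr i nu -> 0 < cr i mu &
      cr i mu < 0 \/ 0 < cr i nu -> arrowA a (r i mu) (r i nu)].
Proof.
move=> ri h; have st := arrowA_step h; have im := step_integral st.
case: (h) => Tn cov [beta [b [[pb cb mE bn] [ab imb]]]].
have inu : integral nu := Torbit_integral hlam Tn.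
have [bi|/eqP bi] := eqVneq beta (al i).
  left; rewrite bi in cb mE; have E : pairing b nu = cr i nu by exact: coroot_of_simple cb inu.
  by split; [rewrite mE /refl E | rewrite -E | rewrite -E].
right; have pb' : pos_root (r i beta) by exact: pos_root_srefl ri pb bi.
have bn' : 0 < pairing (srefl_co i b) (r i nu) by rewrite pairing_srefl_co sreflK.
have st' : step (r i mu) (r i nu).
  split; first exact: srefl_integral.
  exists (r i beta), (srefl_co i b); split=> //; first exact: coroot_of_srefl.
  by rewrite refl_srefl // mE.
have up x : integral x -> cr i x <= 0 -> exists n, steps n x (r i x).
  move=> ix; rewrite le_eqVlt => /orP[/eqP/srefl_fix ->|x0]; first by exists 0%N.
  by exists 1%N; exact/steps1/step_up.
have down x : integral x -> 0 <= cr i x -> exists n, steps n (r i x) x.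
  move=> ix; rewrite le_eqVlt => /orP[/eqP/esym/srefl_fix ->|x0]; first by exists 0%N.
  by exists 1%N; exact/steps1/step_simple.
have h1 : cr i mu < 0 -> cr i nu < 0.
  move=> m0; rewrite ltNge; apply/negP => n0; have [n sn] := down nu inu n0.
  have s1 := steps1 (step_up ri im m0).
  by have := cov _ (steps_cat s1 (steps_cat (steps1 st') sn)).
have h2 : 0 < cr i nu -> 0 < cr i mu.
  move=> n0; rewrite ltNge; apply/negP => m0; have [n sn] := up mu im m0.
  have s1 := steps1 (step_simple inu n0).
  by have := cov _ (steps_cat sn (steps_cat (steps1 st') s1)); rewrite addnS addnC.
split=> // hs; split; first exact: Torbit_srefl.
  move=> n sn; apply: cov; rewrite -(sreflK mu ri) -(sreflK nu ri).
  case: hs => [m0|n0].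
    by apply: steps_srefl_pos => //; [exact: srefl_integral | rewrite cr_srefl_real // oppr_gt0].
  by apply: steps_srefl_neg => //; [exact: srefl_integral | rewrite cr_srefl_real // oppr_lt0].
exists (r i beta), (srefl_co i b); rewrite pairing_srefl_co sreflK //; split.
  split=> //; first exact: coroot_of_srefl.
  by rewrite refl_srefl // mE.
split=> // -[w [l [rw il E]]]; apply: imb; exists (i :: w), l; split=> //=.
  by rewrite ri.
by rewrite act_cons -E sreflK.
Qed.

(** The arrows are reflected one by one starting from the end of the chain, until one
    of them is given by alpha_i; this one is dropped. *)
Lemma chainA_end_pos a i mu nu : real i -> chainA a mu nu -> 0 < cr i nu ->
  (0 < cr i mu /\ chainA a (r i mu) (r i nu)) \/
  (a * cr i nu \is a Num.int /\ chainA a mu (r i nu)).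
Proof.
move=> ri; elim=> [{}mu|{}mu k {}nu mk kn IH] n0.
  by left; split=> //; exact: chainA_refl.
have [[k0 ch]|[ai ch]] := IH n0; last by right; split=> //; exact: chainA_step ch.
have [[-> _ ak]|[h1 h2 h3]] := arrowA_real ri mk.
  right; split=> //; have -> : a * cr i nu = a * cr i k - a * (cr i k - cr i nu) by lra.
  by apply: intB => //; exact: chainA_int kn.
by left; split; [exact: h2 | apply: chainA_step ch; apply: h3; right].
Qed.

(** The counterpart of [chainA_end_pos], from the start of the chain. *)
Lemma chainA_start_neg a i mu nu : real i -> chainA a mu nu -> cr i mu < 0 ->
  (cr i nu < 0 /\ chainA a (r i mu) (r i nu)) \/
  (a * cr i mu \is a Num.int /\ chainA a (r i mu) nu).
Proof.
move=> ri; elim=> [{}mu|{}mu k {}nu mk kn IH] m0.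
  by left; split=> //; exact: chainA_refl.
have [[-> _ ak]|[h1 h2 h3]] := arrowA_real ri mk.
  by right; rewrite cr_srefl_real // mulrN sreflK //; split=> //; exact: intN.
have ar := h3 (or_introl m0).
have [[n0 ch]|[ak ch]] := IH (h1 m0); first by left; split=> //; exact: chainA_step ch.
right; split; last exact: chainA_step ch.
have -> : a * cr i mu = a * cr i k + a * (cr i mu - cr i k) by lra.
by apply: intD => //; exact: chainA_int (chainA1 mk).
Qed.

(** On weights with a common pairing c with the coroot of alpha_i, the map r_i is the
    translation by - c alpha_i. *)
Lemma chainA_imag a i mu nu : ~~ real i -> chainA a mu nu -> cr i mu = cr i nu ->
  chainA a (r i mu) (r i nu).
Proof.
move=> ii; elim=> [{}mu|{}mu k {}nu mk kn IH] mn; first exact: chainA_refl.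
have h1 := step_cr_imag ii (arrowA_step mk); have h2 := chainA_cr_imag ii kn.
have ek : cr i k = cr i nu by apply/le_anti/andP; split=> //; rewrite -mn.
apply: chainA_step (IH ek); have im := step_integral (arrowA_step mk).
have mk' : cr i mu = cr i k by rewrite mn.
case: mk => Tk cov [beta [b [[pb cb mE bn] [ab imb]]]].
have [|b0 E] := imag_shift (- cr i k) ii pb cb bn; first by rewrite -mE.
have rk : r i k = k + (- cr i k) *: al i by rewrite scaleNr.
have rm : r i mu = mu + (- cr i k) *: al i by rewrite scaleNr -mk'.
split; first exact: Torbit_srefl.
  move=> n; rewrite rm rk => sn; apply: cov.
  have := @steps_shift i n _ _ (cr i k) ii _ sn.
  rewrite !scaleNr !subrK; apply.
    exact: Torbit_integral hlam _ Tk i.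
  by rewrite !pairingBr mk'.
exists beta, b; rewrite rk; have -> : pairing b (k + - cr i k *: al i) = pairing b k.
  by rewrite pairingDr pairingZr b0 mulr0 addr0.
by split=> //; split=> //; rewrite rm E mE.
Qed.

Lemma arrowA_simple a i mu : Tl mu -> 0 < cr i mu ->
    (real i -> a * cr i mu \is a Num.int) -> (~~ real i -> a * cr i mu = 1) ->
  arrowA a (r i mu) mu.
Proof.
move=> Tm m0 hr hi; split=> //; first exact: covers_simple.
exists (al i), (coroot D i); split.
  by split=> //; [exact: pos_root_root | exact: coroot_of_root].
have [ri|ii] := boolP (real i); last by rewrite hi.
split; first exact: hr.
move=> im; exfalso; apply: (@real_imag_disjoint _ _ hA _ (al i)) => //.
by split; [exists [::], i | exact: Qplus_root].
Qed.

(** Let mu = r_beta nu be the arrow.  A real beta is excluded because mu is maximal in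
    its W-orbit and nu lies above it.  An imaginary beta is simple unless some real
    alpha_j has positive pairing with it.  In that case the arrow can be compared with
    its image under r_j: as the distance is 1, alpha_j^vee is positive at mu as well,
    and then the coroot of r_j beta would be negative at nu.  That coroot comes from
    an imaginary simple one, and those are nonnegative on the whole orbit. *)
Lemma arrowA_dominant a mu nu : arrowA a mu nu -> (forall j, real j -> 0 <= cr j mu) ->
  exists i, [/\ ~~ real i, mu = r i nu & a * cr i nu = 1].
Proof.
move=> ar mdom; have im := step_integral (arrowA_step ar).
case: (ar) => Tn cov [beta [b [[pb cb mE bn] [ab imb]]]].
have inu := Torbit_integral hlam Tn.
case: (pb) => [[[w [l [rw rl E]]] Qb]|imr].
  exfalso; have cb' : coroot_of beta (act_co w (coroot D l)) by exists w, l.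
  have bE : pairing b nu = pairing (act_co w (coroot D l)) nu.
    exact: coroot_of_uniq cb cb' inu.
  rewrite /refl bE in mE; rewrite bE in bn.
  set u := w ++ l :: rev w; have ru : all real u by rewrite all_cat /= all_rev rw rl.
  have mu' : mu = act u nu by rewrite mE E -(refl_act l nu rw).
  have nE : nu = act (rev u) mu by rewrite mu' act_revK.
  have := @act_le _ _ hA _ real mu (fun j _ => im j) mdom (rev u).
  rewrite all_rev ru -nE => /(_ isT)/Qplus_ht; rewrite mE addrAC subrr add0r htN htZ.
  have h : 0 < ht beta by exact: pos_root_neq0.
  rewrite oppr_ge0 pmulr_rle0 //.
  by rewrite leNgt h.
case: (imr) => w [i [rw ii E]]; exists i.
have cb' : coroot_of beta (act_co w (coroot D i)) by exists w, i.
have E' : pairing b nu = pairing (act_co w (coroot D i)) nu.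
  exact: coroot_of_uniq cb cb' inu.
have bi : beta = al i; last first.
  rewrite bi in cb; have cn : pairing b nu = cr i nu by exact: coroot_of_simple cb inu.
  by rewrite -cn imb //; split=> //; rewrite mE bi /refl cn.
rewrite E; apply: imag_antidominant => // j rj; rewrite leNgt; apply/negP => n0.
have n1 : 1 <= cr j beta.
  by rewrite E; apply: nat_gt0_ge1 => //; apply: act_integral; exact: root_integral.
have k1 : 1 <= cr i (act (rev w) (al j)).
  apply: nat_gt0_ge1; last exact: imag_real_sign.
  by apply: act_integral; exact: root_integral.
have mj : cr j mu = cr j nu - pairing b nu * cr j beta by rewrite mE pairingBr pairingZr.
have := mdom j rj; rewrite mj => h.
have nj : 0 < cr j nu by have : 0 < pairing b nu * cr j beta; [apply: mulr_gt0; lra | lra].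
case: (arrowA_real rj ar) => [[mr _ _]|[_ /(_ nj) m0 _]].
  by have := mdom j rj; rewrite mr cr_srefl_real //; lra.
have := @Torbit_imag_root _ _ hA _ _ hlam (j :: w) i nu ii Tn.
rewrite [act_co _ _]/(srefl_co j (act_co w (coroot D i))) pairing_srefl_co.
rewrite sreflE pairingBr pairingZr -E' pairing_act_co.
move: m0 h n1 k1 nj bn; rewrite mj; clear.
move: (pairing b nu) (cr j nu) (cr j beta) (cr i _) => c q n k h1 _ n1 k1 q0 c0.
have : 0 <= q * (k - 1) by rewrite mulr_ge0 //; lra.
have : 0 <= c * (n - 1) by rewrite mulr_ge0 //; lra.
by lra.
Qed.

End OrderAndChains.

Section BrokenLines.
Variables (I : countType) (A : I -> I -> int).
Context {hA : borcherds_cartan A}.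
Variable D : realization A.

Local Notation hd := (dual (cartan D)).
Local Notation al := (@Defs.root I A D).
Local Notation cr i x := (pairing (coroot D i) x).
Local Notation real := (is_real A).
Implicit Types (x y z mu nu beta : hd) (i j : I) (w : seq I) (K : pred I).

Local Notation path := (gpath D).
Implicit Types (p q : path) (l : nat -> hd) (a : nat -> rat) (s k u v m n : nat) (t : rat).

(** * Broken lines *)

Definition grid s a := [/\ a 0%N = 0, a s = 1 & forall k, (k < s)%N -> a k < a k.+1].

(** The directions are numbered from 1: l k.+1 is the direction between a k and
    a k.+1. *)
Definition follows s l a p := p 0 = 0 /\
  forall k t, (k < s)%N -> a k <= t <= a k.+1 -> p t = p (a k) + (t - a k) *: l k.+1.

(** Paths are functions on all rationals but only their values on [0, 1] matter. *)
Definition same_on p q := forall t, 0 <= t <= 1 -> p t = q t.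

Section Grid.
Variables (s : nat) (a : nat -> rat).
Hypothesis ga : grid s a.

Lemma grid_lt k m : (k < m)%N -> (m <= s)%N -> a k < a m.
Proof.
case: ga => _ _ inc; elim: m => // m IH; rewrite ltnS leq_eqVlt.
case/orP=> [/eqP -> /inc //|km ms].
by apply: lt_trans (inc m ms); apply: IH => //; exact: ltnW.
Qed.

Lemma grid_le k m : (k <= m)%N -> (m <= s)%N -> a k <= a m.
Proof. by rewrite leq_eqVlt => /orP[/eqP -> //|km ms]; apply/ltW/grid_lt. Qed.

Lemma grid_01 k : (k <= s)%N -> 0 <= a k <= 1.
Proof. by case: (ga) => a0 a1 _ ks; rewrite -{1}a0 -a1 !grid_le. Qed.

Lemma grid_gt0 k : (0 < k <= s)%N -> 0 < a k.
Proof. by case: (ga) => a0 _ _ /andP[k0 ks]; rewrite -a0 grid_lt. Qed.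

Lemma grid_pos : (0 < s)%N.
Proof. by case: (ga) => a0 a1 _; case: (s) a1 => // a1; move: a0; rewrite a1 => /eqP; rewrite oner_eq0. Qed.

Lemma grid_find_left t : 0 < t <= 1 -> exists2 k, (k < s)%N & a k < t <= a k.+1.
Proof.
case: (ga) => a0 <- _ /andP[]; rewrite -{1}a0; elim: (s) => [t0 /(lt_le_trans t0)|n IH t0 tn].
  by rewrite ltxx.
have [tl|nt] := leP t (a n); last by exists n => //; rewrite nt.
by have [k kn h] := IH t0 tl; exists k => //; exact: ltnW.
Qed.

Lemma grid_find t : 0 <= t <= 1 -> exists2 k, (k < s)%N & a k <= t <= a k.+1.
Proof.
move=> /andP[t0 t1]; move: t0; rewrite le_eqVlt => /orP[/eqP <-|t0].
  case: (ga) => a0 _ inc; exists 0%N; first exact: grid_pos.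
  by rewrite a0 lexx -a0 ltW //; apply: inc; exact: grid_pos.
have [|k ks /andP[h1 h2]] := @grid_find_left t; first by rewrite t0.
by exists k => //; rewrite (ltW h1).
Qed.

End Grid.

Section Follow.
Variables (s : nat) (l : nat -> hd) (a : nat -> rat) (p : path).
Hypotheses (ga : grid s a) (fp : follows s l a p).

Lemma follows_next k : (k < s)%N -> p (a k.+1) = p (a k) + (a k.+1 - a k) *: l k.+1.
Proof.
by case: (ga) => _ _ inc ks; case: fp => _; apply => //; rewrite lexx andbT ltW // inc.
Qed.

Lemma cr_next i k : (k < s)%N ->
  cr i (p (a k.+1)) = cr i (p (a k)) + (a k.+1 - a k) * cr i (l k.+1).
Proof. by move=> ks; rewrite follows_next // pairingDr pairingZr. Qed.

Lemma cr_piece i k t : (k < s)%N -> a k <= t <= a k.+1 ->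
  cr i (p t) = cr i (p (a k)) + (t - a k) * cr i (l k.+1).
Proof. by case: fp => _ h ks tk; rewrite (h k) // pairingDr pairingZr. Qed.

Lemma follows_at0 : p (a 0%N) = 0.
Proof. by case: (ga) => -> _ _; case: fp. Qed.

(** The bounds on the height inside a piece, here and below, come from its values at
    the ends of the piece, since it is affine in between. *)
Lemma piece_ge i k t (c : rat) : (k < s)%N -> a k <= t <= a k.+1 ->
  c <= cr i (p (a k)) -> c <= cr i (p (a k.+1)) -> c <= cr i (p t).
Proof.
move=> ks tk; rewrite (cr_piece _ ks tk) cr_next //.
case/andP: tk; case: (ga) => _ _ /(_ k ks).
move: (cr i (l k.+1)) (cr i (p (a k))) (a k) (a k.+1) => d g x y xy xt ty h1 h2.
have [d0|d0] := leP 0 d.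
  by have : 0 <= (t - x) * d; [apply: mulr_ge0; lra | lra].
by have : (t - x) * d >= (y - x) * d; [rewrite ler_nM2r //; lra | lra].
Qed.

Lemma piece_gt i k t (c : rat) : (k < s)%N -> a k < t <= a k.+1 ->
  c <= cr i (p (a k)) -> c < cr i (p (a k.+1)) -> c < cr i (p t).
Proof.
move=> ks /andP[kt tk]; have tk' : a k <= t <= a k.+1 by rewrite tk ltW.
rewrite (cr_piece _ ks tk') cr_next //.
move: (cr i (l k.+1)) (cr i (p (a k))) (a k) (a k.+1) kt tk {tk'} => d g x y xt ty h1 h2.
have [d0|d0] := ltP 0 d.
  by have : 0 < (t - x) * d; [apply: mulr_gt0; lra | lra].
have : (t - x) * d >= (y - x) * d; last by lra.
by rewrite ler_wnM2r //; lra.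
Qed.

Lemma piece_lt_left i k t (c : rat) : (k < s)%N -> a k < t <= a k.+1 ->
  cr i (p (a k)) <= c -> cr i (p (a k.+1)) < c -> cr i (p t) < c.
Proof.
move=> ks /andP[kt tk]; have tk' : a k <= t <= a k.+1 by rewrite tk ltW.
rewrite (cr_piece _ ks tk') cr_next //.
move: (cr i (l k.+1)) (cr i (p (a k))) (a k) (a k.+1) kt tk {tk'} => d g x y xt ty h1 h2.
have [d0|d0] := ltP d 0.
  by have : 0 < (t - x) * (- d); [apply: mulr_gt0; lra | lra].
have : (t - x) * d <= (y - x) * d; last by lra.
by rewrite ler_wpM2r //; lra.
Qed.

Lemma piece_lt_right i k t (c : rat) : (k < s)%N -> a k <= t < a k.+1 ->
  cr i (p (a k)) < c -> cr i (p (a k.+1)) <= c -> cr i (p t) < c.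
Proof.
move=> ks /andP[kt tk]; have tk' : a k <= t <= a k.+1 by rewrite kt ltW.
rewrite (cr_piece _ ks tk') cr_next //.
move: (cr i (l k.+1)) (cr i (p (a k))) (a k) (a k.+1) kt tk {tk'} => d g x y xt ty h1 h2.
have [d0|d0] := leP d 0.
  by have : 0 <= (t - x) * (- d); [apply: mulr_ge0; lra | lra].
have : (t - x) * d < (y - x) * d; last by lra.
by rewrite ltr_pM2r //; lra.
Qed.

Lemma piece_gt_right i k t (c : rat) : (k < s)%N -> a k <= t < a k.+1 ->
  c < cr i (p (a k)) -> c <= cr i (p (a k.+1)) -> c < cr i (p t).
Proof.
move=> ks /andP[kt tk]; have tk' : a k <= t <= a k.+1 by rewrite kt ltW.
rewrite (cr_piece _ ks tk') cr_next //.
move: (cr i (l k.+1)) (cr i (p (a k))) (a k) (a k.+1) kt tk {tk'} => d g x y xt ty h1 h2.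
have [d0|d0] := leP 0 d.
  by have : 0 <= (t - x) * d; [apply: mulr_ge0; lra | lra].
have : (t - x) * d > (y - x) * d; last by lra.
by rewrite ltr_nM2r //; lra.
Qed.

Lemma follows_ext q : same_on p q -> follows s l a q.
Proof.
have [p0 fk] := fp; have [a0 a1 inc] := ga.
move=> pq; split; first by rewrite -pq ?lexx ?ler01.
move=> k t ks /andP[kt tk].
have /andP[h1 h2] := grid_01 ga (ltnW ks); have /andP[h3 h4] := grid_01 ga ks.
rewrite -!pq; first by apply: fk => //; rewrite kt.
  by rewrite h1.
by rewrite (le_trans h1 kt) (le_trans tk h4).
Qed.

Lemma follows_uniq q : follows s l a q -> same_on p q.
Proof.
move=> [q0 fq] t /(grid_find ga) [k ks tk]; have [p0 fk] := fp.
rewrite (fk _ _ ks tk) (fq _ _ ks tk); congr (_ + _).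
elim: (k) (ltnW ks) => [|n IH] ns; first by case: (ga) => -> _ _; rewrite p0 q0.
have h : a n <= a n.+1 <= a n.+1 by rewrite lexx andbT (grid_le ga).
by rewrite (fk _ _ ns h) (fq _ _ ns h) IH // ltnW.
Qed.

Lemma follows_sum k : (k <= s)%N ->
  p (a k) = \sum_(1 <= j < k.+1) (a j - a j.-1) *: l j.
Proof.
elim: k => [|k IH] ks; first by rewrite big_geq // follows_at0.
by rewrite big_nat_recr //= -IH ?follows_next // ltnW.
Qed.

End Follow.

Lemma follows_change s l l' a p : (forall k, (0 < k <= s)%N -> l k = l' k) ->
  follows s l a p -> follows s l' a p.
Proof. by move=> ll [p0 h]; split=> // k t ks; rewrite -ll ?ks //; exact: h. Qed.

(** ** Bent paths

    The path is modified between the breakpoints u and v by x - c alpha_i^vee(x)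
    alpha_i and translated after v.  For f_i, and for e_i with i real, c = 1; for e_i
    with i imaginary, c = - 1 / (1 - a_ii), which inverts r_i. *)
Section Bend.
Variables (s : nat) (l : nat -> hd) (a : nat -> rat) (p : path).
Hypotheses (ga : grid s a) (fp : follows s l a p).
Variables (u v : nat) (i : I) (c : rat).
Hypotheses (uv : (u < v)%N) (vs : (v <= s)%N).

Definition bend_dir (x : hd) : hd := x - (c * cr i x) *: al i.
Definition bend_dirs k : hd := if (u < k <= v)%N then bend_dir (l k) else l k.
Let g k := cr i (p (a k)).
Let kap := c * (g v - g u).

Definition bend t : hd :=
  if t <= a u then p t
  else if t <= a v then p (a u) + bend_dir (p t - p (a u))
  else p t - kap *: al i.

Lemma bend_dirD x y : bend_dir (x + y) = bend_dir x + bend_dir y.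
Proof. by rewrite /bend_dir pairingDr mulrDr scalerDl opprD addrACA. Qed.
Lemma bend_dirZ (b : rat) x : bend_dir (b *: x) = b *: bend_dir x.
Proof. by rewrite /bend_dir pairingZr scalerBr scalerA mulrCA. Qed.

Lemma bend_first t : t <= a u -> bend t = p t.
Proof. by rewrite /bend => ->. Qed.

Lemma bend_mid t : a u <= t <= a v -> bend t = p (a u) + bend_dir (p t - p (a u)).
Proof.
move=> /andP[ut tv]; rewrite /bend tv; case: ifP => // tu.
have -> : t = a u by apply/le_anti; rewrite tu.
by rewrite subrr /bend_dir pairing0r mulr0 scale0r subr0 addr0.
Qed.

Lemma bend_last t : a v <= t -> bend t = p t - kap *: al i.
Proof.
move=> vt; have uv' : a u < a v by rewrite (grid_lt ga).
rewrite /bend leNgt (lt_le_trans uv' vt) /=; case: ifP => // tv.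
have -> : t = a v by apply/le_anti; rewrite tv.
by rewrite /bend_dir pairingBr addrA addrCA subrr addr0.
Qed.

Lemma bend_follows : follows s bend_dirs a bend.
Proof.
have [p0 fk] := fp; have us : (u <= s)%N by apply: leq_trans vs; exact: ltnW.
split.
  by rewrite bend_first //; case/andP: (grid_01 ga us).
move=> k t ks tk; have /andP[kt tk1] := tk; rewrite /bend_dirs.
have [ku|uk] := ltnP k u.
  have k1u : a k.+1 <= a u by apply: (grid_le ga).
  rewrite ltnNge ku /= !bend_first ?(le_trans tk1) //; first exact: fk.
  by apply: (grid_le ga) => //; exact: ltnW.
have uk' : a u <= a k by apply: (grid_le ga) => //; exact: ltnW.
rewrite ltnS uk /=; case: ltnP => kv.
  have k1v : a k.+1 <= a v by apply: (grid_le ga).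
  have kv' : a k <= a v by apply: (grid_le ga) => //; exact: ltnW.
  rewrite !bend_mid ?uk' ?(le_trans uk') ?(le_trans tk1) //.
  by rewrite -addrA -bend_dirZ -bend_dirD (fk _ _ ks tk) addrAC.
have vk : a v <= a k by apply: (grid_le ga) => //; exact: ltnW.
by rewrite !bend_last ?(le_trans vk) // (fk _ _ ks tk) addrAC.
Qed.

Lemma cr_bend_dir x : cr i (bend_dir x) = (1 - c * (A i i)%:~R) * cr i x.
Proof. by rewrite pairingBr pairingZr cr_root; lra. Qed.

Lemma cr_bend_first k : (k <= u)%N -> cr i (bend (a k)) = g k.
Proof.
move=> ku; rewrite bend_first //; apply: (grid_le ga) => //.
by apply: leq_trans vs; exact: ltnW.
Qed.

Lemma cr_bend_mid k : (u <= k <= v)%N ->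
  cr i (bend (a k)) = g u + (1 - c * (A i i)%:~R) * (g k - g u).
Proof.
move=> /andP[uk kv]; rewrite bend_mid.
  by rewrite pairingDr cr_bend_dir pairingBr.
by rewrite !(grid_le ga) // (leq_trans kv).
Qed.

Lemma cr_bend_last k : (v <= k <= s)%N -> cr i (bend (a k)) = g k - kap * (A i i)%:~R.
Proof.
move=> /andP[vk ks]; rewrite bend_last; last exact: (grid_le ga).
by rewrite pairingBr pairingZr cr_root.
Qed.

Lemma bend_end : bend 1 = p 1 - kap *: al i.
Proof. by case: (ga) => _ <- _; rewrite bend_last //; exact: (grid_le ga). Qed.

End Bend.

(** * Evaluating the root operators *)

Lemma greatestE (S : set rat) t : S t -> (forall t', S t' -> t' <= t) -> greatest S = t.
Proof.
move=> St h; apply: xget_unique => // t' [St' ht'].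
by apply/le_anti; rewrite h // ht'.
Qed.

Lemma leastE (S : set rat) t : S t -> (forall t', S t' -> t <= t') -> least S = t.
Proof.
move=> St h; apply: xget_unique => // t' [St' ht'].
by apply/le_anti; rewrite h // ht'.
Qed.

Section Evaluate.
Variables (s : nat) (l : nat -> hd) (a : nat -> rat) (p : path).
Hypotheses (ga : grid s a) (fp : follows s l a p).
Variables (i : I) (m : int).
Local Notation g k := (cr i (p (a k))).
Hypothesis gm : forall k, (k <= s)%N -> m%:~R <= g k.

Lemma height_ge t : 0 <= t <= 1 -> m%:~R <= cr i (p t).
Proof.
by move=> /(grid_find ga) [k ks tk]; apply: (piece_ge ga fp ks tk); rewrite gm // ltnW.
Qed.

Section Attained.
Variable u : nat.
Hypotheses (us : (u <= s)%N) (gu : g u = m%:~R).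

Lemma min_heightE : min_height i p = m.
Proof.
have a01 := grid_01 ga us; apply: xget_unique => [|n [[t t01 ht] hn]].
  by split=> [|n t t01 ht]; [exists (a u) | have := height_ge t01; rewrite -/(height i p t) ht ler_int].
apply/le_anti; rewrite (hn m (a u)) //=.
by have := height_ge t01; rewrite -/(height i p t) ht ler_int.
Qed.

Lemma f_plusE : (forall k, (u < k <= s)%N -> m%:~R < g k) -> f_plus i p = a u.
Proof.
move=> gt; rewrite /f_plus min_heightE; apply: greatestE; first by split; [exact: (grid_01 ga us) | exact: gu].
move=> t [/andP[t0 t1] ht]; rewrite leNgt; apply/negP => ut.
have au := grid_01 ga us.
have [|k ks tk] := grid_find_left ga (t := t).
  by rewrite t1 andbT; case/andP: au => h _; exact: le_lt_trans h ut.
have uk : (u <= k)%N.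
  rewrite leqNgt; apply/negP => ku; case/andP: tk => _ tk.
  by have := le_trans tk (grid_le ga ku us); rewrite leNgt ut.
have := piece_gt ga fp ks tk (gm (ltnW ks)) (gt k.+1 _).
by rewrite ltnS uk ks => /(_ isT); rewrite -/(height i p t) ht ltxx.
Qed.

Lemma f_op_none : (forall k, (u < k <= s)%N -> m%:~R < g k) -> u = s -> f_op i p = None.
Proof.
by move=> gt e; rewrite /f_op f_plusE // e; case: (ga) => _ -> _; rewrite eqxx.
Qed.

Lemma f_op_bend v : (forall k, (u < k <= s)%N -> m%:~R < g k) ->
    (u < v <= s)%N -> g v = m%:~R + 1 ->
    (forall k, (u < k < v)%N -> g k < m%:~R + 1) ->
  exists2 p', f_op i p = Some p' & p' =1 bend a p u v i 1.
Proof.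
move=> gt /andP[uv vs] gv mid.
have uv' : a u < a v by exact: (grid_lt ga).
have au1 : (a u == 1) = false.
  by apply/negbTE/eqP => e; have /andP[_] := grid_01 ga vs; rewrite leNgt -{1}e uv'.
have fm : least [set t | a u <= t <= 1 /\ height i p t = m%:~R + 1] = a v.
  apply: leastE; first by split; [rewrite (ltW uv'); case/andP: (grid_01 ga vs) | exact: gv].
  move=> t [/andP[ut t1] ht]; rewrite leNgt; apply/negP => tv.
  have t01 : 0 <= t <= 1.
    by rewrite t1 andbT; case/andP: (grid_01 ga us) => h _; exact: le_trans h ut.
  have [k ks /andP[kt tk]] := grid_find ga t01.
  have kv : (k < v)%N.
    rewrite ltnNge; apply/negP => vk.
    by have := le_lt_trans (le_trans (grid_le ga vk (ltnW ks)) kt) tv; rewrite ltxx.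
  have lt1 : cr i (p t) < m%:~R + 1; last by move: lt1; rewrite -/(height i p t) ht ltxx.
  have small n : (u <= n < v)%N -> g n < m%:~R + 1.
    move=> /andP[]; rewrite leq_eqVlt => /orP[/eqP <- _|un nv].
      by rewrite gu; lra.
    by apply: mid; rewrite un.
  have small' n : (u <= n <= v)%N -> g n <= m%:~R + 1.
    move=> /andP[un]; rewrite leq_eqVlt => /orP[/eqP ->|nv]; first by rewrite gv.
    by apply/ltW/small; rewrite un.
  have [ku|uk] := ltnP k u.
    have -> : t = a u by apply/le_anti; rewrite ut (le_trans tk) // (grid_le ga).
    by apply: small; rewrite leqnn.
  move: tk; rewrite le_eqVlt => /orP[/eqP tk|tk].
    move: tv; rewrite tk => h; apply: small; rewrite (leq_trans uk (leqnSn _)) /=.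
    by rewrite ltn_neqAle kv andbT; apply/eqP => e; move: h; rewrite e ltxx.
  apply: (piece_lt_right ga fp ks (t := t)); rewrite ?kt //.
    by apply: small; rewrite uk.
  by apply: small'; rewrite (leq_trans uk (leqnSn _)).
rewrite /f_op f_plusE // min_heightE fm au1.
eexists; first reflexivity.
move=> t; rewrite /bend gv gu; case: ifP => // _; case: ifP => _.
  by rewrite /bend_dir mul1r.
by rewrite mul1r addrAC subrr add0r scale1r.
Qed.

End Attained.

Lemma e_real_bend u v : real i -> (u < v <= s)%N -> g v = m%:~R ->
    (forall k, (k < v)%N -> m%:~R < g k) -> g u = m%:~R + 1 ->
    (forall k, (u < k < v)%N -> g k < m%:~R + 1) ->
  exists2 p', e_path i p = Some p' & p' =1 bend a p u v i 1.
Proof.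
move=> ri /andP[uv vs] gv gt gu mid.
have us : (u <= s)%N by apply: leq_trans vs; exact: ltnW.
have uv' : a u < a v by exact: (grid_lt ga).
have av0 : (a v == 0) = false.
  by apply/negbTE/eqP => e; have /andP[] := grid_01 ga us; rewrite leNgt -{1}e uv'.
have ep : least [set t | 0 <= t <= 1 /\ height i p t = m%:~R] = a v.
  apply: leastE; first by split; [exact: (grid_01 ga vs) | exact: gv].
  move=> t [t01 ht]; rewrite leNgt; apply/negP => tv.
  have [k ks /andP[kt tk]] := grid_find ga t01.
  have kv : (k < v)%N.
    rewrite ltnNge; apply/negP => vk.
    by have := le_lt_trans (le_trans (grid_le ga vk (ltnW ks)) kt) tv; rewrite ltxx.
  have lt1 : m%:~R < cr i (p t); last by move: lt1; rewrite -/(height i p t) ht ltxx.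
  move: tk; rewrite le_eqVlt => /orP[/eqP tk|tk].
    move: tv; rewrite tk => h; apply: gt.
    by rewrite ltn_neqAle kv andbT; apply/eqP => e; move: h; rewrite e ltxx.
  by apply: (piece_gt_right ga fp ks (t := t)); rewrite ?kt ?gt ?gm.
have em : greatest [set t | 0 <= t <= a v /\ height i p t = m%:~R + 1] = a u.
  apply: greatestE; first by split; [rewrite (ltW uv') andbT; case/andP: (grid_01 ga us) | exact: gu].
  move=> t [/andP[t0 tv] ht]; rewrite leNgt; apply/negP => ut.
  have [|k ks /andP[kt tk]] := grid_find_left ga (t := t).
    rewrite (le_trans tv) ?andbT; last by case/andP: (grid_01 ga vs).
    by case/andP: (grid_01 ga us) => h _; exact: le_lt_trans h ut.
  have uk : (u <= k)%N.
    rewrite leqNgt; apply/negP => ku.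
    by have := le_trans tk (grid_le ga ku us); rewrite leNgt ut.
  have kv : (k < v)%N.
    rewrite ltnNge; apply/negP => vk.
    by have := lt_le_trans (le_lt_trans (grid_le ga vk (ltnW ks)) kt) tv; rewrite ltxx.
  have lt1 : cr i (p t) < m%:~R + 1; last by move: lt1; rewrite -/(height i p t) ht ltxx.
  apply: (piece_lt_left ga fp ks (t := t)); rewrite ?kt //.
    move: uk; rewrite leq_eqVlt => /orP[/eqP <-|uk]; first by rewrite gu.
    by apply/ltW/mid; rewrite uk.
  move: kv; rewrite leq_eqVlt => /orP[/eqP ->|kv]; first by rewrite gv; lra.
  by apply: mid; rewrite kv ltnS uk.
rewrite /e_path ri /e_real (min_heightE vs gv) ep em av0.
eexists; first reflexivity.
move=> t; rewrite /bend gv gu; case: ifP => // _; case: ifP => _.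
  by rewrite /bend_dir mul1r.
by rewrite mul1r opprD addNKr scaleN1r opprK.
Qed.

End Evaluate.

(** The slopes of the height are nonnegative and the first is positive: the minimum is
    0, attained at 0 only, and the height does not go below 1 - a_ii once it has reached it. *)
Lemma e_imag_bend s l a p i v : grid s a -> follows s l a p -> ~~ real i ->
    (0 < v <= s)%N -> (forall k, (0 < k <= s)%N -> 0 <= cr i (l k)) ->
    0 < cr i (l 1%N) -> cr i (p (a v)) = 1 - (A i i)%:~R ->
    (forall k, (k < v)%N -> cr i (p (a k)) < 1 - (A i i)%:~R) ->
  exists2 p', e_path i p = Some p' & p' =1 bend a p 0 v i (- (1 - (A i i)%:~R)^-1).
Proof.
move=> ga fp ii /andP[v0 vs] lpos l1 gv mid; have [a0 a1 inc] := ga.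
have s0 := grid_pos ga.
have aii : (A i i)%:~R <= 0 :> rat by exact: cartan_imag.
have p0 : cr i (p (a 0%N)) = (0 : int)%:~R by rewrite (follows_at0 ga fp) pairing0r.
have mono k n : (k <= n)%N -> (n <= s)%N -> cr i (p (a k)) <= cr i (p (a n)).
  elim: n => [|n IH]; first by rewrite leqn0 => /eqP ->.
  rewrite leq_eqVlt => /orP[/eqP -> //|kn ns].
  rewrite (cr_next ga fp) //; have := IH kn (ltnW ns).
  suff : 0 <= (a n.+1 - a n) * cr i (l n.+1) by lra.
  by rewrite mulr_ge0 ?lpos // subr_ge0 ltW // inc.
have gm k : (k <= s)%N -> ((0 : int)%:~R : rat) <= cr i (p (a k)).
  by move=> ks; rewrite -p0; exact: mono.
have gt k : (0 < k <= s)%N -> ((0 : int)%:~R : rat) < cr i (p (a k)).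
  move=> /andP[k0 ks]; apply: (lt_le_trans _ (mono _ _ k0 ks)).
  rewrite (cr_next ga fp) // p0 add0r mulr_gt0 // subr_gt0; exact: inc.
have mE := min_heightE ga fp gm (leq0n s) p0.
have fE := f_plusE ga fp gm (leq0n s) p0 gt.
have v01 := grid_01 ga vs.
have after t : a v <= t <= 1 -> 1 - (A i i)%:~R <= cr i (p t).
  move=> /andP[vt t1]; have t01 : 0 <= t <= 1.
    by rewrite t1 andbT (le_trans _ vt) //; case/andP: v01.
  have [k ks /andP[kt tk]] := grid_find ga t01.
  have [kv|vk] := ltnP k v.
    have -> : t = a v by apply/le_anti; rewrite vt (le_trans tk) // (grid_le ga).
    by rewrite gv.
  have tk' : a k <= t <= a k.+1 by rewrite kt.
  rewrite -gv; apply: (piece_ge ga fp ks tk'); apply: mono => //; first exact: ltnW.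
  exact: leq_trans vk (leqnSn k).
have ep : least [set t | 0 <= t <= 1 /\ height i p t = 0 + 1 - (A i i)%:~R] = a v.
  apply: leastE; first by split; [exact: v01 | rewrite add0r; exact: gv].
  move=> t [t01 ht]; rewrite leNgt; apply/negP => tv.
  have [k ks /andP[kt tk]] := grid_find ga t01.
  have kv : (k < v)%N.
    rewrite ltnNge; apply/negP => vk.
    by have := le_lt_trans (le_trans (grid_le ga vk (ltnW ks)) kt) tv; rewrite ltxx.
  have lt1 : cr i (p t) < 1 - (A i i)%:~R.
    move: tk; rewrite le_eqVlt => /orP[/eqP tk|tk].
      move: tv; rewrite tk => h; apply: mid.
      by rewrite ltn_neqAle kv andbT; apply/eqP => e; move: h; rewrite e ltxx.
    apply: (piece_lt_right ga fp ks (t := t)); rewrite ?kt //; first exact: mid.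
    move: kv; rewrite leq_eqVlt => /orP[/eqP ->|kv]; first by rewrite gv.
    by apply/ltW/mid.
  by move: lt1; rewrite -/(height i p t) ht add0r ltxx.
rewrite /e_path (negbTE ii) /e_imag fE mE a0 ep.
case: asboolP => [[e|/(_ (a v) v01)]|_].
- by move: e => /eqP; rewrite eq_sym oner_eq0.
- by rewrite /height gv add0r ltxx.
case: asboolP => [[t tv]|_].
  by have := after t tv; rewrite /height; lra.
eexists; first reflexivity.
move=> t; rewrite /bend gv p0 a0; case: ifP => // _; case: ifP => _.
  by rewrite /srefl_inv /bend_dir mulNr scaleNr opprK.
rewrite subr0 mulNr mulVf ?scaleN1r ?opprK //.
by rewrite gt_eqF //; lra.
Qed.

End BrokenLines.

(** * Paths with repeated directions *)

Section PathData.
Variables (I : countType) (A : I -> I -> int).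
Context {hA : borcherds_cartan A}.
Variable D : realization A.

Local Notation hd := (dual (cartan D)).
Local Notation cr i x := (pairing (coroot D i) x).
Local Notation r := (@srefl I A D).
Local Notation real := (is_real A).
Implicit Types (x y z mu nu beta : hd) (i : I) (w : seq I) (K : pred I).

Variable lam : hd.
Hypothesis hlam : dominant lam.
Local Notation Tl := (Torbit lam).
Local Notation chain := (chainA lam).
Local Notation path := (gpath D).
Implicit Types (p q : path) (l : nat -> hd) (a : nat -> rat) (s j k u v m n : nat) (t : rat).

(** GLS data with two relaxations: the chain from the last direction to lam is treated
    as one more breakpoint by setting l s.+1 = lam (with a s = 1), and successive
    directions may be equal.  The second allows breakpoints to be inserted where a
    root operator starts or stops to bend the path. *)
Definition wGLS s l a := [/\ grid s a, l s.+1 = lam,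
  forall k, (0 < k <= s)%N -> Tl (l k) &
  forall k, (0 < k <= s)%N -> chain (a k) (l k) (l k.+1)].

Lemma GLS_wGLS p : GLS lam p -> exists s l a, wGLS s l a /\ follows s l a p.
Proof.
move=> [s [l [a [[[a0 a1] inc lT lc lE] pE]]]].
have ga : grid s a by [].
have s0 := grid_pos ga.
exists s, (fun k => if (k <= s)%N then l k else lam), a; split.
  split=> //; first by rewrite ltnn.
    by move=> k /andP[k0 ks]; rewrite ks; apply: lT; rewrite k0.
  move=> k /andP[k0 ks]; have [->|ks'] := eqVneq k s.
    rewrite leqnn ltnn; have [->|/eqP ls] := eqVneq (l s) lam; first exact: chainA_refl.
    by rewrite a1; apply: has_chain_chainA => //; exact: lE.
  have {}ks' : (k < s)%N by rewrite ltn_neqAle ks'.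
  rewrite ks ks'; have [|_ ch] := lc k; first by rewrite k0.
  by apply: has_chain_chainA ch => //; apply: (grid_gt0 ga); rewrite k0.
split.
  have := pE 1%N 0; rewrite s0 /= a0 lexx -a0 (ltW (inc 0%N s0)) => /(_ isT isT) ->.
  by rewrite big_geq // subrr scale0r addr0.
move=> k t ks tk; rewrite ks (pE k.+1 t) //= (pE k.+1 (a k)) //=.
  by rewrite subrr scale0r addr0.
by rewrite lexx ltW // inc.
Qed.

Lemma delete_break s l a p k : wGLS s.+1 l a -> follows s.+1 l a p ->
    (0 < k < s.+1)%N -> l k = l k.+1 ->
  exists l' a', wGLS s l' a' /\ follows s l' a' p.
Proof.
move=> [ga lE lT lc] fp /andP[k0 ks] lk; have [a0 a1 inc] := ga; have [p0 fk] := fp.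
have bump_lt j : (j < k)%N -> bump k j = j by move=> jk; rewrite /bump leqNgt jk.
have bump_ge j : (k <= j)%N -> bump k j = j.+1 by rewrite /bump => ->.
exists (fun j => l (bump k j)), (fun j => a (bump k j)).
have same j : (j.+1 < k)%N -> bump k j = j /\ bump k j.+1 = j.+1.
  by move=> jk; rewrite !bump_lt // ltnW.
split; split.
- split.
  + by rewrite bump_lt.
  + by rewrite bump_ge.
  + move=> j js; apply: (grid_lt ga); last by rewrite /bump; lia.
    by rewrite /bump; lia.
- by rewrite bump_ge // ltnW.
- by move=> j /andP[j0 js]; apply: lT; rewrite /bump; lia.
- move=> j /andP[j0 js]; have [jk|jk|jk] := ltngtP j.+1 k.
  + by have [-> ->] := same j jk; apply: lc; rewrite j0 ltnW.
  + rewrite (bump_ge j jk) (bump_ge j.+1 (ltnW jk)); apply: lc.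
    exact: js.
  + rewrite bump_lt; last by rewrite -jk.
    rewrite bump_ge; last by rewrite jk.
    by rewrite jk -lk -jk; apply: lc; rewrite j0 ltnW.
- exact: p0.
- move=> j t js; have [jk|jk|jk] := ltngtP j.+1 k.
  + by have [-> ->] := same j jk; apply: fk; exact: ltnW.
  + by rewrite (bump_ge j jk) (bump_ge j.+1 (ltnW jk)); exact: fk.
  + rewrite bump_lt; last by rewrite -jk.
    rewrite bump_ge; last by rewrite jk.
    rewrite jk -lk.
    have js1 : (j < s.+1)%N by exact: ltnW.
    have next := follows_next ga fp js1; rewrite jk in next.
    move=> /andP[jt tk]; have [tk'|kt] := leP t (a k).
      by have := fk j t js1; rewrite jk jt tk'; apply.
    rewrite (fk k t ks); last by rewrite (ltW kt).
    by rewrite next -lk -addrA -scalerDl [_ - _ + _]addrC subrKA.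
Qed.

(** Breakpoints between equal directions are deleted one at a time. *)
Lemma wGLS_GLS s l a p : wGLS s l a -> follows s l a p -> GLS lam p.
Proof.
elim: s l a => [|s IH] l a W fp; first by case: W => /grid_pos.
have [[k ks lk]|] := pselect (exists2 k, (0 < k < s.+1)%N & l k = l k.+1).
  by have [l' [a' [W' f']]] := delete_break W fp ks lk; exact: IH W' f'.
move=> nl; have [ga lE lT lc] := W; have [a0 a1 inc] := ga; have [p0 fk] := fp.
exists s.+1, l, a; split.
  split=> //.
    move=> k ks; have /andP[k0 ks'] := ks.
    have ch : has_chain lam (a k) (l k) (l k.+1).
      apply: chainA_has_chain => //; first by apply: (grid_gt0 ga); rewrite k0 ltnW.
      - by apply: lc; rewrite k0 ltnW.
      - by apply: lT; rewrite ks'.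
      - by move=> e; apply: nl; exists k.
    by split=> //; case: ch.
  move=> ls; have := lc s.+1; rewrite leqnn lE a1 => /(_ isT) ch.
  by apply: chainA_has_chain ch _ ls => //; exact: Torbit_lam.
move=> [|j] t // /andP[_ js] tj; rewrite (fk j t) //; congr (_ + _).
by rewrite (follows_sum ga fp) // ltnW.
Qed.

Section Insert.
Variables (s : nat) (l : nat -> hd) (a : nat -> rat) (k : nat) (t : rat).

Definition insert_break j : rat := if (j <= k)%N then a j else if j == k.+1 then t else a j.-1.
Definition insert_dir j : hd := if (j <= k.+1)%N then l j else l j.-1.

Lemma insert_break_le j : (j <= k)%N -> insert_break j = a j.
Proof. by rewrite /insert_break => ->. Qed.
Lemma insert_break_new : insert_break k.+1 = t.
Proof. by rewrite /insert_break ltnn eqxx. Qed.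
Lemma insert_break_gt j : (k < j)%N -> insert_break j.+1 = a j.
Proof.
move=> kj; rewrite /insert_break leqNgt ltnS ltnW //= eqSS.
by case: eqP => // jk; rewrite jk ltnn in kj.
Qed.
Lemma insert_dir_le j : (j <= k.+1)%N -> insert_dir j = l j.
Proof. by rewrite /insert_dir => ->. Qed.
Lemma insert_dir_gt j : (k < j)%N -> insert_dir j.+1 = l j.
Proof. by move=> kj; rewrite /insert_dir ltnS leqNgt kj. Qed.

Lemma insert_wGLS : wGLS s l a -> (k < s)%N -> a k < t < a k.+1 ->
  wGLS s.+1 insert_dir insert_break.
Proof.
move=> [ga lE lT lc] ks /andP[kt tk]; have [a0 a1 inc] := ga.
split.
- split.
  + by rewrite insert_break_le.
  + by rewrite insert_break_gt.
  + move=> j js; have [jk|kj|->] := ltngtP j k.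
    * rewrite (insert_break_le (ltnW jk)) (insert_break_le jk); apply: inc.
      exact: leq_trans jk (ltnW ks).
    * rewrite (insert_break_gt kj).
      case: j kj js => // j; rewrite ltnS leq_eqVlt => /orP[/eqP <-|kj] js.
        by rewrite insert_break_new.
      by rewrite (insert_break_gt kj); apply: inc.
    * by rewrite (insert_break_le (leqnn k)) insert_break_new.
- by rewrite (insert_dir_gt (leqW ks)).
- move=> [//|j] js; have [jk|kj] := leqP j k.
    by rewrite insert_dir_le //; apply: lT; rewrite /= (leq_trans _ ks).
  by rewrite insert_dir_gt //; apply: lT; rewrite (leq_ltn_trans _ kj).
- move=> j /andP[j0 js]; have [jk|kj|jk] := ltngtP j k.
  + rewrite (insert_break_le (ltnW jk)) (insert_dir_le (leqW (ltnW jk))) (insert_dir_le (leqW jk)).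
    by apply: lc; rewrite j0 (leq_trans (ltnW jk)) // ltnW.
  + rewrite (insert_dir_gt kj); case: j kj js j0 => // j.
    rewrite ltnS leq_eqVlt => /orP[/eqP <-|kj] js _.
      by rewrite (insert_dir_le (leqnn _)); exact: chainA_refl.
    rewrite (insert_break_gt kj) (insert_dir_gt kj); apply: lc.
    by rewrite (leq_ltn_trans _ kj).
  + rewrite jk (insert_break_le (leqnn k)) (insert_dir_le (leqnSn k)) (insert_dir_le (leqnn _)).
    by apply: lc; rewrite -jk j0 jk ltnW.
Qed.

Lemma insert_follows p : follows s l a p -> grid s a -> (k < s)%N -> a k < t < a k.+1 ->
  follows s.+1 insert_dir insert_break p.
Proof.
move=> [p0 fk] ga ks /andP[kt tk]; split=> // j t' js.
have [jk|kj|->] := ltngtP j k.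
- rewrite (insert_break_le (ltnW jk)) (insert_break_le jk) (insert_dir_le (leqW jk)).
  by apply: fk; exact: leq_trans jk (ltnW ks).
- rewrite (insert_break_gt kj) (insert_dir_gt kj).
  case: j kj js => // j; rewrite ltnS leq_eqVlt => /orP[/eqP <-|kj] js.
    rewrite insert_break_new => /andP[tt' t'k].
    rewrite (fk k t' ks) ?t'k ?(ltW (lt_le_trans kt tt')) //.
    rewrite (fk k t ks) ?ltW // -addrA -scalerDl; congr (_ + _ *: _).
    by rewrite [RHS]addrC subrKA.
  by rewrite (insert_break_gt kj); exact: fk.
- rewrite (insert_break_le (leqnn k)) insert_break_new (insert_dir_le (leqnn _)) => /andP[h1 h2].
  by apply: fk => //; rewrite h1 (le_trans h2 (ltW tk)).
Qed.

End Insert.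

(** * Integrality at the breakpoints *)

Section Integrality.
Variables (s : nat) (l : nat -> hd) (a : nat -> rat) (p : path).
Hypotheses (W : wGLS s l a) (fp : follows s l a p).
Variable i : I.
Local Notation g k := (cr i (p (a k))).

Let ga : grid s a. Proof. by case: W. Qed.

Lemma dir_Torbit k : (0 < k <= s.+1)%N -> Tl (l k).
Proof.
case: W => _ lE lT _ /andP[k0]; rewrite leq_eqVlt => /orP[/eqP ->|ks].
  by rewrite lE; exact: Torbit_lam.
by apply: lT; rewrite k0.
Qed.

Lemma dir_chain k : (0 < k <= s)%N -> chain (a k) (l k) (l k.+1).
Proof. by case: W => _ _ _; exact. Qed.

Lemma dir_chain_int k : (0 < k <= s)%N -> a k * (cr i (l k) - cr i (l k.+1)) \is a Num.int.
Proof. by move=> ks; by apply: chainA_int; exact: dir_chain. Qed.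

(** By Abel summation the height at a_k is a_k alpha_i^vee(l_{k+1}) plus the terms
    a_j (alpha_i^vee(l_j) - alpha_i^vee(l_{j+1})) for 0 < j <= k, which are integers
    because of the chains. *)
Lemma height_int_next k : (k <= s)%N -> g k - a k * cr i (l k.+1) \is a Num.int.
Proof.
elim: k => [_|k IH ks].
  by rewrite (follows_at0 ga fp) pairing0r; case: ga => -> _ _; rewrite mul0r subr0.
rewrite (cr_next ga fp) //.
have -> : g k + (a k.+1 - a k) * cr i (l k.+1) - a k.+1 * cr i (l k.+2) =
  (g k - a k * cr i (l k.+1)) + a k.+1 * (cr i (l k.+1) - cr i (l k.+2)) by lra.
by apply: intD; [exact: IH (ltnW ks) | exact: dir_chain_int].
Qed.

Lemma height_int_end : g s \is a Num.int.
Proof.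
have := height_int_next (leqnn s); case: ga => _ -> _; case: (W) => _ -> _ _ h.
rewrite -[cr i _](subrK (1 * cr i lam)); apply: intD => //.
by rewrite mul1r; case: (hlam i).
Qed.

Lemma height_int_right k : (k <= s)%N ->
  (g k \is a Num.int) = (a k * cr i (l k.+1) \is a Num.int).
Proof.
move=> ks; have h := height_int_next ks; apply/idP/idP => h'.
  have -> : a k * cr i (l k.+1) = g k - (g k - a k * cr i (l k.+1)) by lra.
  exact: intB.
rewrite -[cr i (p _)](subrK (a k * cr i (l k.+1))); exact: intD.
Qed.

Lemma height_int_left k : (0 < k <= s)%N ->
  (g k \is a Num.int) = (a k * cr i (l k) \is a Num.int).
Proof.
move=> /[dup] ks0 /andP[k0 ks]; rewrite height_int_right //.
have h := dir_chain_int ks0; apply/idP/idP => h'.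
  have -> : a k * cr i (l k) = a k * cr i (l k.+1) + a k * (cr i (l k) - cr i (l k.+1)) by lra.
  exact: intD.
have -> : a k * cr i (l k.+1) = a k * cr i (l k) - a k * (cr i (l k) - cr i (l k.+1)) by lra.
exact: intB.
Qed.

Lemma slope_gt0 k : (k < s)%N -> (0 < cr i (l k.+1)) = (g k < g k.+1).
Proof.
move=> ks; rewrite (cr_next ga fp) // ltrDl.
by case: ga => _ _ /(_ k ks) h; rewrite pmulr_rgt0 // subr_gt0.
Qed.

Lemma slope_lt0 k : (k < s)%N -> (cr i (l k.+1) < 0) = (g k.+1 < g k).
Proof.
move=> ks; rewrite (cr_next ga fp) // gtrDl.
by case: ga => _ _ /(_ k ks) h; rewrite pmulr_rlt0 // subr_gt0.
Qed.

(** The chain at such a breakpoint does not reflect as a whole, so by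
    [chainA_end_pos] it contains the reflection r_i, and then the height is an
    integer. *)
Lemma int_valley_right k : (0 < k < s)%N -> real i -> g k <= g k.-1 -> g k < g k.+1 ->
  g k \is a Num.int /\ chain (a k) (l k) (r i (l k.+1)).
Proof.
move=> /andP[k0 ks] ri h1 h2.
have h1' : cr i (l k) <= 0.
  by case: (k) k0 ks h1 => // n _ ns; rewrite /= leNgt -(slope_gt0 (ltnW ns)) -leNgt.
have ksl : (0 < k <= s)%N by rewrite k0 ltnW.
rewrite -slope_gt0 // in h2.
case: (chainA_end_pos hlam ri (dir_chain ksl) h2) => [[h _]|[h ch]].
  by move: h; rewrite ltNge h1'.
by rewrite height_int_right // ltnW.
Qed.

(** The minimum of the height is an integer, so the minimal integer among its values
    is its minimum.  For imaginary i the height is concave with nonnegative slopes,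
    and a last minimum before the end is at 0. *)
Lemma last_minimum : exists (m : int) u, [/\ (u <= s)%N, g u = m%:~R,
  forall k, (k <= s)%N -> m%:~R <= g k & forall k, (u < k <= s)%N -> m%:~R < g k].
Proof.
have [u [us h1 h2]] : exists u, [/\ (u <= s)%N, forall k, (k <= s)%N -> g u <= g k &
    forall k, (u < k <= s)%N -> g u < g k].
  elim: (s) => [|n [u [us h1 h2]]].
    exists 0%N; split=> // k; first by rewrite leqn0 => /eqP ->.
    by case: k.
  have [nu|un] := leP (g n.+1) (g u).
    exists n.+1; split=> // k.
      by rewrite leq_eqVlt => /orP[/eqP -> //|kn]; exact: le_trans nu (h1 k kn).
    by rewrite ltnNge => /andP[/negbTE ->].
  exists u; split; first exact: leqW.
    by move=> k; rewrite leq_eqVlt => /orP[/eqP ->|/h1 //]; exact: ltW.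
  move=> k /andP[uk]; rewrite leq_eqVlt => /orP[/eqP -> //|kn].
  by apply: h2; rewrite uk.
suff /intrP [m mE] : g u \is a Num.int by exists m, u; rewrite -mE.
move: us; rewrite leq_eqVlt => /orP[/eqP ->|us]; first exact: height_int_end.
case: (posnP u) => [->|u0]; first by rewrite (follows_at0 ga fp) pairing0r.
have low : g u <= g u.-1 by apply: h1; exact: leq_trans (leq_pred u) (ltnW us).
have up : g u < g u.+1 by apply: h2; rewrite leqnn.
have [ri|ii] := boolP (real i); first by have [|//] := int_valley_right _ ri low up; rewrite u0.
have u0s : (0 < u <= s)%N by rewrite u0 ltnW.
have le : cr i (l u.+1) <= cr i (l u) by exact: chainA_cr_imag ii (dir_chain u0s).
rewrite -slope_gt0 // in up; have := lt_le_trans up le; move: low.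
case: (u) u0 us => // n _ ns; rewrite /= => low.
by rewrite slope_gt0 ?(ltnW ns) // ltNge low.
Qed.

End Integrality.
End PathData.

Section Lowering.
Variables (I : countType) (A : I -> I -> int).
Context {hA : borcherds_cartan A}.
Variable D : realization A.

Local Notation hd := (dual (cartan D)).
Local Notation cr i x := (pairing (coroot D i) x).
Local Notation r := (@srefl I A D).
Local Notation real := (is_real A).
Implicit Types (x y z mu nu beta : hd) (i : I) (w : seq I) (K : pred I).

Variable lam : hd.
Hypothesis hlam : dominant lam.
Local Notation Tl := (Torbit lam).
Local Notation chain := (chainA lam).
Local Notation path := (gpath D).
Implicit Types (p q : path) (l : nat -> hd) (a : nat -> rat) (s j k u v m n : nat) (t : rat).

Local Notation wGLS := (@wGLS I A D lam).

(** * Lowering operators preserve the paths *)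

Lemma int_between (m : int) (x : rat) : x \is a Num.int -> m%:~R < x -> x < m%:~R + 1 -> False.
Proof.
move=> /intrP [n ->]; rewrite ltr_int -[1]/((1%:Z)%:~R) -intrD ltr_int; lia.
Qed.

Lemma int_gt (m : int) (x : rat) : x \is a Num.int -> m%:~R < x -> m%:~R + 1 <= x.
Proof. by move=> ix mx; rewrite leNgt; apply/negP => h; exact: int_between mx h. Qed.

Lemma bend_dir1 i x : bend_dir i 1 x = r i x.
Proof. by rewrite /bend_dir mul1r. Qed.

Lemma bend_dirs_in l u v i c k : (u < k <= v)%N -> bend_dirs l u v i c k = bend_dir i c (l k).
Proof. by rewrite /bend_dirs => ->. Qed.

Lemma bend_dirs_out l u v i c k : ~~ (u < k <= v)%N -> bend_dirs l u v i c k = l k.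
Proof. by rewrite /bend_dirs => /negbTE ->. Qed.

Lemma same_on_grid s a p q k : grid s a -> same_on p q -> (k <= s)%N -> p (a k) = q (a k).
Proof. by move=> ga pq ks; apply: pq; exact: (grid_01 ga ks). Qed.

(** The breakpoints u and v are the two times that enter the definition of f_i. *)
Definition lowering s a p i (m : int) u v :=
  [/\ (u < v <= s)%N, cr i (p (a u)) = m%:~R, cr i (p (a v)) = m%:~R + 1,
      forall k, (k <= s)%N -> m%:~R <= cr i (p (a k)) &
      (forall k, (u < k <= s)%N -> m%:~R < cr i (p (a k))) /\
      (forall k, (u < k < v)%N -> cr i (p (a k)) < m%:~R + 1)].

Lemma lowering_ext s a p q i (m : int) u v : grid s a -> same_on p q ->
  lowering s a p i m u v -> lowering s a q i m u v.
Proof.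
move=> ga pq [/andP[uv vs] gu gv gm [gt mid]].
have us : (u <= s)%N by apply: leq_trans vs; exact: ltnW.
have E k : (k <= s)%N -> q (a k) = p (a k) by move=> ks; rewrite (same_on_grid ga pq).
split; rewrite ?uv ?E //.
  by move=> k ks; rewrite E //; exact: gm.
split=> k /andP[uk kv]; rewrite E //; first by apply: gt; rewrite uk.
  by apply: mid; rewrite uk.
by apply: leq_trans vs; exact: ltnW.
Qed.

Lemma lowering_bend s l a p i (m : int) u v : grid s a -> follows s l a p ->
  lowering s a p i m u v -> exists2 p', f_op i p = Some p' & p' =1 bend a p u v i 1.
Proof.
move=> ga fp [uvs gu gv gm [gt mid]].
have us : (u <= s)%N by case/andP: uvs => uv; apply: leq_trans; exact: ltnW.
exact: (f_op_bend ga fp gm us gu gt uvs gv mid).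
Qed.

(** An affine function takes each intermediate value. *)
Lemma crossing s l a p i k (c : rat) : grid s a -> follows s l a p -> (k < s)%N ->
    cr i (p (a k)) < c < cr i (p (a k.+1)) \/ cr i (p (a k.+1)) < c < cr i (p (a k)) ->
  exists2 t, a k < t < a k.+1 & cr i (p t) = c.
Proof.
move=> ga fp ks h; have [_ _ /(_ k ks) inc] := ga.
set x := cr i (p (a k)) in h *; set y := cr i (p (a k.+1)) in h *.
have yE : y = x + (a k.+1 - a k) * cr i (l k.+1) by exact: (cr_next ga fp).
set d := cr i (l k.+1) in yE; set st := a k.+1 - a k in yE.
have d0 : d != 0.
  by apply: contraPneq h => d0; rewrite yE d0 mulr0 addr0; case=> /andP[h1 h2];
    have := lt_trans h1 h2; rewrite ltxx.
pose e := (c - x) / d.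
have eE : e * d = c - x by rewrite /e divfK.
have de : (st - e) * d = y - c by rewrite mulrBl eE yE; lra.
have st0 : 0 < st by rewrite subr_gt0.
have [e0 es] : 0 < e /\ 0 < st - e.
  move: d0; rewrite neq_lt => /orP[d0|d0]; case: h => /andP[h1 h2].
  - by exfalso; have : 0 < st * (- d); [rewrite mulr_gt0 ?oppr_gt0 | lra].
  - by split; rewrite -(nmulr_llt0 _ d0) ?eE ?de subr_lt0.
  - by split; rewrite -(pmulr_lgt0 _ d0) ?eE ?de subr_gt0.
  - by exfalso; have : 0 < st * d; [rewrite mulr_gt0 | lra].
have t01 : a k < a k + e < a k.+1 by move: es; rewrite /st; lra.
exists (a k + e) => //; have /andP[h1 h2] := t01.
rewrite (cr_piece fp i ks); last by rewrite !ltW.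
by rewrite [a k + _]addrC addrK eE -/x addrC subrK.
Qed.

Section Data.
Variables (s : nat) (l : nat -> hd) (a : nat -> rat) (p : path).
Hypotheses (W : wGLS s l a) (fp : follows s l a p).
Variable i : I.
Local Notation g k := (cr i (p (a k))).

Let ga : grid s a. Proof. by case: W. Qed.

Lemma bend_Torbit u v k : (0 < k <= s)%N -> Tl (bend_dirs l u v i 1 k).
Proof.
move=> /andP[k0 ks]; have Tk : Tl (l k) by apply: (dir_Torbit W); rewrite k0 leqW.
by rewrite /bend_dirs bend_dir1; case: ifP => // _; exact: Torbit_srefl.
Qed.

Lemma bend_dirs_last u v : (v <= s)%N -> bend_dirs l u v i 1 s.+1 = lam.
Proof.
move=> vs; rewrite bend_dirs_out; first by case: W.
by rewrite negb_and -leqNgt -ltnNge ltnS vs orbT.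
Qed.

(** Only the chains at the breakpoints from u to v change. *)
Lemma bend_wGLS u v : (u < v <= s)%N ->
    ((0 < u)%N -> chain (a u) (l u) (r i (l u.+1))) ->
    (forall k, (u < k < v)%N -> chain (a k) (r i (l k)) (r i (l k.+1))) ->
    chain (a v) (r i (l v)) (l v.+1) ->
  wGLS s (bend_dirs l u v i 1) a.
Proof.
move=> /andP[uv vs] cu cm cv; split=> //; first exact: bend_dirs_last.
  by move=> k; exact: bend_Torbit.
move=> k /andP[k0 ks]; have ck := dir_chain W (k := k).
rewrite k0 ks in ck; have {}ck := ck isT.
have [ku|uk|ku] := ltngtP k u.
- rewrite !bend_dirs_out //; first by rewrite ltnNge ku.
  by rewrite ltnNge (ltnW ku).
- have [kv|vk|kv] := ltngtP k v.
  + rewrite !bend_dirs_in ?uk ?kv ?(ltnW kv) ?leqW // !bend_dir1.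
    by apply: cm; rewrite uk.
  + rewrite !bend_dirs_out //; first by rewrite (leqNgt k.+1 v) (leqW vk) andbF.
    by rewrite (leqNgt k v) vk andbF.
  + by rewrite kv bend_dirs_in ?uv ?leqnn // bend_dir1 bend_dirs_out // ltnn andbF.
- rewrite ku bend_dirs_out ?ltnn // bend_dirs_in ?leqnn ?uv // bend_dir1.
  by apply: cu; rewrite -ku.
Qed.

Section Lowering.
Variables (m : int) (u v : nat).
Hypothesis low : lowering s a p i m u v.

(** Once the height is below m + 1 after its last minimum it keeps growing: a descent
    would be followed by a valley, whose height is an integer strictly between m and
    m + 1. *)
Lemma rising k : real i -> (u < k <= s)%N -> g k < m%:~R + 1 ->
  (k < s)%N /\ 0 < cr i (l k.+1).
Proof.
case: low => _ _ _ gm [gt _] ri.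
move: {2}(s - k)%N (leqnn (s - k)) => n; elim: n k => [|n IH] k nk /[dup] uks /andP[uk ks] gk.
  exfalso; have ek : k = s by lia.
  have := height_int_end hlam W fp i; rewrite -ek => ik.
  exact: int_between ik (gt k uks) gk.
move: ks; rewrite leq_eqVlt => /orP[/eqP ek|ks].
  exfalso; have := height_int_end hlam W fp i; rewrite -ek => ik.
  exact: int_between ik (gt k uks) gk.
split=> //; rewrite (slope_gt0 W fp) // ltNge; apply/negP => down.
have uk1 : (u < k.+1 <= s)%N by rewrite ks ltnS ltnW.
have gk1 := le_lt_trans down gk.
have [|k1s up] := IH k.+1 _ uk1 gk1; first by lia.
rewrite (slope_gt0 W fp) // in up.
have [|ik _] := int_valley_right hlam W fp (k := k.+1) _ ri down up; first by rewrite k1s.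
exact: int_between ik (gt _ uk1) gk1.
Qed.

Lemma lowering_slope k : real i -> (u < k <= v)%N -> 0 < cr i (l k).
Proof.
move=> ri; case: (low) => /andP[uv vs] gu gv gm [gt mid].
case: k => // k; rewrite ltnS => /andP[uk kv].
have ks : (k < s)%N by exact: leq_trans kv vs.
move: uk; rewrite leq_eqVlt => /orP[/eqP <-|uk].
  rewrite (slope_gt0 W fp); last exact: leq_trans uv vs.
  by rewrite gu gt // ltnSn (leq_trans uv).
have [] := rising ri (k := k) _ (mid k _); rewrite ?uk ?kv //.
exact: ltnW.
Qed.

(** At v the arrow from r_i l_v to l_v is put in front of the chain; its integrality
    condition is that of the height at v.  At a breakpoint strictly between u and v
    the chain is reflected as a whole, for otherwise the height there would be an
    integer strictly between m and m + 1.  At u there is a valley or the path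
    starts. *)
Lemma lowering_wGLS_real : real i -> wGLS s (bend_dirs l u v i 1) a.
Proof.
move=> ri; case: (low) => /[dup] uvs /andP[uv vs] gu gv gm [gt mid].
have us : (u < s)%N by exact: leq_trans uv vs.
apply: bend_wGLS => //.
- move=> u0; have u0s : (0 < u < s)%N by rewrite u0.
  have dn : g u <= g u.-1 by rewrite gu gm // (leq_trans (leq_pred u)) // ltnW.
  have up : g u < g u.+1 by rewrite gu gt // ltnSn.
  by have [_] := int_valley_right hlam W fp u0s ri dn up.
- move=> k /[dup] ukv /andP[uk kv]; have ks : (k < s)%N by exact: leq_trans kv vs.
  have k0 : (0 < k <= s)%N by rewrite (leq_trans _ uk) // ltnW.
  have up : 0 < cr i (l k.+1) by apply: lowering_slope; rewrite // ltnS ltnW.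
  case: (chainA_end_pos hlam ri (dir_chain W k0) up) => [[_ //]|[ik _]].
  rewrite -(height_int_right W fp) in ik; last exact: ltnW.
  by exfalso; apply: (int_between ik _ (mid k ukv)); apply: gt; rewrite uk ltnW.
- have v0 : (0 < v <= s)%N by rewrite vs (leq_trans _ uv).
  apply: chainA_trans (dir_chain W v0); apply: chainA1; apply: arrowA_simple.
  + by apply: (dir_Torbit W); case/andP: v0 => ->; exact: leqW.
  + by apply: lowering_slope; rewrite // uv /=.
  + move=> _; rewrite -(height_int_left W fp) // gv -[1]/((1%:Z)%:~R) -intrD.
    exact: intr_int.
  + by rewrite ri.
Qed.

(** For imaginary i the bent piece starts at 0, and the height is linear on it: if a
    slope decreases at a breakpoint, a_k times the decrease is a positive integer and
    the height there is already 1.  So the directions of the piece have a common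
    pairing with the coroot, and [chainA_imag] reflects the chains between them. *)
Lemma lowering_wGLS_imag : ~~ real i -> wGLS s (bend_dirs l u v i 1) a.
Proof.
move=> ii; case: (low) => /[dup] uvs /andP[uv vs] gu gv gm [gt mid].
have us : (u < s)%N by exact: leq_trans uv vs.
have dec k : (0 < k <= s)%N -> cr i (l k.+1) <= cr i (l k).
  by move=> ks; exact: chainA_cr_imag ii (dir_chain W ks).
have pos k : (0 < k <= s.+1)%N -> 0 <= cr i (l k).
  by move=> ks; apply: (Torbit_imag hlam ii); exact: (dir_Torbit W).
have u0 : u = 0%N.
  case: (posnP u) => // u0; exfalso.
  have up : 0 < cr i (l u.+1) by rewrite (slope_gt0 W fp) // gu gt // ltnSn.
  have := dec u; rewrite u0 ltnW // => /(_ isT) /(lt_le_trans up).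
  have : g u <= g u.-1 by rewrite gu gm // (leq_trans (leq_pred u)) // ltnW.
  case: (u) u0 us => // n _ ns; rewrite /= => h.
  by rewrite (slope_gt0 W fp) ?(ltnW ns) // ltNge h.
have m0 : (m%:~R : rat) = 0 by rewrite -gu u0 (follows_at0 ga fp) pairing0r.
have lin k : (0 < k <= v)%N -> g k = a k * cr i (l k) /\
    ((k < v)%N -> cr i (l k) = cr i (l k.+1)).
  elim: k => // k IH /andP[_ kv]; have ks := leq_trans kv vs.
  have gk : g k.+1 = a k.+1 * cr i (l k.+1).
    rewrite (cr_next ga fp) //; case: (posnP k) => [->|k0].
      by rewrite (follows_at0 ga fp) pairing0r; case: ga => -> _ _; lra.
    have [|-> e] := IH; first by rewrite k0 ltnW.
    by rewrite e //; lra.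
  split=> // kv'; apply/eqP; rewrite eq_sym eq_le dec //=; rewrite leNgt; apply/negP => lt.
  have ks1 : (0 < k.+1 <= s)%N by rewrite ks.
  have ak := grid_gt0 ga ks1.
  have : 1 <= a k.+1 * (cr i (l k.+1) - cr i (l k.+2)).
    by apply: nat_gt0_ge1; [exact: (dir_chain_int W) | rewrite mulr_gt0 // subr_gt0].
  have : 0 <= a k.+1 * cr i (l k.+2) by rewrite mulr_ge0 ?pos // ltW.
  have := mid k.+1; rewrite kv' u0 m0 gk => /(_ isT); lra.
have v0 : (0 < v <= v)%N by rewrite leqnn (leq_trans _ uv).
have v0s : (0 < v <= s)%N by rewrite vs (leq_trans _ uv).
have [gvE _] := lin v v0; rewrite gv m0 add0r in gvE.
apply: bend_wGLS => //.
- by rewrite u0.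
- move=> k; rewrite u0 => /andP[k0 kv]; have [|_ e] := lin k; first by rewrite k0 ltnW.
  apply: (chainA_imag hlam ii); last exact: e.
  by apply: (dir_chain W); rewrite k0 (leq_trans (ltnW kv)).
- apply: chainA_trans (dir_chain W v0s); apply: chainA1; apply: arrowA_simple.
  + by apply: (dir_Torbit W); case/andP: v0s => ->; exact: leqW.
  + have : 0 < a v * cr i (l v) by rewrite -gvE.
    by rewrite pmulr_rgt0 // (grid_gt0 ga).
  + by move=> ri; rewrite ri in ii.
  + by rewrite -gvE.
Qed.

End Lowering.

(** A breakpoint is inserted at the first time after the last minimum when the height
    is m + 1, if it is not one already. *)
Lemma lowering_refine : f_op i p <> None -> exists s' l' a' (m : int) u v,
  [/\ wGLS s' l' a', follows s' l' a' p & lowering s' a' p i m u v].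
Proof.
move=> fN; have [m [u [us gu gm gt]]] := last_minimum hlam W fp i.
have {}us : (u < s)%N.
  rewrite ltn_neqAle us andbT; apply/eqP => e.
  by apply: fN; exact: (f_op_none ga fp gm us gu gt e).
have ex : exists k, (u < k <= s)%N && (m%:~R + 1 <= g k).
  exists s; rewrite us leqnn /=; apply: int_gt; first exact: (height_int_end hlam W fp).
  by apply: gt; rewrite us leqnn.
have [v /andP[/andP[uv vs] gv] vmin] := ex_minnP ex.
have mid k : (u < k < v)%N -> g k < m%:~R + 1.
  move=> /andP[uk kv]; rewrite ltNge; apply/negP => h.
  have := vmin k; rewrite uk h (leq_trans (ltnW kv)) // => /(_ isT).
  by rewrite leqNgt kv.
move: gv; rewrite le_eqVlt => /orP[/eqP gv|gv].
  exists s, l, a, m, u, v; split=> //; split=> //; first by rewrite uv.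
case: v uv vs gv mid {vmin} => // k; rewrite ltnS => uk ks gv mid.
have gk : g k < m%:~R + 1.
  move: uk; rewrite leq_eqVlt => /orP[/eqP <-|uk]; first by rewrite gu; lra.
  by apply: mid; rewrite uk ltnSn.
have [|t tk pt] := crossing (i := i) (c := m%:~R + 1) ga fp ks; first by left; rewrite gk.
exists s.+1, (insert_dir l k), (insert_break a k t), m, u, k.+1.
split; [exact: insert_wGLS | exact: insert_follows | ].
have new := insert_break_new a k t.
split.
- by rewrite ltnS uk ltnS ltnW.
- by rewrite insert_break_le.
- by rewrite new.
- move=> j js; have [jk|] := leqP j k; first by rewrite (insert_break_le a t jk) gm // (leq_trans jk) // ltnW.
  case: j js => // j js; rewrite ltnS leq_eqVlt => /orP[/eqP <-|kj]; first by rewrite new pt; lra.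
  by rewrite (insert_break_gt a t kj) gm.
- split=> j /andP[uj js].
    have [jk|] := leqP j k.
      by rewrite (insert_break_le a t jk) gt // uj (leq_trans jk) // ltnW.
    case: j js uj => // j js uj; rewrite ltnS leq_eqVlt => /orP[/eqP <-|kj].
      by rewrite new pt; lra.
    by rewrite (insert_break_gt a t kj) gt // (leq_ltn_trans uk kj).
  have jk : (j <= k)%N by [].
  by rewrite (insert_break_le a t jk) mid // uj.
Qed.

End Data.

Theorem f_op_GLS p p' i : GLS lam p -> f_op i p = Some p' -> GLS lam p'.
Proof.
move=> /(GLS_wGLS hlam) [s0 [l0 [a0 [W0 f0]]]] fE.
have [|s [l [a [m [u [v [W fp low]]]]]]] := lowering_refine W0 f0 (i := i).
  by rewrite fE.
have ga : grid s a by case: W.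
have [p'' fE' p''E] := lowering_bend ga fp low.
move: fE'; rewrite fE => -[p'p]; subst p''.
have [uvs _ _ _ _] := low; have [uv vs] := andP uvs.
have fb := bend_follows ga fp i 1 uv vs.
apply: (wGLS_GLS hlam (s := s) (l := bend_dirs l u v i 1) (a := a)).
  have [ri|ii] := boolP (real i); first exact: (lowering_wGLS_real W fp low).
  exact: (lowering_wGLS_imag W fp low).
by apply: (follows_ext ga fb) => t _.
Qed.

End Lowering.

Section RaisingAndOrbit.
Variables (I : countType) (A : I -> I -> int).
Context {hA : borcherds_cartan A}.
Variable D : realization A.

Local Notation hd := (dual (cartan D)).
Local Notation al := (@Defs.root I A D).
Local Notation cr i x := (pairing (coroot D i) x).
Local Notation r := (@srefl I A D).
Local Notation real := (is_real A).
Implicit Types (x y z mu nu beta : hd) (i : I) (w : seq I) (K : pred I).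

Variable lam : hd.
Hypothesis hlam : dominant lam.
Local Notation Tl := (Torbit lam).
Local Notation chain := (chainA lam).
Local Notation path := (gpath D).
Implicit Types (p q : path) (l : nat -> hd) (a : nat -> rat) (s j k u v m n : nat) (t : rat).

Local Notation wGLS := (@wGLS I A D lam).

(** * Raising operators *)

(** The breakpoints u and v are the two times that enter the definition of e_i for
    real i. *)
Definition raising s a p i (m : int) u v :=
  [/\ (u < v <= s)%N, cr i (p (a u)) = m%:~R + 1, cr i (p (a v)) = m%:~R,
      forall k, (k <= s)%N -> m%:~R <= cr i (p (a k)) &
      [/\ forall k, (k <= u)%N -> m%:~R + 1 <= cr i (p (a k)),
          forall k, (k < v)%N -> m%:~R < cr i (p (a k)) &
          forall k, (u < k < v)%N -> cr i (p (a k)) < m%:~R + 1]].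

Section RaisingReal.
Variables (s : nat) (l : nat -> hd) (a : nat -> rat) (p : path).
Hypotheses (W : wGLS s l a) (fp : follows s l a p).
Variable i : I.
Hypothesis ri : real i.
Local Notation g k := (cr i (p (a k))).

Let ga : grid s a. Proof. by case: W. Qed.

(** The mirror image of [int_valley_right]. *)
Lemma int_valley_left k : (0 < k <= s)%N -> cr i (l k) < 0 -> 0 <= cr i (l k.+1) ->
  g k \is a Num.int /\ chain (a k) (r i (l k)) (l k.+1).
Proof.
move=> ks h1 h2; case: (chainA_start_neg hlam ri (dir_chain W ks) h1) => [[h _]|[h ch]].
  by move: h; rewrite ltNge h2.
by rewrite (height_int_left W fp).
Qed.

(** The mirror image of [rising]: before its first minimum the height is falling
    wherever it is below m + 1. *)
Lemma falling (m : int) v k : (v <= s)%N -> (forall j, (j < v)%N -> m%:~R < g j) ->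
  (k < v)%N -> g k < m%:~R + 1 -> (0 < k)%N /\ cr i (l k) < 0.
Proof.
move=> vs gt; elim: k => [v0|k IH kv] gk.
  exfalso; apply: (int_between _ (gt 0%N v0) gk).
  by rewrite (follows_at0 ga fp) pairing0r.
split=> //; have ks : (k < s)%N by exact: leq_trans (ltnW kv) vs.
rewrite (slope_lt0 W fp) // ltNge; apply/negP => up.
have gk' := le_lt_trans up gk; have [k0 dn] := IH (ltnW kv) gk'.
have k0s : (0 < k <= s)%N by rewrite k0 ltnW.
have [|ik _] := int_valley_left k0s dn.
  by rewrite leNgt (slope_lt0 W fp) // -leNgt.
exact: int_between ik (gt _ (ltnW kv)) gk'.
Qed.

Lemma falling_next (m : int) v k j : (v <= s)%N -> (forall j, (j < v)%N -> m%:~R < g j) ->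
  (k <= j)%N -> (j < v)%N -> g k < m%:~R + 1 -> g j < m%:~R + 1.
Proof.
move=> vs gt; elim: j => [|j IH]; first by rewrite leqn0 => /eqP ->.
rewrite leq_eqVlt => /orP[/eqP -> //|kj] jv gk; have gj := IH kj (ltnW jv) gk.
have [j0 dn] := falling vs gt (ltnW jv) gj.
have js : (j < s)%N by exact: leq_trans (ltnW jv) vs.
rewrite ltNge; apply/negP => up; have j0s : (0 < j <= s)%N by rewrite j0 ltnW.
have [|ij _] := int_valley_left j0s dn.
  by apply: ltW; rewrite (slope_gt0 W fp) // (lt_le_trans gj).
exact: int_between ij (gt _ (ltnW jv)) gj.
Qed.

(** As the first direction goes down, the minimum of the height is negative, hence at
    most -1, and e_i does not vanish. *)
Lemma raising_refine : cr i (l 1%N) < 0 -> exists s' l' a' (m : int) u v,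
  [/\ wGLS s' l' a', follows s' l' a' p & raising s' a' p i m u v].
Proof.
move=> neg; have [m [u0 [u0s gu0 gm _]]] := last_minimum hlam W fp i.
have s0 := grid_pos ga; have g0 : g 0%N = 0 by rewrite (follows_at0 ga fp) pairing0r.
have m0 : m%:~R < (0 : rat).
  by rewrite -g0; apply: le_lt_trans (gm 1%N s0) _; rewrite -(slope_lt0 W fp).
have exv : exists k, (k <= s)%N && (g k == m%:~R) by exists u0; rewrite u0s gu0 eqxx.
have [v /andP[vs /eqP gv] vmin] := ex_minnP exv.
have gt k : (k < v)%N -> m%:~R < g k.
  move=> kv; have ks : (k <= s)%N by exact: leq_trans (ltnW kv) vs.
  rewrite lt_neqAle gm // andbT eq_sym; apply/negP => e.
  by have := vmin k; rewrite ks e leqNgt kv => /(_ isT).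
have v0 : (0 < v)%N by rewrite lt0n; apply/eqP => e; move: m0; rewrite -gv e g0 ltxx.
have exu : exists k, (k < v)%N && (m%:~R + 1 <= g k).
  by exists 0%N; rewrite v0 g0 /=; apply: int_gt => //; exact: (intr_int 0).
have ub k : (k < v)%N && (m%:~R + 1 <= g k) -> (k <= v)%N by case/andP => /ltnW.
have [u /andP[uv gu] umax] := ex_maxnP exu ub.
have mid k : (u < k < v)%N -> g k < m%:~R + 1.
  move=> /andP[uk kv]; rewrite ltNge; apply/negP => h.
  by have := umax k; rewrite kv h leqNgt uk => /(_ isT).
have pre k : (k <= u)%N -> m%:~R + 1 <= g k.
  move=> ku; rewrite leNgt; apply/negP => h.
  by have := falling_next vs gt ku uv h; rewrite ltNge gu.
move: gu; rewrite le_eqVlt => /orP[/eqP gu|gu].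
  by exists s, l, a, m, u, v; split=> //; split=> //; rewrite uv.
have us : (u < s)%N by exact: leq_trans uv vs.
have gu1 : g u.+1 < m%:~R + 1.
  move: (uv); rewrite leq_eqVlt => /orP[/eqP ->|u1v]; first by rewrite gv; lra.
  by apply: mid; rewrite ltnSn.
have [|t tk pt] := crossing (i := i) (c := m%:~R + 1) ga fp us; first by right; rewrite gu1.
exists s.+1, (insert_dir l u), (insert_break a u t), m, u.+1, v.+1.
split; [exact: insert_wGLS | exact: insert_follows | ].
have new := insert_break_new a u t.
split.
- by rewrite !ltnS uv.
- by rewrite new.
- by rewrite (insert_break_gt a t uv).
- move=> j js; have [ju|] := leqP j u.
    by rewrite (insert_break_le a t ju) gm // (leq_trans ju) // ltnW.
  case: j js => // j js; rewrite ltnS leq_eqVlt => /orP[/eqP <-|uj]; first by rewrite new pt; lra.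
  by rewrite (insert_break_gt a t uj) gm.
- split=> j.
  + rewrite leq_eqVlt => /orP[/eqP ->|ju]; first by rewrite new pt.
    have ju' : (j <= u)%N by [].
    by rewrite (insert_break_le a t ju') pre.
  + move=> js; have [ju|] := leqP j u.
      by rewrite (insert_break_le a t ju) gt // (leq_ltn_trans ju).
    case: j js => // j js; rewrite ltnS leq_eqVlt => /orP[/eqP <-|uj]; first by rewrite new pt; lra.
    by rewrite (insert_break_gt a t uj) gt.
  + move=> /andP[uj jv]; case: j uj jv => // j uj jv.
    have uj' : (u < j)%N by [].
    by rewrite (insert_break_gt a t uj') mid // uj'.
Qed.

Section Raising.
Variables (m : int) (u v : nat).
Hypothesis up : raising s a p i m u v.

Lemma raising_slope k : (u < k <= v)%N -> cr i (l k) < 0.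
Proof.
case: up => /andP[uv vs] gu gv gm [pre gt mid] /andP[uk].
rewrite leq_eqVlt => /orP[/eqP kv|kv].
  case: k uk kv => // k uk kv; rewrite (slope_lt0 W fp); last by rewrite kv.
  by rewrite kv gv gt // -kv.
by case: (falling vs gt kv) => //; apply: mid; rewrite uk.
Qed.

(** As for lowering, with the roles of u and v exchanged: an arrow given by r_i is
    appended to the chain at u, and one is removed from the chain at v. *)
Lemma raising_wGLS : wGLS s (bend_dirs l u v i 1) a.
Proof.
case: (up) => /[dup] uvs /andP[uv vs] gu gv gm [pre gt mid].
have us : (u < s)%N by exact: leq_trans uv vs.
apply: (bend_wGLS W) => //.
- move=> u0; have u0s : (0 < u <= s)%N by rewrite u0 ltnW.
  have neg : cr i (l u.+1) < 0 by apply: raising_slope; rewrite ltnSn.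
  apply: chainA_trans (dir_chain W u0s) _; apply: chainA1.
  rewrite -{1}(sreflK (l u.+1) ri); apply: arrowA_simple.
  + by apply: Torbit_srefl; apply: (dir_Torbit W); exact: leqW us.
  + by rewrite cr_srefl_real // oppr_gt0.
  + move=> _; rewrite cr_srefl_real // mulrN; apply: intN.
    rewrite -(height_int_right W fp i (ltnW us)) gu.
    by apply: intD.
  + by rewrite ri.
- move=> k /[dup] ukv /andP[uk kv]; have ks : (k < s)%N by exact: leq_trans kv vs.
  have k0 : (0 < k <= s)%N by rewrite (leq_trans _ uk) // ltnW.
  have neg : cr i (l k) < 0 by apply: raising_slope; rewrite uk ltnW.
  case: (chainA_start_neg hlam ri (dir_chain W k0) neg) => [[_ //]|[ik _]].
  rewrite -(height_int_left W fp) // in ik.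
  by exfalso; exact: (int_between ik (gt k kv) (mid k ukv)).
- have v0 : (0 < v <= s)%N by rewrite vs (leq_trans _ uv).
  have neg : cr i (l v) < 0 by apply: raising_slope; rewrite uv leqnn.
  have [|_ ch] := int_valley_left v0 neg; last exact: ch.
  move: (vs); rewrite leq_eqVlt => /orP[/eqP ->|vs'].
    by case: (W) => _ -> _ _; case: (hlam i).
  by rewrite leNgt (slope_lt0 W fp) // -leNgt gv gm.
Qed.

Lemma raising_e_path : exists2 p', e_path i p = Some p' & p' =1 bend a p u v i 1.
Proof.
case: up => uvs gu gv gm [pre gt mid].
exact: (e_real_bend ga fp gm ri uvs gv gt gu mid).
Qed.

(** After raising, the height has minimum m + 1, last attained at u, and reaches
    m + 2 at v. *)
Lemma raising_lowering q : same_on (bend a p u v i 1) q -> lowering s a q i (m + 1) u v.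
Proof.
move=> pq; apply: (lowering_ext ga pq).
case: up => /[dup] uvs /andP[uv vs] gu gv gm [pre gt mid].
have kap : 1 * (g v - g u) = -1 by rewrite gu gv; lra.
have first k : (k <= u)%N -> cr i (bend a p u v i 1 (a k)) = g k.
  by move=> ku; exact: (cr_bend_first p ga i 1 uv vs ku).
have middle k : (u <= k <= v)%N -> cr i (bend a p u v i 1 (a k)) = 2 * m%:~R + 2 - g k.
  by move=> ukv; rewrite (cr_bend_mid p ga i 1 vs ukv) cartan_real // gu; lra.
have last k : (v <= k <= s)%N -> cr i (bend a p u v i 1 (a k)) = g k + 2.
  by move=> vks; rewrite (cr_bend_last p ga i 1 uv vs vks) cartan_real // kap; lra.
have m1 : (m + 1)%:~R = m%:~R + 1 :> rat by rewrite intrD.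
rewrite /lowering m1; split=> //.
- by rewrite first.
- by rewrite last ?leqnn // gv; lra.
- move=> k ks; have [ku|uk] := leqP k u; first by rewrite first // pre.
  have [kv|vk] := ltnP k v.
    rewrite middle; last by rewrite (ltnW uk) (ltnW kv).
    by have := mid k; rewrite uk kv => /(_ isT); lra.
  by rewrite last ?vk //; have := gm k ks; lra.
- split=> k /andP[uk kv].
    have [kv'|vk] := ltnP k v; last by rewrite last ?vk //; have := gm k kv; lra.
    rewrite middle; last by rewrite (ltnW uk) (ltnW kv').
    by have := mid k; rewrite uk kv' => /(_ isT); lra.
  rewrite middle; last by rewrite (ltnW uk) (ltnW kv).
  by have := gt k kv; lra.
Qed.

End Raising.
End RaisingReal.

(** In the last clause q stands for p' up to its values off [0, 1]; f_i takes q back to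
    p up to such values. *)
Definition raised p i p' := [/\ e_path i p = Some p', GLS lam p', p' 1 = p 1 + al i &
  forall q, same_on p' q -> exists2 p'', f_op i q = Some p'' & same_on p p''].

Lemma same_on_refl p q : p =1 q -> same_on p q.
Proof. by move=> pq t _. Qed.

Lemma same_on_trans p q q' : same_on p q -> same_on q q' -> same_on p q'.
Proof. by move=> h1 h2 t t01; rewrite h1 // h2. Qed.

Lemma raise_real s l a p i : wGLS s l a -> follows s l a p -> real i ->
  cr i (l 1%N) < 0 -> exists p', raised p i p'.
Proof.
move=> W0 f0 ri neg.
have {s l a W0 f0 neg} [s [l [a [m [u [v [W fp up]]]]]]] := raising_refine W0 f0 ri neg.
have ga : grid s a by case: W.
have [p' pE p'E] := raising_e_path W fp ri up; exists p'.
have [/andP[uv vs] gu gv _ _] := up.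
have fb := bend_follows ga fp i 1 uv vs.
split=> //.
- apply: (wGLS_GLS hlam (raising_wGLS W fp ri up)).
  by apply: (follows_ext ga fb); apply: same_on_refl => t; rewrite p'E.
- by rewrite p'E (bend_end p ga i 1 uv vs) gu gv mul1r opprD addNKr scaleN1r opprK.
- move=> q p'q; have bq : same_on (bend a p u v i 1) q.
    by apply: same_on_trans p'q; apply: same_on_refl => t; rewrite p'E.
  have fq := follows_ext ga fb bq.
  have [p'' fE p''E] := lowering_bend ga fq (raising_lowering W ri up bq).
  exists p'' => //; apply: (follows_uniq ga fp).
  have fb2 := bend_follows ga fq i 1 uv vs.
  have : same_on (bend a q u v i 1) p'' by apply: same_on_refl => t; rewrite p''E.
  move=> /(follows_ext ga fb2); apply: follows_change => k _.
  have [kuv|kuv] := boolP (u < k <= v)%N; last by rewrite !bend_dirs_out.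
  by rewrite !bend_dirs_in // !bend_dir1 sreflK.
Qed.

Lemma height_const s l a p i k x : grid s a -> follows s l a p -> (k <= s)%N ->
  (forall j, (0 < j <= k)%N -> l j = x) -> cr i (p (a k)) = a k * cr i x.
Proof.
move=> ga fp; elim: k => [_ _|k IH ks lx].
  by rewrite (follows_at0 ga fp) pairing0r; case: ga => -> _ _; rewrite mul0r.
rewrite (cr_next ga fp) // lx ?leqnn // IH ?(ltnW ks) //; first by lra.
by move=> j /andP[j0 jk]; apply: lx; rewrite j0 leqW.
Qed.

Lemma height_mono s l a p i j k : wGLS s l a -> follows s l a p -> ~~ real i ->
  (j <= k)%N -> (k <= s)%N -> cr i (p (a j)) <= cr i (p (a k)).
Proof.
move=> W fp ii; have ga : grid s a by case: W.
elim: k => [|k IH]; first by rewrite leqn0 => /eqP ->.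
rewrite leq_eqVlt => /orP[/eqP -> //|jk ks].
apply: le_trans (IH jk (ltnW ks)) _.
rewrite leNgt -(slope_lt0 W fp) // -leNgt.
by apply: (Torbit_imag hlam ii); apply: (dir_Torbit W); exact: leqW ks.
Qed.

(** The path goes straight in the direction r_i kap up to its breakpoint v, where its
    chain starts with the arrow from r_i kap to kap.  Then e_i replaces the direction
    by kap: the integrality condition a_v alpha_i^vee(kap) = 1 of the imaginary arrow
    puts the height at v at 1 - a_ii exactly. *)
Lemma raise_imag s l a p i v kap : wGLS s l a -> follows s l a p -> ~~ real i ->
    (0 < v <= s)%N -> (forall k, (0 < k <= v)%N -> l k = r i kap) ->
    a v * cr i kap = 1 -> Tl kap -> chain (a v) kap (l v.+1) ->
  exists p', raised p i p'.
Proof.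
move=> W fp ii v0s lmu av Tk ch; have ga : grid s a by case: W.
have /andP[v0 vs] := v0s; have av0 : 0 < a v by exact: (grid_gt0 ga).
pose b : rat := 1 - (A i i)%:~R.
have aii : (A i i)%:~R <= 0 :> rat by exact: cartan_imag.
have b1 : 1 <= b by rewrite /b; lra.
have cmu : cr i (r i kap) = b * cr i kap by rewrite cr_srefl /b; lra.
have ck : 0 < cr i kap by rewrite -(pmulr_rgt0 _ av0) av.
have gk k : (k <= v)%N -> cr i (p (a k)) = a k * cr i (r i kap).
  move=> kv; apply: (height_const i ga fp); first exact: leq_trans vs.
  by move=> j /andP[j0 jk]; apply: lmu; rewrite j0 (leq_trans jk).
have gv : cr i (p (a v)) = b by rewrite gk // cmu mulrCA av mulr1.
have g0 : cr i (p (a 0%N)) = 0 by rewrite (follows_at0 ga fp) pairing0r.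
have slopes k : (0 < k <= s)%N -> 0 <= cr i (l k).
  move=> /andP[k0 ks]; apply: (Torbit_imag hlam ii); apply: (dir_Torbit W).
  by rewrite k0 leqW.
have mu0 : 0 < cr i (r i kap) by rewrite cmu mulr_gt0 //; lra.
have l10 : 0 < cr i (l 1%N) by rewrite lmu.
have mid k : (k < v)%N -> cr i (p (a k)) < 1 - (A i i)%:~R.
  move=> kv; rewrite -/b -gv gk ?(ltnW kv) // gk // ltr_pM2r //.
  exact: (grid_lt ga).
have [p' pE p'E] := e_imag_bend ga fp ii v0s slopes l10 gv mid.
exists p'; pose c : rat := - b^-1.
have b0 : b != 0 by rewrite gt_eqF //; lra.
have back : bend_dir i c (r i kap) = kap.
  rewrite /bend_dir cmu /c mulNr mulKf // scaleNr opprK sreflE subrK //.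
have fb := bend_follows ga fp i c v0 vs.
set l' := bend_dirs l 0 v i c in fb.
have l'in k : (0 < k <= v)%N -> l' k = kap.
  by move=> kv; rewrite /l' bend_dirs_in // lmu.
have l'out k : (v < k)%N -> l' k = l k.
  by move=> vk; rewrite /l' bend_dirs_out // (leqNgt k v) vk andbF.
have W' : wGLS s l' a.
  split=> //.
  - by rewrite l'out ?ltnS //; case: W.
  - move=> k /andP[k0 ks]; have [kv|vk] := leqP k v; first by rewrite l'in // k0.
    by rewrite l'out //; apply: (dir_Torbit W); rewrite k0 leqW.
  - move=> k /andP[k0 ks]; have [kv|vk|kv] := ltngtP k v.
    + rewrite !l'in ?k0 ?(ltnW kv) //; exact: chainA_refl.
    + rewrite !l'out ?leqW //; apply: (dir_chain W); rewrite k0; exact: ks.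
    + by rewrite kv l'in ?v0 ?leqnn // l'out // ltnSn.
have bp' : same_on (bend a p 0 v i c) p' by apply: same_on_refl => t; rewrite p'E.
split=> //.
- exact: (wGLS_GLS hlam W' (follows_ext ga fb bp')).
- rewrite p'E (bend_end p ga i _ v0 vs) gv g0 subr0 mulNr mulVf //.
  by rewrite scaleN1r opprK.
- move=> q p'q; have bq := same_on_trans bp' p'q.
  have fq := follows_ext ga fb bq.
  have hq k : (k <= v)%N -> cr i (q (a k)) = a k * cr i kap.
    move=> kv; apply: (height_const i ga fq); first exact: leq_trans vs.
    by move=> j /andP[j0 jk]; apply: l'in; rewrite j0 (leq_trans jk).
  have q0 : cr i (q (a 0%N)) = 0 by rewrite (follows_at0 ga fq) pairing0r.
  have low : lowering s a q i 0 0 v.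
    split=> //; first by rewrite hq // av add0r.
      by move=> k ks; rewrite -[X in X <= _]q0; exact: (height_mono W' fq).
    split=> k /andP[k0 ks].
      apply: (lt_le_trans _ (height_mono W' fq ii k0 ks)).
      rewrite hq // mulr_gt0 //; apply: (grid_gt0 ga) => /=; exact: leq_trans vs.
    rewrite hq ?(ltnW ks) // add0r -av ltr_pM2r //; exact: (grid_lt ga).
  have [p'' fE p''E] := lowering_bend ga fq low.
  exists p'' => //; apply: (follows_uniq ga fp).
  have fb2 := bend_follows ga fq i 1 v0 vs.
  have : same_on (bend a q 0 v i 1) p'' by apply: same_on_refl => t; rewrite p''E.
  move=> /(follows_ext ga fb2); apply: follows_change => k /andP[k0 ks].
  have [kv|vk] := leqP k v; last by rewrite bend_dirs_out ?l'out // (leqNgt k v) vk andbF.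
  by rewrite bend_dirs_in ?k0 // bend_dir1 l'in ?k0 // lmu ?k0.
Qed.

Lemma straight_follows : follows 1 (fun=> lam) (fun k => k%:R) (straight lam).
Proof.
split=> [|[|//] t _ _]; first by rewrite /straight scale0r.
by rewrite /straight scale0r add0r subr0.
Qed.

Lemma straight_grid : grid 1 (fun k => k%:R : rat).
Proof. by split=> // -[|//] _; rewrite ltr01. Qed.

Lemma straight_GLS : GLS lam (straight lam).
Proof.
apply: (wGLS_GLS hlam _ straight_follows); split=> //.
- exact: straight_grid.
- by move=> k _; exact: Torbit_lam.
- by move=> k _; exact: chainA_refl.
Qed.

Lemma follows_straight s l a p : grid s a -> follows s l a p ->
  (forall k, (0 < k <= s)%N -> l k = lam) -> same_on p (straight lam).
Proof.
move=> ga fp ll; apply: (follows_uniq ga fp); split; first by rewrite /straight scale0r.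
by move=> k t ks _; rewrite ll //= /straight -scalerDl addrC subrK.
Qed.

(** Either some real i has negative pairing with the first direction, or e_i is given
    by the first arrow out of it, at the first breakpoint with a nonempty chain.  If
    all chains are empty then all directions are lam. *)
Lemma raise_exists p : GLS lam p ->
  same_on p (straight lam) \/ exists i p', raised p i p'.
Proof.
move=> /(GLS_wGLS hlam) [s [l [a [W fp]]]]; have ga : grid s a by case: W.
have s0 := grid_pos ga.
have [[i /andP[ri neg]]|/forallNP dom] := pselect (exists i, real i && (cr i (l 1%N) < 0)).
  by right; exists i; exact: raise_real W fp ri neg.
have [nconst|const] := pselect (exists k, (0 < k <= s)%N && (l k != l k.+1)); last first.
  left; apply: (follows_straight ga fp).
  have step k : (0 < k <= s)%N -> l k = l k.+1.
    move=> ks; apply/eqP; apply: contraT => ne; case: const; exists k.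
    by rewrite ks.
  move=> k /andP[k0 ks]; have lE : l s.+1 = lam by case: W.
  have eq n : (k <= n)%N -> (n <= s.+1)%N -> l k = l n.
    elim: n => [|n IH]; first by rewrite leqNgt k0.
    rewrite leq_eqVlt => /orP[/eqP -> //|kn] ns.
    rewrite (IH kn (ltnW ns)); apply: step.
    by rewrite (leq_trans k0 kn).
  by rewrite (eq s.+1) // leqW.
have [v /andP[vs ne] vmin] := ex_minnP nconst.
have mu k : (0 < k <= v)%N -> l k = l 1%N.
  case: k => // k; elim: k => // k IH kv; rewrite -IH; last exact: ltnW.
  apply/eqP; rewrite eq_sym; apply: contraT => nk.
  have := vmin k.+1; rewrite nk /= (leq_trans (ltnW kv)) ?(andP vs).2 // => /(_ isT).
  have kv' : (k.+1 < v)%N by [].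
  by rewrite leqNgt kv'.
right; case/andP: (vs) => v0 vs'; have lv : l v = l 1%N by apply: mu; rewrite v0 leqnn.
have arr : exists2 kap, arrowA lam (a v) (l v) kap & chain (a v) kap (l v.+1).
  move: (dir_chain W vs) ne; case=> [x|x kap y ar ch _]; first by rewrite eqxx.
  by exists kap.
have [kap ar ch] := arr.
have mdom (j : I) : real j -> 0 <= cr j (l v).
  by move=> rj; rewrite lv leNgt; apply/negP => neg; apply: (dom j); rewrite rj.
have [i [ii lr ai]] := arrowA_dominant hlam ar mdom.
exists i; apply: (raise_imag W fp ii vs _ ai _ ch); last by case: ar.
by move=> k kv; rewrite (mu k kv) -lv.
Qed.

(** * Weights of the paths *)

Lemma ht_path s l a p k : wGLS s l a -> follows s l a p -> (k <= s)%N ->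
  ht (p (a k)) <= a k * ht lam.
Proof.
move=> W fp; have ga : grid s a by case: W.
elim: k => [_|k IH ks].
  by rewrite (follows_at0 ga fp) ht0; case: ga => -> _ _; rewrite mul0r.
rewrite (follows_next ga fp) // htD htZ; have := IH (ltnW ks).
have : 0 <= ht (lam - l k.+1).
  by apply/Qplus_ht/(Torbit_le hlam); apply: (dir_Torbit W); exact: leqW ks.
have : 0 < a k.+1 - a k by rewrite subr_gt0; case: ga => _ _; apply.
rewrite htB; move: (a k.+1) (a k) (ht _) (ht lam) (ht (l _)) => x y h0 h1 h2 xy d0 d1.
have : 0 <= (x - y) * (h1 - h2) by rewrite mulr_ge0 // ltW.
by lra.
Qed.

Lemma ht_end p : GLS lam p -> ht (p 1) <= ht lam.
Proof.
move=> /(GLS_wGLS hlam) [s [l [a [W fp]]]]; have := ht_path W fp (leqnn s).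
by case: W => -[_ -> _] _ _ _; rewrite mul1r.
Qed.

Lemma raised_ht p i p' : raised p i p' -> ht (p' 1) = ht (p 1) + 1.
Proof. by case=> _ _ -> _; rewrite htD ht_root. Qed.

(** Induction on the height of lam - p(1), which drops by 1 at each raising. *)
Lemma GLS_orbit p : GLS lam p ->
  exists w q, f_word w (straight lam) = Some q /\ same_on p q.
Proof.
move=> Gp; have [n hn] : exists n : nat, ht lam - ht (p 1) < n%:R.
  by exists (Num.truncn (ht lam - ht (p 1))).+1; rewrite truncnS_gt.
elim: n p Gp hn => [|n IH] p Gp hn; first by have := ht_end Gp; lra.
have [st|[i [p' rp]]] := raise_exists Gp; first by exists [::], (straight lam).
have h' := raised_ht rp; have [_ Gp' _ fq] := rp.
have [|w [q [wq p'q]]] := IH p' Gp'; first by move: hn; rewrite -natr1; lra.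
have [q' qE pq'] := fq q p'q.
by exists (i :: w), q'; split=> //; rewrite /= wq.
Qed.

Lemma orbit_GLS w q : f_word w (straight lam) = Some q -> GLS lam q.
Proof.
elim: w q => [|i w IH] q /=; first by case=> <-; exact: straight_GLS.
case E : (f_word w (straight lam)) => [q0|//] /= h.
exact: f_op_GLS (IH _ E) h.
Qed.

(** A path ending at lam cannot be raised. *)
Lemma end_straight p : GLS lam p -> p 1 = lam -> same_on p (straight lam).
Proof.
move=> Gp p1; have [//|[i [p' rp]]] := raise_exists Gp.
have [_ Gp' _ _] := rp; have := ht_end Gp'.
by rewrite (raised_ht rp) p1; lra.
Qed.

(** * Reparametrization *)

Lemma reparam_01 phi t : reparam phi -> 0 <= t <= 1 -> 0 <= phi t <= 1.
Proof.
move=> [[p0 p1] mono _ _] /andP[t0 t1].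
by rewrite -{1}p0 -p1 !mono ?lexx ?ler01.
Qed.

Lemma reparam_id : reparam id.
Proof.
split=> // [t _ e e0|y y01]; last by exists y.
by exists e.
Qed.

Lemma same_on_path p q : same_on p q -> same_path p q.
Proof. by move=> pq; exists id, id; split; [exact: reparam_id | exact: reparam_id | exact: pq]. Qed.

Lemma same_path_on_r p q q' : same_path p q -> same_on q q' -> same_path p q'.
Proof.
move=> [phi [psi [hp hq pq]]] qq'; exists phi, psi; split=> // t t01.
by rewrite pq // qq' //; exact: reparam_01.
Qed.

Lemma same_path_end p q : same_path p q -> p 1 = q 1.
Proof.
move=> [phi [psi [[[_ p1] _ _ _] [[_ q1] _ _ _] pq]]].
by have := pq 1; rewrite p1 q1 lexx ler01 => ->.
Qed.

(** * The highest weight path *)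

(** The path produced from the straight one by e_i, if any, ends at lam + alpha_i.
    This is clear unless e_i is imaginary and its bent piece extends up to the time 1,
    where the inverse of r_i adds alpha_i because alpha_i^vee(lam) = 1 - a_ii. *)
Lemma e_path_end p p' i : same_on p (straight lam) -> e_path i p = Some p' ->
  p' 1 = lam + al i.
Proof.
move=> ps; pose c := cr i lam; have c0 : 0 <= c by case: (hlam i).
have h t : 0 <= t <= 1 -> height i p t = t * c.
  by move=> t01; rewrite /height ps // /straight pairingZr.
have r0 : 0 <= (0 : rat) <= 1 by rewrite lexx ler01.
have r1 : 0 <= (1 : rat) <= 1 by rewrite lexx ler01.
have mE : min_height i p = 0.
  apply: xget_unique => [|n [[t t01 ht] hn]].
    split=> [|n t t01 ht]; first by exists 0 => //; rewrite h // mul0r.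
    by rewrite -(ler_int rat) -ht h // mulr_ge0 //; case/andP: t01.
  apply/le_anti; rewrite (hn 0 0) ?h ?mul0r //=.
  by rewrite -(ler_int rat) -ht h // mulr_ge0 //; case/andP: t01.
have p0 : p 0 = 0 by rewrite ps // /straight scale0r.
have p1 : p 1 = lam by rewrite ps // /straight scale1r.
rewrite /e_path; case: ifP => ri.
  rewrite /e_real mE (@leastE _ 0) ?eqxx // => [|t [/andP[]] //].
  by split=> //; rewrite h // mul0r.
have aii : (A i i)%:~R <= 0 :> rat by apply: cartan_imag; rewrite ri.
rewrite /e_imag mE.
move: c0; rewrite le_eqVlt => /orP[/eqP c0|c0].
  have -> : f_plus i p = 1.
    rewrite /f_plus mE; apply: greatestE; first by split=> //; rewrite h // -c0 mulr0.
    by move=> t [/andP[]].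
  by case: asboolP => // -[]; left.
have -> : f_plus i p = 0.
  rewrite /f_plus mE; apply: greatestE; first by split=> //; rewrite h // mul0r.
  move=> t [t01]; rewrite h // => /eqP; rewrite mulf_eq0 => /orP[/eqP -> //|].
  by rewrite gt_eqF.
case: asboolP => // /not_orP[_ low].
have cb : 1 - (A i i)%:~R <= c.
  rewrite leNgt; apply/negP => hc; apply: low => t t01; rewrite h // add0r.
  apply: le_lt_trans hc; case/andP: t01 => t0 t1.
  by rewrite -[X in _ <= X]mul1r ler_wpM2r // ltW.
set b := (1 - (A i i)%:~R) / c.
have b0 : 0 < b by rewrite divr_gt0 //; lra.
have b1 : b <= 1 by rewrite ler_pdivrMr // mul1r.
have bc : b * c = 1 - (A i i)%:~R by rewrite divfK // gt_eqF.
have -> : least [set t | 0 <= t <= 1 /\ height i p t = 0 + 1 - (A i i)%:~R] = b.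
  apply: leastE; first by split; rewrite ?h ?b1 ?ltW // bc add0r.
  move=> t [t01]; rewrite h // add0r -bc => e.
  by rewrite -(ler_pM2r c0) e.
case: asboolP => // _ [<-]; rewrite ler10 p1.
case: ifP => // h1; have b1' : b = 1 by apply/le_anti; rewrite b1.
rewrite p0 add0r subr0 /srefl_inv -/c.
suff -> : c = 1 - (A i i)%:~R by rewrite mulVf ?scale1r // gt_eqF //; lra.
by rewrite -bc b1' mul1r.
Qed.

Lemma straight_e_op p i : same_on p (straight lam) -> e_op lam i p = None.
Proof.
move=> ps; rewrite /e_op; case E : (e_path i p) => [p'|//] /=.
case: asboolP => // -[q Gq pq]; have := ht_end Gq.
rewrite -(same_path_end pq) (e_path_end ps E) htD ht_root.
by rewrite gerDl ler10.
Qed.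

Lemma raised_e_op p i p' : raised p i p' -> e_op lam i p = Some p'.
Proof.
move=> [pE Gp' _ _]; rewrite /e_op pE /=; case: asboolP => // -[].
by exists p' => //; exact: same_on_path.
Qed.

Lemma e_op_none_straight p : GLS lam p ->
  (forall i, e_op lam i p = None) <-> same_on p (straight lam).
Proof.
move=> Gp; split=> [h|ps i]; last exact: straight_e_op.
have [//|[i [p' rp]]] := raise_exists Gp.
by have := h i; rewrite (raised_e_op rp).
Qed.

End RaisingAndOrbit.

Theorem proposition6p3p5 (I : countType) (A : I -> I -> int)
    (hA : borcherds_cartan A) (D : realization A)
    (lam : dual (cartan D)) (hlam : dominant lam) :
  [/\ forall pi : gpath D, GLS lam pi ->
        ((forall i, e_op lam i pi = None) <-> same_path pi (straight lam)),
      up_to_reparam [set pi : gpath D | GLS lam pi /\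
                                       forall i, e_op lam i pi = None]
        = up_to_reparam [set straight lam] &
      up_to_reparam (GLS lam) = up_to_reparam (F_orbit (straight lam))].
Proof.
split.
- move=> p Gp; rewrite (e_op_none_straight hlam Gp); split; first exact: same_on_path.
  move=> /same_path_end p1; apply: (end_straight hlam Gp).
  by rewrite p1 /straight scale1r.
- rewrite predeqE => p; split=> [[q [Gq /(e_op_none_straight hlam Gq) qs] pq]|[_ -> ps]].
    by exists (straight lam) => //; exact: same_path_on_r pq qs.
  have Gs := straight_GLS hlam; exists (straight lam) => //; split=> //.
  by apply/(e_op_none_straight hlam Gs).
- rewrite predeqE => p; split=> [[q Gq pq]|[q [w wq] pq]].
    have [w [q' [wq' qq']]] := GLS_orbit hlam Gq.
    by exists q'; [exists w | exact: same_path_on_r pq qq'].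
  by exists q => //; exact: (orbit_GLS hlam wq).
Qed.
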